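(* Let $G(s)$ be a real rational transfer function whose impulse response belongs to $L_1[0,\infty)$, and let $\Phi:\mathbb{R}\to\mathbb{R}$ satisfy $\Phi(0)=0$, $|\Phi(r)|\le C|r|$ for all real $r$ for some $C>0$, and $(r-s)[\Phi(r)-\Phi(s)]\ge0$ for all real $r,s$. Suppose the stability of the integer order Lur'e system formed by $G(s)$ and $\Phi$ is established by the Zames-Falb theorem with an integer order (real rational) $Z(s)$, i.e. there are a BIBO-stable $Z(s)$ whose impulse response $z$ is nonnegative with $\|z\|_1=\int_0^\infty|z(t)|\,dt<1$, and $\varepsilon>0$, such that $\mathrm{Re}\left\{[1-Z(\hat{j}\omega)]G(\hat{j}\omega)\right\}\ge\varepsilon>0$ for all $\omega\in\mathbb{R}$. Then for every $0<\alpha<1$ the corresponding fractional order Lur'e system, formed by the linear subsystem with transfer function $G(s^\alpha)$ and the same $\Phi$, is stable: for all $u_1,u_2\in L_2$, $e_1,e_2\in L_2$.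
   Context: Lur'e system: real signals (vanishing for $t<0$) satisfying $e_1=u_1-y_2$, $e_2=u_2+y_1$, $y_1=g*e_1$ with $g$ the impulse response (inverse Laplace transform) of the transfer function of the linear subsystem, and $y_2(t)=\Phi(e_2(t))$. It is assumed that for all $u_1,u_2\in L_2$ one has $e_1,e_2\in L_{2e}$, where $L_{2e}$ is the set of functions square integrable on every compact set. A linear system is BIBO stable if and only if its impulse response is in $L_1$. $\hat{j}=\sqrt{-1}$; $s^\alpha$ is the principal value ($s=re^{\hat{j}\theta}$, $-\pi<\theta\le\pi$, $s^\alpha=r^\alpha e^{\hat{j}\alpha\theta}$). *)

(* Defs.v *)
From HB Require Import structures.
From mathcomp Require Import all_boot all_order all_algebra.
From mathcomp Require Import all_classical all_reals all_analysis.
From mathcomp Require Import complex.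

Set Implicit Arguments.
Unset Strict Implicit.
Unset Printing Implicit Defensive.

Import Order.TTheory GRing.Theory Num.Theory.
Import numFieldNormedType.Exports.

Local Open Scope classical_set_scope.
Local Open Scope ring_scope.
Local Open Scope complex_scope.

Local Notation leb R := (@lebesgue_measure R).

(** * Complex powers *)

(* The principal argument, in ]-pi, pi]; its value at 0 is irrelevant. *)
Definition carg (R : realType) (s : R[i]) : R :=
  let a := acos (complex.Re s / ComplexField.Normc.normc s) in
  if 0 <= complex.Im s then a else - a.

(* The principal value of s ^ a: r ^ a * exp(i a theta) for
   s = r * exp(i theta), -pi < theta <= pi. *)
Definition cpow (R : realType) (s : R[i]) (a : R) : R[i] :=
  (ComplexField.Normc.normc s `^ a)%:C *
  (cos (a * carg s) +i* sin (a * carg s)).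

(** * Real rational transfer functions *)

(* A real rational function, in lowest terms, so that evaluating the quotient
   (where Rocq's division by 0 gives 0) is only conventional at genuine
   poles. *)
Record ratfun (R : realType) := RatFun {
  rf_num : {poly R};
  rf_den : {poly R};
  rf_den_neq0 : rf_den != 0;
  rf_coprime : coprimep rf_num rf_den
}.

Definition rf_eval (R : realType) (G : ratfun R) (s : R[i]) : R[i] :=
  (map_poly (real_complex R) (rf_num G)).[s] /
  (map_poly (real_complex R) (rf_den G)).[s].

(** * Signals *)

Definition causal (R : realType) (f : R -> R) : Prop :=
  forall t, t < 0 -> f t = 0.

Definition L1 (R : realType) (f : R -> R) : Prop := f \in Lfun (leb R) 1.

Definition L2 (R : realType) (f : R -> R) : Prop := f \in Lfun (leb R) 2%:E.

(* The restriction f \_ K is f on K and 0 outside. *)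
Definition L2e (R : realType) (f : R -> R) : Prop :=
  measurable_fun setT f /\ forall K : set R, compact K -> L2 (f \_ K).

(** * Impulse responses *)

(* The causal impulse response ir_dirac * delta(t) + ir_fun t.  A biproper
   rational function such as (s + 2) / (s + 1) has a Dirac component at 0
   (its direct feedthrough), whereas the transform of an integrable function
   tends to 0 along the imaginary axis. *)
Record impulse (R : realType) := Impulse {
  ir_dirac : R;
  ir_fun : R -> R
}.

(* The unilateral Laplace transform, real and imaginary parts of
   exp(- s t) = exp(- Re s t) (cos (Im s t) - i sin (Im s t)). *)
Definition laplace (R : realType) (f : R -> R) (s : R[i]) : R[i] :=
  (\int[leb R]_(t in `[0, +oo[)
     (expR (- complex.Re s * t) * cos (complex.Im s * t) * f t)) +i*
  (- \int[leb R]_(t in `[0, +oo[)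
     (expR (- complex.Re s * t) * sin (complex.Im s * t) * f t)).

(* h is an inverse Laplace transform of H: on some right half-plane the
   transform of h converges absolutely and equals H. *)
Definition impulse_response (R : realType) (H : R[i] -> R[i])
    (h : impulse R) : Prop :=
  [/\ measurable_fun setT (ir_fun h), causal (ir_fun h) &
    exists sigma : R, forall s : R[i], sigma < complex.Re s ->
      (leb R).-integrable `[0, +oo[
        (fun t => (expR (- complex.Re s * t) * ir_fun h t)%:E) /\
      H s = (ir_dirac h)%:C + laplace (ir_fun h) s].

Definition ir_L1 (R : realType) (h : impulse R) : Prop := L1 (ir_fun h).

Definition ir_norm1 (R : realType) (h : impulse R) : \bar R :=
  (`|ir_dirac h|%:E + \int[leb R]_(t in `[0%R, +oo[) `|ir_fun h t|%:E)%E.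

Definition ir_nonneg (R : realType) (h : impulse R) : Prop :=
  0 <= ir_dirac h /\ forall t, 0 <= ir_fun h t.

Definition ir_conv (R : realType) (h : impulse R) (f : R -> R) (t : R) : R :=
  ir_dirac h * f t + \int[leb R]_(x in `[0, t]) (ir_fun h (t - x) * f x).

(** * Lur'e systems *)

(* The equations hold almost everywhere: signals in L2 and L2e, and the
   convolution of a locally integrable kernel with such a signal, are only
   determined up to null sets. *)
Definition lure_system (R : realType) (h : impulse R) (Phi : R -> R)
    (u1 u2 e1 e2 y1 y2 : R -> R) : Prop :=
  [/\ [/\ causal u1 & causal u2], [/\ causal e1 & causal e2],
      [/\ causal y1 & causal y2] &
      {ae leb R, forall t, [/\ e1 t = u1 t - y2 t, e2 t = u2 t + y1 t,
                               y1 t = ir_conv h e1 t & y2 t = Phi (e2 t)]}].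

(* Stability of the feedback loop of the linear subsystem with transfer
   function H and the nonlinearity Phi, under the standing assumption that
   e1 and e2 belong to L2e. *)
Definition lure_stable (R : realType) (H : R[i] -> R[i]) (Phi : R -> R) :
    Prop :=
  forall h : impulse R, impulse_response H h ->
  forall u1 u2 e1 e2 y1 y2 : R -> R,
    lure_system h Phi u1 u2 e1 e2 y1 y2 ->
    L2 u1 -> L2 u2 -> L2e e1 -> L2e e2 ->
    L2 e1 /\ L2 e2.

(* Main.v *)
(** Write N for the truncated binomial series of 1 - (1 - X)^alpha.  At
    x = exp(- s delta) and with lambda = delta^(- alpha), the number
    lambda (1 - N(x)) approximates s^alpha.  On the other hand the transform of a
    causal integrable f at lambda (1 - x) is a power series in x whose
    coefficients (integrals of f against Poisson weights) have l^1 norm at most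
    ||f||_1 and are nonnegative if f is.  Composing with N therefore yields
    polynomials E and zeta in the delay by delta that approximate G(s^alpha) and
    Z(s^alpha): E is bounded in l^1, and zeta has nonnegative coefficients of
    sum at most 1.  Since |N| <= 1 on the unit circle, lambda (1 - N) stays in the
    closed right half-plane, where Re (1 - Z) G >= eps by the Poisson formula;
    hence Re (1 - zeta) E >= eps / 2 on the unit circle.

    Convergence of the transforms of E at s0 + n, n = 0, 1, 2, ..., together with
    the l^1 bound and the Weierstrass theorem in exp(- t), determines the limit
    of E as a functional on test functions.  So the impulse response h of
    G(s^alpha) is integrable, and the operators E converge strongly to the
    convolution with h on L2(0, T).

    The Zames-Falb argument is then run with the delay multiplier 1 - zeta: the
    convex primitive of Phi gives <Phi(x), x - zeta x> >= 0 for the truncated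
    x = e2, the Toeplitz form of (1 - zeta) E gives the coercivity, and
    ||Phi(x)|| is bounded uniformly in T. *)

Require Import Defs.
From HB Require Import structures.
From mathcomp Require Import all_boot all_order all_algebra.
From mathcomp Require Import all_classical all_reals all_analysis.
From mathcomp Require Import complex ring lra measurable_realfun.
From mathcomp Require separable cyclic cyclotomic.

Set Implicit Arguments.
Unset Strict Implicit.
Unset Printing Implicit Defensive.

Import Order.TTheory GRing.Theory Num.Theory.
Import numFieldNormedType.Exports.

Local Open Scope classical_set_scope.
Local Open Scope ring_scope.
Local Open Scope complex_scope.

(** * Integration and convolution on the line *)

(** The direct route would use the multiplier Z(s^alpha). Its impulse response is nonnegative
    because exp(- t s^alpha) is the transform of a probability density, that of a stable
    subordinator, in general without elementary formula. The delay discretisation puts a discrete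
    law in its place: for 0 < alpha < 1 the series 1 - (1 - X)^alpha has nonnegative coefficients of
    sum 1, so substituting its truncation N preserves both nonnegativity and l^1 bounds. At the
    outset the response h of G(s^alpha) is known through its transform on some right half-plane,
    without integrability. The approximants are therefore compared with h at real points, where
    s^alpha is an ordinary power, and they converge to h weakly, as measures. E alone passes to the
    limit: each zeta serves as a multiplier for its own E. Delays also keep the frequency-domain
    step finite: positivity on the circle becomes positivity of Toeplitz forms, checked at roots of
    unity. The half in eps / 2 pays for truncating the power series in x. *)

Section integral_on_the_line.
Context {R : realType}.
Notation mu := (@lebesgue_measure R).
Implicit Types f g : R -> R.

Lemma aeS (P Q : R -> Prop) : (forall x, P x -> Q x) ->
  {ae mu, forall x, P x} -> {ae mu, forall x, Q x}.
Proof. exact: (@filterS _ _ (ae_filter_ringOfSetsType mu)). Qed.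

Lemma aeS2 (P Q S : R -> Prop) : (forall x, P x -> Q x -> S x) ->
  {ae mu, forall x, P x} -> {ae mu, forall x, Q x} -> {ae mu, forall x, S x}.
Proof. exact: (@filterS2 _ _ (ae_filter_ringOfSetsType mu)). Qed.

(** Real-valued counterparts of the extended-real notions, always on the whole line: restrictions to
    subsets are written as indicator factors, so that one set of linearity lemmas serves
    throughout. *)
Definition intg f : Prop := mu.-integrable setT (EFin \o f).
Definition itg f : R := \int[mu]_x f x.

Lemma intg_meas f : intg f -> measurable_fun setT f.
Proof. by move/measurable_int/measurable_EFinP. Qed.

Lemma intg_le f g : measurable_fun setT f -> (forall x, `|f x| <= g x) ->
  intg g -> intg f.
Proof.
move=> mf fg ig; apply: (le_integrable measurableT _ _ ig).
  exact/measurable_EFinP.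
by move=> x _; rewrite !lee_fin (le_trans (fg x))// ler_norm.
Qed.

Lemma intg_eq f g : f =1 g -> intg f -> intg g.
Proof. by move=> fg; have -> : g = f by apply/funext. Qed.

Lemma itg_eq f g : f =1 g -> itg f = itg g.
Proof. by move=> fg; have -> : g = f by apply/funext. Qed.

Lemma intgD f g : intg f -> intg g -> intg (fun x => f x + g x).
Proof.
move=> fi gi; have := integrableD measurableT fi gi.
by apply: eq_integrable => //.
Qed.

Lemma intgZ (c : R) f : intg f -> intg (fun x => c * f x).
Proof.
move=> fi; have := integrableZl measurableT c fi.
by apply: eq_integrable => //.
Qed.

Lemma intgN f : intg f -> intg (fun x => - f x).
Proof. by move=> fi; apply: intg_eq (intgZ (-1) fi) => x; rewrite mulN1r. Qed.

Lemma intgB f g : intg f -> intg g -> intg (fun x => f x - g x).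
Proof. by move=> fi gi; exact: intgD fi (intgN gi). Qed.

Lemma intg_norm f : intg f -> intg (fun x => `|f x|).
Proof. exact: integrable_norm. Qed.

Lemma intg0 : intg (fun=> 0).
Proof. exact: integrable0. Qed.

Lemma intg_sum (I : Type) (s : seq I) (h : I -> R -> R) :
  (forall i, intg (h i)) -> intg (fun x => \sum_(i <- s) h i x).
Proof.
move=> hi; elim: s => [|i s IH].
  by apply: intg_eq intg0 => x; rewrite big_nil.
by apply: intg_eq (intgD (hi i) IH) => x; rewrite big_cons.
Qed.

Lemma itgD f g : intg f -> intg g -> itg (fun x => f x + g x) = itg f + itg g.
Proof. by move=> fi gi; exact: RintegralD. Qed.

Lemma itgB f g : intg f -> intg g -> itg (fun x => f x - g x) = itg f - itg g.
Proof. by move=> fi gi; exact: RintegralB. Qed.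

Lemma itgZ (c : R) f : intg f -> itg (fun x => c * f x) = c * itg f.
Proof. by move=> fi; exact: RintegralZl. Qed.

Lemma itg0 : itg (fun=> 0) = 0.
Proof. by rewrite /itg Rintegral_cst// mul0r. Qed.

Lemma itg_sum (I : Type) (s : seq I) (h : I -> R -> R) :
  (forall i, intg (h i)) ->
  itg (fun x => \sum_(i <- s) h i x) = \sum_(i <- s) itg (h i).
Proof.
move=> hi; elim: s => [|i s IH].
  rewrite big_nil -[RHS]itg0.
  by apply: itg_eq => x; rewrite big_nil.
rewrite big_cons -IH -itgD//; last exact: intg_sum.
by apply: itg_eq => x; rewrite big_cons.
Qed.

Lemma itg_ge0 f : (forall x, 0 <= f x) -> 0 <= itg f.
Proof. by move=> f0; apply: Rintegral_ge0. Qed.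

Lemma itg_le f g : intg f -> intg g -> (forall x, f x <= g x) -> itg f <= itg g.
Proof. by move=> fi gi fg; apply: le_Rintegral. Qed.

Lemma itg_norm f : intg f -> `|itg f| <= itg (fun x => `|f x|).
Proof. by move=> fi; exact: le_normr_Rintegral. Qed.

Lemma itg_norm_le f g : intg f -> intg g -> (forall x, `|f x| <= g x) ->
  `|itg f| <= itg g.
Proof.
move=> fi gi fg; apply: le_trans (itg_norm fi) _.
by apply: itg_le => //; exact: intg_norm.
Qed.

Lemma intgM_bdd f (k : R -> R) (B : R) : intg f -> measurable_fun setT k ->
  (forall x, `|k x| <= B) -> intg (fun x => f x * k x).
Proof.
move=> fi mk kB; apply: (@intg_le _ (fun x => B * `|f x|)).
- by apply: measurable_funM => //; exact: intg_meas.
- by move=> x; rewrite normrM mulrC ler_wpM2r.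
- exact/intgZ/intg_norm.
Qed.

Lemma itg_ae f g : measurable_fun setT f -> measurable_fun setT g ->
  {ae mu, forall x, f x = g x} -> itg f = itg g.
Proof.
move=> mf mg fg; rewrite /itg /Rintegral; congr fine.
apply: ae_eq_integral => //; [exact/measurable_EFinP|exact/measurable_EFinP|].
by apply: aeS fg => x /= -> _.
Qed.

Lemma intg_ae f g : measurable_fun setT g ->
  {ae mu, forall x, f x = g x} -> intg f -> intg g.
Proof.
move=> mg fg fi; have mf := intg_meas fi.
move: fi => /integrableP[_ foo]; apply/integrableP; split.
  exact/measurable_EFinP.
rewrite (@ae_eq_integral _ _ _ mu setT (fun x => `|(EFin \o f) x|%E))//.
- by apply: measurableT_comp => //; exact/measurable_EFinP.
- by apply: measurableT_comp => //; exact/measurable_EFinP.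
- by apply: aeS fg => x /= -> _.
Qed.

Lemma intg_EFin f : intg f -> (\int[mu]_x (f x)%:E = (itg f)%:E)%E.
Proof. by move=> fi; rewrite /itg /Rintegral fineK//; exact: integrable_fin_num. Qed.

Lemma intg_nneg f : measurable_fun setT f -> (forall x, 0 <= f x) ->
  (\int[mu]_x (f x)%:E < +oo)%E -> intg f.
Proof.
move=> mf f0 fo; apply/integrableP; split; first exact/measurable_EFinP.
by under eq_integral => x _ do rewrite /= ger0_norm//.
Qed.

Lemma itg_dct (u : nat -> R -> R) f g :
  (forall n, measurable_fun setT (u n)) -> measurable_fun setT f ->
  (forall x, u n x @[n --> \oo] --> f x) -> intg g ->
  (forall n x, `|u n x| <= g x) ->
  intg f /\ itg (u n) @[n --> \oo] --> itg f.
Proof.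
move=> mu_ mf uf ig ug.
have muE n : measurable_fun setT (EFin \o u n) by exact/measurable_EFinP.
have mfE : measurable_fun setT (EFin \o f) by exact/measurable_EFinP.
have ufE : {ae mu, forall x, setT x -> (EFin \o u n) x @[n --> \oo] --> (EFin \o f) x}.
  by apply: aeW => x _; apply: cvg_EFin; [exact: nearW|exact: uf].
have ugE : {ae mu, forall x n, setT x -> (`|(EFin \o u n) x| <= (EFin \o g) x)%E}.
  by apply: aeW => x n _ /=; rewrite lee_fin.
have [fi _ cv] := @dominated_convergence _ _ R mu setT measurableT
  (fun n => EFin \o u n) (EFin \o f) (EFin \o g) muE mfE ufE ig ugE.
split => //.
have {}cv : (\int[mu]_x (u n x)%:E)%E @[n --> \oo] --> (itg f)%:E.
  by rewrite -(intg_EFin fi).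
exact: fine_cvg cv.
Qed.

Lemma itg_pushforward (phi : R -> R) f : measurable_fun setT phi ->
  (forall A, measurable A -> mu (phi @^-1` A) = mu A) ->
  intg f -> intg (f \o phi) /\ itg (f \o phi) = itg f.
Proof.
move=> mphi inv fi; have mf := intg_meas fi.
have E : forall h : R -> \bar R, measurable_fun setT h -> (forall x, 0 <= h x)%E ->
    (\int[mu]_x h (phi x) = \int[mu]_x h x)%E.
  move=> h mh h0; rewrite -[LHS](@ge0_integral_pushforward _ _ (measurableTypeR R) (measurableTypeR R) R phi mphi mu setT h) //.
  by apply: eq_measure_integral => A mA _; exact: inv.
have fpi : intg (f \o phi).
  apply/integrableP; split.
    by apply/measurable_EFinP; exact: measurableT_comp.
  rewrite (E (fun x => `|(f x)%:E|)%E)//; first by case/integrableP: fi.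
  by apply: measurableT_comp => //; exact/measurable_EFinP.
split=> //; rewrite /itg /Rintegral; congr fine.
have mE : measurable_fun setT (EFin \o f) by exact/measurable_EFinP.
rewrite -[LHS](@integral_pushforward _ _ (measurableTypeR R) (measurableTypeR R) R
  phi mphi mu setT (EFin \o f) mE fpi) //.
by apply: eq_measure_integral => A mA _; exact: inv.
Qed.

(** The pushforward under a translation gives every half-open interval its length, and Lebesgue
    measure is the only measure that does. *)
Lemma mu_shift (c : R) (A : set R) : measurable A ->
  mu ((fun x => x - c) @^-1` A) = mu A.
Proof.
have mphi : @measurable_fun _ _ (measurableTypeR R) (measurableTypeR R) setT
  (fun x : R => x - c) by exact: measurable_funB.
pose phi : {mfun _ >-> _} := HB.pack_for {mfun measurableTypeR R >-> measurableTypeR R}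
  (fun x : R => x - c) (isMeasurableFun.Build _ _ _ _ _ mphi).
move=> mA; symmetry.
apply: (@lebesgue_measure_unique R (pushforward mu phi)) => // X [[a b] /= _ <-].
rewrite /pushforward /=.
have -> : (fun x : R => x - c) @^-1` `]a, b] = `]a + c, b + c]%classic.
  by apply/seteqP; split => x /=; rewrite !in_itv /= ltrBrDr lerBlDr.
by rewrite !lebesgue_measure_itv /= !lte_fin ltrD2r -!EFinD; case: ifP => // _; congr (_%:E); ring.
Qed.

Lemma mu_opp (A : set R) : measurable A -> mu (-%R @^-1` A) = mu A.
Proof. by move=> mA; rewrite -[RHS](lebesgue_measureN mA). Qed.

Lemma intg_shift c f : intg f -> intg (fun x => f (x - c)).
Proof.
move=> fi; have := itg_pushforward _ (@mu_shift c) fi.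
by case=> //; exact: measurable_funB.
Qed.

Lemma itg_shift c f : intg f -> itg (fun x => f (x - c)) = itg f.
Proof.
move=> fi; have := itg_pushforward _ (@mu_shift c) fi.
by case=> //; exact: measurable_funB.
Qed.

Lemma itg_refl c f : intg f ->
  intg (fun x => f (c - x)) /\ itg (fun x => f (c - x)) = itg f.
Proof.
move=> fi; have [|fi1 fe1] := itg_pushforward _ mu_opp fi.
  exact: measurable_funN.
have [|fi2 fe2] := itg_pushforward _ (@mu_shift c) fi1; first exact: measurable_funB.
have E : (f \o -%R) \o (fun x => x - c) = fun x => f (c - x).
  by apply/funext => x /=; rewrite opprB.
by rewrite -E -fe1.
Qed.

End integral_on_the_line.

(** * Fubini's theorem and the convolution of integrable functions *)

Section fubini_and_convolution.
Context {R : realType}.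
Notation mu := (@lebesgue_measure R).
Implicit Types f g : R -> R.

Lemma fubini_abs (F : R * R -> R) : measurable_fun setT F ->
  (forall x, intg (fun y => F (x, y))) ->
  intg (fun x => itg (fun y => `|F (x, y)|)) ->
  (mu \x mu)%E.-integrable setT (EFin \o F).
Proof.
move=> mF Fx FI; apply/(@integrable12ltyP _ _ (measurableTypeR R) (measurableTypeR R) R mu mu).
  exact/measurable_EFinP.
under eq_integral => x _.
  rewrite (_ : (\int[mu]_y _)%E = (itg (fun y => `|F (x, y)|))%:E); last first.
    by rewrite -intg_EFin //; exact: intg_norm.
  over.
by rewrite (intg_EFin FI) ltry.
Qed.

(* The value at the exceptional [x] is irrelevant: [itg] is total. *)
Lemma fubini_swap (F : R * R -> R) :
  (mu \x mu)%E.-integrable setT (EFin \o F) ->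
  [/\ {ae mu, forall x, intg (fun y => F (x, y))},
      {ae mu, forall y, intg (fun x => F (x, y))},
      intg (fun x => itg (fun y => F (x, y))),
      intg (fun y => itg (fun x => F (x, y))) &
      itg (fun x => itg (fun y => F (x, y))) =
      itg (fun y => itg (fun x => F (x, y)))].
Proof.
move=> iF.
have a1 := @ae_integrable1 _ _ (measurableTypeR R) (measurableTypeR R) R mu mu _ iF.
have a2 := @ae_integrable2 _ _ (measurableTypeR R) (measurableTypeR R) R mu mu _ iF.
have i1 := @integrable_fubini_F _ _ (measurableTypeR R) (measurableTypeR R) R mu mu _ iF.
have mF : measurable_fun setT F by apply/measurable_EFinP; exact: measurable_int iF.
have iF' : (mu \x mu)%E.-integrable setT (EFin \o (fun z : R * R => F (z.2, z.1))).
  apply/(@integrable12ltyP _ _ (measurableTypeR R) (measurableTypeR R) R mu mu).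
    by apply/measurable_EFinP; exact: measurableT_comp mF (@measurable_swap _ _ (measurableTypeR R) (measurableTypeR R)).
  by have /(@integrable21ltyP _ _ (measurableTypeR R) (measurableTypeR R) R mu mu) := iF;
    apply; exact/measurable_EFinP.
have i2 := @integrable_fubini_F _ _ (measurableTypeR R) (measurableTypeR R) R mu mu _ iF'.
have m1 : measurable_fun setT (fun x => itg (fun y => F (x, y))).
  have := measurable_int _ i1.
  by move=> h; exact: (measurableT_comp (fine_measurable measurableT) h).
have m2 : measurable_fun setT (fun y => itg (fun x => F (x, y))).
  have := measurable_int _ i2.
  by move=> h; exact: (measurableT_comp (fine_measurable measurableT) h).
have E1 : {ae mu, forall x, fubini_F mu (EFin \o F) x = (itg (fun y => F (x, y)))%:E}.
  by apply: aeS a1 => x /intg_EFin.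
have E2 : {ae mu, forall y, fubini_G mu (EFin \o F) y = (itg (fun x => F (x, y)))%:E}.
  by apply: aeS a2 => x /intg_EFin.
have I1 : intg (fun x => itg (fun y => F (x, y))).
  apply/integrableP; split; first exact/measurable_EFinP.
  case/integrableP: i1 => mi1; rewrite (@ae_eq_integral _ _ _ mu setT (fun x => `|(itg (fun y => F (x, y)))%:E|%E))//.
  - exact: measurableT_comp.
  - by apply: measurableT_comp => //; exact/measurable_EFinP.
  - by apply: aeS E1 => x e _; exact: (congr1 abse e).
have I2 : intg (fun y => itg (fun x => F (x, y))).
  apply/integrableP; split; first exact/measurable_EFinP.
  case/integrableP: i2 => mi2; rewrite (@ae_eq_integral _ _ _ mu setT (fun y => `|(itg (fun x => F (x, y)))%:E|%E))//.
  - exact: measurableT_comp.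
  - by apply: measurableT_comp => //; exact/measurable_EFinP.
  - by apply: aeS E2 => x e _; exact: (congr1 abse e).
have T1 : (\int[mu]_x fubini_F mu (EFin \o F) x =
    \int[mu]_x (itg (fun y => F (x, y)))%:E)%E.
  apply: ae_eq_integral; [exact: measurableT|exact: measurable_int i1| |].
  - exact/measurable_EFinP.
  - by apply: aeS E1 => x e _; exact: e.
have T2 : (\int[mu]_y fubini_G mu (EFin \o F) y =
    \int[mu]_y (itg (fun x => F (x, y)))%:E)%E.
  apply: ae_eq_integral; [exact: measurableT|exact: measurable_int i2| |].
  - exact/measurable_EFinP.
  - by apply: aeS E2 => x e _; exact: e.
have H := @Fubini _ _ (measurableTypeR R) (measurableTypeR R) R mu mu _ iF.
split; [exact: a1|exact: a2|exact: I1|exact: I2|].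
apply: EFin_inj.
exact: (etrans (esym (intg_EFin I1)) (etrans (esym T1) (etrans H (etrans T2 (intg_EFin I2))))).
Qed.

(** On the product the integrand is dominated by [B * |f x| * |g y|]. The kernels to which this is
    applied are cosines, integrable in neither variable. *)
Lemma fubini_bdd f g (k : R -> R -> R) (B : R) : intg f -> intg g ->
  measurable_fun setT (fun z : R * R => k z.1 z.2) ->
  (forall x y, `|k x y| <= B) ->
  [/\ intg (fun x => f x * itg (fun y => g y * k x y)),
      intg (fun y => g y * itg (fun x => f x * k x y)) &
      itg (fun x => f x * itg (fun y => g y * k x y)) =
      itg (fun y => g y * itg (fun x => f x * k x y))].
Proof.
move=> fi gi mk kB.
have mf := intg_meas fi; have mg := intg_meas gi.
pose F (z : R * R) := f z.1 * (g z.2 * k z.1 z.2).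
have mF : measurable_fun setT F.
  apply: measurable_funM; first exact: measurableT_comp.
  by apply: measurable_funM => //; exact: measurableT_comp.
have mk1 x : measurable_fun setT (k x).
  exact: measurableT_comp mk (pair1_measurable x).
have mk2 y : measurable_fun setT (k ^~ y).
  exact: measurableT_comp mk (pair2_measurable y).
have g1 x : intg (fun y => g y * k x y) by exact: intgM_bdd (kB x).
have f1 y : intg (fun x => f x * k x y) by exact: intgM_bdd (kB ^~ y).
have Fx x : intg (fun y => F (x, y)) by exact: (intgZ (f x) (g1 x)).
have iF : (mu \x mu)%E.-integrable setT (EFin \o F).
  have pB : (mu \x mu)%E.-integrable setT (EFin \o (fun z : R * R => f z.1 * g z.2)).
    apply: fubini_abs.
    - by apply: measurable_funM; exact: measurableT_comp.
    - by move=> x; exact: (intgZ (f x) gi).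
    - apply: intg_eq (intgZ (itg (fun y => `|g y|)) (intg_norm fi)) => x /=.
      rewrite mulrC -itgZ; last exact: intg_norm.
      by apply: itg_eq => y; rewrite normrM.
  apply: (@le_integrable _ _ _ (mu \x mu)%E setT measurableT _
     (fun z : R * R => (B%:E * (f z.1 * g z.2)%:E)%E)).
  - exact/measurable_EFinP.
  - move=> z _; rewrite /F /= lee_fin !normrM mulrA mulrC.
    by rewrite ler_wpM2r ?mulr_ge0 // (le_trans (kB _ _)) // ler_norm.
  - exact: integrableZl.
have [_ _ i1 i2 H] := fubini_swap iF.
have E1 x : itg (fun y => F (x, y)) = f x * itg (fun y => g y * k x y).
  by rewrite -itgZ.
have E2 y : itg (fun x => F (x, y)) = g y * itg (fun x => f x * k x y).
  by rewrite -itgZ //; apply: itg_eq => x; rewrite /F /=; ring.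
split; [exact: intg_eq E1 i1|exact: intg_eq E2 i2|].
exact: (etrans (esym (itg_eq E1)) (etrans H (itg_eq E2))).
Qed.

(** Taken over the whole line; for causal factors the integrand lives on [0, t], and [ir_conv_cnv]
    makes the link with the truncated integral in [ir_conv]. *)
Definition cnv f g (t : R) : R := itg (fun x => f x * g (t - x)).

Lemma conv_integrable f g : intg f -> intg g ->
  (mu \x mu)%E.-integrable setT
    (EFin \o (fun z : R * R => f z.1 * g (z.2 - z.1))).
Proof.
move=> fi gi; have mf := intg_meas fi; have mg := intg_meas gi.
apply: fubini_abs.
- apply: measurable_funM; first exact: measurableT_comp.
  by apply: (measurableT_comp mg); exact: measurable_funB.
- by move=> x; exact: (intgZ (f x) (intg_shift x gi)).
- apply: intg_eq (intgZ (itg (fun y => `|g y|)) (intg_norm fi)) => x /=.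
  rewrite mulrC -(itg_shift x (intg_norm gi)) -itgZ; last exact/intg_norm/intg_shift.
  by apply: itg_eq => y; rewrite normrM.
Qed.

Lemma intg_conv f g : intg f -> intg g ->
  [/\ intg (cnv f g), itg (cnv f g) = itg f * itg g &
      {ae mu, forall t, intg (fun x => f x * g (t - x))}].
Proof.
move=> fi gi.
have [_ h1 _ h2 h3] := fubini_swap (conv_integrable fi gi); split => //.
have E x : itg (fun t => f x * g (t - x)) = itg g * f x.
  by rewrite itgZ; [rewrite itg_shift // mulrC|exact: intg_shift].
etransitivity; first exact: (esym h3).
by rewrite (itg_eq E) itgZ // mulrC.
Qed.

End fubini_and_convolution.

(** * Square-integrable functions: Cauchy-Schwarz and Young inequalities *)

Section square_integrable.
Context {R : realType}.
Notation mu := (@lebesgue_measure R).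
Implicit Types f g : R -> R.

Definition sqi f := measurable_fun setT f /\ intg (fun x => f x ^+ 2).
Definition nrm f : R := Num.sqrt (itg (fun x => f x ^+ 2)).

Lemma L2_sqi f : L2 f <-> sqi f.
Proof.
split=> [h|[mf fi]].
  split; last exact: Lfun2_integrable_sqr.
  by move: h; rewrite /L2 inE => /andP[]; rewrite inE.
rewrite /L2 inE; apply/andP; split; first by rewrite inE.
rewrite inE /= /finite_norm unlock.
apply: poweR_lty.
under eq_integral => x _ do rewrite poweR_EFin powR_mulrn // -normrX ger0_norm ?sqr_ge0 //.
by rewrite (intg_EFin fi) ltry.
Qed.

Lemma sqiM f g : sqi f -> sqi g -> intg (fun x => f x * g x).
Proof.
move=> [mf fi] [mg gi].
apply: (@intg_le _ _ (fun x => f x ^+ 2 + g x ^+ 2)).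
- exact: measurable_funM.
- move=> x; rewrite normrM -(real_normK (num_real (f x))) -(real_normK (num_real (g x))).
  by nra.
- exact: intgD.
Qed.

Lemma sqiD f g : sqi f -> sqi g -> sqi (fun x => f x + g x).
Proof.
move=> [mf fi] [mg gi]; split; first exact: measurable_funD.
apply: (@intg_le _ _ (fun x => 2 * (f x ^+ 2 + g x ^+ 2))).
- by apply: measurable_funX; exact: measurable_funD.
- move=> x; rewrite ger0_norm ?sqr_ge0 // -subr_ge0.
  by rewrite (_ : _ - _ = (f x - g x) ^+ 2) ?sqr_ge0 //; ring.
- exact/intgZ/intgD.
Qed.

Lemma sqiZ c f : sqi f -> sqi (fun x => c * f x).
Proof.
move=> [mf fi]; split; first exact: measurable_funM.
by apply: intg_eq (intgZ (c ^+ 2) fi) => x; rewrite exprMn.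
Qed.

Lemma sqiN f : sqi f -> sqi (fun x => - f x).
Proof. by move/(sqiZ (-1)); have -> : (fun x => - f x) = (fun x => -1 * f x) by apply/funext => x; rewrite mulN1r. Qed.

Lemma sqiB f g : sqi f -> sqi g -> sqi (fun x => f x - g x).
Proof. by move=> sf sg; exact: sqiD sf (sqiN sg). Qed.

Lemma sqi0 : sqi (fun=> 0).
Proof. by split => //; apply: intg_eq intg0 => x; rewrite expr0n. Qed.

Lemma sqi_sum (I : Type) (s : seq I) (h : I -> R -> R) :
  (forall i, sqi (h i)) -> sqi (fun x => \sum_(i <- s) h i x).
Proof.
move=> hi; elim: s => [|i s IH].
  by have -> : (fun x => \sum_(i <- [::]) h i x) = fun=> 0;
    [apply/funext => x; rewrite big_nil|exact: sqi0].
have -> : (fun x => \sum_(j <- i :: s) h j x) = (fun x => h i x + \sum_(j <- s) h j x).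
  by apply/funext => x; rewrite big_cons.
exact: sqiD.
Qed.

Lemma sqi_le f g : measurable_fun setT f -> (forall x, `|f x| <= `|g x|) ->
  sqi g -> sqi f.
Proof.
move=> mf fg [mg gi]; split => //.
apply: (@intg_le _ _ (fun x => g x ^+ 2)) => //.
- exact: measurable_funX.
- by move=> x; rewrite normrX -[leRHS]ger0_norm ?sqr_ge0 // normrX ler_sqr ?nnegrE.
Qed.

Lemma sqi_shift c f : sqi f -> sqi (fun x => f (x - c)).
Proof.
move=> [mf fi]; split; last exact: (intg_shift c fi).
by apply: (measurableT_comp mf); exact: measurable_funB.
Qed.

Lemma nrm_shift c f : sqi f -> nrm (fun x => f (x - c)) = nrm f.
Proof. by move=> [mf fi]; rewrite /nrm (itg_shift c fi). Qed.

Lemma nrm_ge0 f : 0 <= nrm f.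
Proof. exact: sqrtr_ge0. Qed.

Lemma sqr_nrm f : nrm f ^+ 2 = itg (fun x => f x ^+ 2).
Proof. by rewrite sqr_sqrtr //; apply: itg_ge0 => x; exact: sqr_ge0. Qed.

(** Discriminant argument: the nonnegative quadratic form [H] is evaluated at (b^2, Q). When [b = 0]
    the form is affine in [d] and would take the value -1 if [Q] were nonzero. *)
Lemma cauchy_schwarz f g : sqi f -> sqi g ->
  `|itg (fun x => f x * g x)| <= nrm f * nrm g.
Proof.
move=> sf sg; have [mf fi] := sf; have [mg gi] := sg.
have fgi := sqiM sf sg.
set Q := itg _; set a := nrm f; set b := nrm g.
have H (c d : R) : 0 <= c ^+ 2 * a ^+ 2 - 2 * (c * d) * Q + d ^+ 2 * b ^+ 2.
  rewrite !sqr_nrm -!itgZ // -itgB; [|exact: intgZ|exact: intgZ].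
  rewrite -itgD; [|by apply: intgB; exact: intgZ|exact: intgZ].
  apply: itg_ge0 => x.
  rewrite (_ : _ + _ = (c * f x - d * g x) ^+ 2) ?sqr_ge0 //; ring.
have a0 := nrm_ge0 f; have b0 := nrm_ge0 g; rewrite -/a -/b in a0 b0.
have H2 : Q ^+ 2 <= (a * b) ^+ 2.
  have [b1|b1] := eqVneq b 0.
    have [-> |Q0] := eqVneq Q 0; first by rewrite expr0n sqr_ge0.
    exfalso; have := H 1 ((a ^+ 2 + 1) / (2 * Q)).
    rewrite b1 expr0n /= mulr0 addr0 expr1n !mul1r.
    rewrite (_ : 2 * ((a ^+ 2 + 1) / (2 * Q)) * Q = a ^+ 2 + 1); last by field.
    by rewrite opprD addrA subrr add0r lerNr oppr0 ler10.
  have b2 : 0 < b ^+ 2 by rewrite exprn_gt0 // lt_neqAle eq_sym b1.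
  have := H (b ^+ 2) Q.
  rewrite (_ : _ + _ = b ^+ 2 * ((a * b) ^+ 2 - Q ^+ 2)); last by ring.
  by rewrite pmulr_rge0 // subr_ge0.
by rewrite -[leRHS]ger0_norm ?mulr_ge0 // -ler_sqr ?nnegrE // !real_normK ?num_real.
Qed.

Lemma nrmD f g : sqi f -> sqi g -> nrm (fun x => f x + g x) <= nrm f + nrm g.
Proof.
move=> sf sg; have [mf fi] := sf; have [mg gi] := sg.
have fgi := sqiM sf sg.
rewrite -ler_sqr ?nnegrE ?addr_ge0 ?nrm_ge0 // sqr_nrm.
rewrite (_ : itg _ = nrm f ^+ 2 + 2 * itg (fun x => f x * g x) + nrm g ^+ 2); last first.
  rewrite !sqr_nrm -itgZ // -!itgD //; last 2 first.
  - by apply: intgD => //; exact: intgZ.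
  - exact: intgZ.
  by apply: itg_eq => x; ring.
have := cauchy_schwarz sf sg; have := ler_norm (itg (fun x => f x * g x)).
by move=> h1 h2; rewrite sqrrD -mulr_natr; nra.
Qed.

Lemma nrmZ c f : sqi f -> nrm (fun x => c * f x) = `|c| * nrm f.
Proof.
move=> [mf fi]; rewrite /nrm -sqrtr_sqr -sqrtrM ?sqr_ge0 // -itgZ //.
by congr Num.sqrt; apply: itg_eq => x; rewrite exprMn.
Qed.

Lemma nrm_le f g : sqi f -> sqi g -> (forall x, `|f x| <= `|g x|) -> nrm f <= nrm g.
Proof.
move=> [mf fi] [mg gi] fg; apply: ler_wsqrtr; apply: itg_le => // x.
by rewrite -real_normK ?num_real // -[leRHS]real_normK ?num_real // ler_sqr ?nnegrE.
Qed.

Lemma nrm0 : nrm (fun=> 0) = 0.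
Proof. by rewrite /nrm (@itg_eq _ _ (fun=> 0)) ?itg0 ?sqrtr0 // => x; rewrite expr0n. Qed.

Lemma nrm_sum (I : Type) (s : seq I) (h : I -> R -> R) :
  (forall i, sqi (h i)) -> nrm (fun x => \sum_(i <- s) h i x) <= \sum_(i <- s) nrm (h i).
Proof.
move=> hi; elim: s => [|i s IH].
  have -> : (fun x => \sum_(i <- [::]) h i x) = fun=> 0 by apply/funext => x; rewrite big_nil.
  by rewrite big_nil nrm0.
have -> : (fun x => \sum_(j <- i :: s) h j x) = (fun x => h i x + \sum_(j <- s) h j x).
  by apply/funext => x; rewrite big_cons.
rewrite big_cons; apply: le_trans (nrmD _ _) _ => //; first exact: sqi_sum.
by rewrite lerD2l.
Qed.

Lemma nrm_ae f g : sqi f -> sqi g -> {ae mu, forall x, f x = g x} -> nrm f = nrm g.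
Proof.
move=> [mf fi] [mg gi] fg; rewrite /nrm; congr Num.sqrt; apply: itg_ae.
- exact: intg_meas.
- exact: intg_meas.
- by apply: aeS fg => x ->.
Qed.

(* Cauchy-Schwarz for the weight |h (t - x)| dx: the L1 kernel acts on L2. *)
Lemma young2 f g : intg f -> sqi g ->
  [/\ sqi (cnv f g), nrm (cnv f g) <= itg (fun x => `|f x|) * nrm g &
      {ae mu, forall t, intg (fun x => f x * g (t - x))}].
Proof.
move=> fi sg; have [mg gi] := sg; have mf := intg_meas fi.
have [ci ce cae] := intg_conv (intg_norm fi) gi.
set a := itg (fun x => `|f x|).
have mgt (t : R) : measurable_fun setT (fun x : R => g (t - x)).
  by apply: (measurableT_comp mg); exact: measurable_funB.
have aeI : {ae mu, forall t, intg (fun x => f x * g (t - x))}.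
  apply: aeS cae => t ht.
  apply: (@intg_le _ _ (fun x => `|f x| + `|f x| * g (t - x) ^+ 2)).
  - exact: measurable_funM.
  - move=> x; rewrite normrM -(real_normK (num_real (g (t - x)))).
    rewrite -[X in _ <= X + _](mulr1 `|f x|) -mulrDr ler_wpM2l //.
    by have := sqr_ge0 (`|g (t - x)| - 1); nra.
  - by apply: intgD => //; exact: intg_norm.
have a0 : 0 <= a by apply: itg_ge0.
have ptw : {ae mu, forall t, cnv f g t ^+ 2 <= a * cnv (fun x => `|f x|) (fun x => g x ^+ 2) t}.
  apply: aeS2 cae aeI => t h1 h2; rewrite /cnv.
  set P := itg (fun x => `|f x| * _); set Q := itg (fun x => f x * g (t - x)).
  have H (c d : R) : 0 <= c ^+ 2 * P - 2 * (c * d) * Q + d ^+ 2 * a.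
    rewrite -!itgZ //; last exact: intg_norm.
    rewrite -itgB; [|exact: intgZ|exact: intgZ].
    rewrite -itgD; [|by apply: intgB; exact: intgZ|by apply: intgZ; exact: intg_norm].
    apply: itg_ge0 => x; have [f0|f0] := leP 0 (f x).
      rewrite (ger0_norm f0) (_ : _ + _ = f x * (c * g (t - x) - d) ^+ 2); last by ring.
      by rewrite mulr_ge0 ?sqr_ge0.
    rewrite (ltr0_norm f0) (_ : _ + _ = (- f x) * (c * g (t - x) + d) ^+ 2); last by ring.
    by rewrite mulr_ge0 ?sqr_ge0 // oppr_ge0 ltW.
  have P0 : 0 <= P by apply: itg_ge0 => x; rewrite mulr_ge0 ?sqr_ge0.
  have [a1|a1] := eqVneq a 0.
    have [-> |Q0] := eqVneq Q 0; first by rewrite expr0n mulr_ge0.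
    exfalso; have := H 1 ((P + 1) / (2 * Q)).
    rewrite a1 mulr0 addr0 expr1n !mul1r.
    rewrite (_ : 2 * ((P + 1) / (2 * Q)) * Q = P + 1); last by field.
    by rewrite opprD addrA subrr add0r lerNr oppr0 ler10.
  have a2 : 0 < a by rewrite lt_neqAle eq_sym a1.
  have := H a Q.
  rewrite (_ : _ + _ = a * (a * P - Q ^+ 2)); last by ring.
  by rewrite pmulr_rge0 // subr_ge0.
(* For [g] merely square integrable the integrand need not be integrable on the plane, so
   measurability in [t] comes from Tonelli applied to its positive and negative parts. *)
have mc : measurable_fun setT (cnv f g).
  have mF : measurable_fun setT (fun z : R * R => f z.2 * g (z.1 - z.2)).
    apply: measurable_funM; first exact: measurableT_comp.
    by apply: (measurableT_comp mg); exact: measurable_funB.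
  have mp := @measurable_funrpos _ _ R setT _ mF.
  have mn := @measurable_funrneg _ _ R setT _ mF.
  have h1 := @measurable_fun_fubini_tonelli_F _ _ (measurableTypeR R) (measurableTypeR R) R mu
   (EFin \o (fun z : R * R => f z.2 * g (z.1 - z.2))^\+).
  have h2 := @measurable_fun_fubini_tonelli_F _ _ (measurableTypeR R) (measurableTypeR R) R mu
   (EFin \o (fun z : R * R => f z.2 * g (z.1 - z.2))^\-).
  have {}h1 : measurable_fun setT (fun t : R => (\int[mu]_x (((fun x : R => f x * g (t - x))^\+ x)%:E))%E).
    by apply: h1 => [|z]; [exact/measurable_EFinP|rewrite lee_fin].
  have {}h2 : measurable_fun setT (fun t : R => (\int[mu]_x (((fun x : R => f x * g (t - x))^\- x)%:E))%E).
    by apply: h2 => [|z]; [exact/measurable_EFinP|rewrite lee_fin].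
  have -> : cnv f g = fine \o (fun t : R => (\int[mu]_x (((fun x : R => f x * g (t - x))^\+ x)%:E) -
      \int[mu]_x (((fun x : R => f x * g (t - x))^\- x)%:E))%E).
    apply/funext => t; rewrite /cnv /itg /Rintegral /= integralE.
    have F1 (h : R -> R) x : ((EFin \o h)^\+)%E x = (h^\+ x)%:E by rewrite funerpos.
    have F2 (h : R -> R) x : ((EFin \o h)^\-)%E x = (h^\- x)%:E by rewrite funerneg.
    by congr (fine (_ - _)%E); apply: eq_integral => x _; [exact: F1|exact: F2].
  by apply: measurableT_comp => //; exact: emeasurable_funB.
have sqc : intg (fun t => cnv f g t ^+ 2).
  have := intgZ a ci => iZ.
  apply/integrableP; split; first by apply/measurable_EFinP; exact: measurable_funX.
  case/integrableP: iZ => mZ; apply: le_lt_trans.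
  apply: ae_ge0_le_integral => //.
  - by apply: measurableT_comp => //; apply/measurable_EFinP; exact: measurable_funX.
  - by apply: measurableT_comp.
  - apply: aeS ptw => t ht _ /=; rewrite lee_fin ger0_norm ?sqr_ge0 //.
    by apply: le_trans ht _; exact: ler_norm.
split => //.
rewrite -ler_sqr ?nnegrE ?mulr_ge0 ?nrm_ge0 // exprMn !sqr_nrm expr2 -mulrA -/a -ce -itgZ //.
rewrite -lee_fin -!intg_EFin //; last exact: intgZ.
apply: ae_ge0_le_integral => //.
- by move=> x _; rewrite lee_fin sqr_ge0.
- exact/measurable_EFinP/measurable_funX.
- move=> x _; rewrite lee_fin mulr_ge0 //; apply: itg_ge0 => y.
  by rewrite mulr_ge0 ?sqr_ge0.
- by apply/measurable_EFinP; exact: (intg_meas (intgZ a ci)).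
- by apply: aeS ptw => t ht _; rewrite lee_fin.
Qed.

End square_integrable.

(** * Laplace transforms determine measures *)

Section bernstein.
Context {R : realType}.

Lemma unif_continuous01 (f : R -> R) (e : R) : continuous f -> 0 < e ->
  exists2 d : R, 0 < d &
    forall x y, 0 <= x <= 1 -> `|x - y| < d -> `|f x - f y| <= e.
Proof.
move=> cf e0.
have H : \forall d \near 0^'+, forall x, `[0%R, 1%R]%classic x ->
    forall y : R, `|x - y| < d -> `|f x - f y| <= e.
  have /compact_near_coveringP := @segment_compact R 0 1.
  apply => x x01.
  have e2 : 0 < e / 2 by rewrite divr_gt0.
  have /cvgrPdist_le /(_ _ e2) [d /= d0 hd] := cf x.
  exists (ball x (d / 2), [set i | 0 < i < d / 2]) => /=.
    split; first by apply: nbhsx_ballx; rewrite divr_gt0.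
    exists (d / 2) => /=; first by rewrite divr_gt0.
    by move=> i /= hi i0; rewrite i0 /=; move: hi; rewrite sub0r normrN gtr0_norm.
  move=> [x' i] /= [xx' /andP[i0 id]] y hy.
  have h1 := hd x'; have h2 := hd y.
  have {}h1 : `|f x - f x'| <= e / 2.
    by apply: h1; rewrite /ball_ /=; rewrite /ball /= in xx'; apply: lt_trans xx' _; rewrite gtr_pMr // invf_lt1 ?ltr1n.
  have {}h2 : `|f x - f y| <= e / 2.
    apply: h2; rewrite /ball_ /= (le_lt_trans (ler_distD x' _ _)) //.
    by rewrite [ltRHS]splitr ltrD // (lt_trans hy).
  rewrite (le_trans (ler_distD (f x) _ _)) // [leRHS]splitr lerD //.
  by rewrite distrC.
have [d [d0 hd]] : exists d, 0 < d /\ (forall x, `[0%R, 1%R]%classic x ->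
    forall y : R, `|x - y| < d -> `|f x - f y| <= e).
  have : \forall d \near 0^'+, 0 < d /\ (forall x, `[0%R, 1%R]%classic x ->
    forall y : R, `|x - y| < d -> `|f x - f y| <= e).
    by near=> d; split; [near: d; exact: nbhs_right_gt|near: d].
  by move/filter_ex.
exists d => // x y x01; apply: hd; rewrite /= in_itv /=.
exact: x01.
Unshelve. all: by end_near. Qed.

Let b (x : R) n k : R := 'C(n, k)%:R * x ^+ k * (1 - x) ^+ (n - k).

Lemma bernstein_sum1 x n : \sum_(k < n.+1) b x n k = 1.
Proof.
transitivity ((1 - x + x) ^+ n); last by rewrite subrK expr1n.
by rewrite exprDn; apply: eq_bigr => k _; rewrite /b -mulr_natl; ring.
Qed.

(** From k C(n+1, k) = (n+1) C(n, k-1). With [h] constant, then the identity, it yields the first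
    two factorial moments of the binomial distribution. *)
Lemma bernstein_sumS x n (h : nat -> R) :
  \sum_(k < n.+2) k%:R * h k.-1 * b x n.+1 k =
  n.+1%:R * x * \sum_(k < n.+1) h k * b x n k.
Proof.
rewrite big_ord_recl /= !mul0r add0r mulr_sumr; apply: eq_bigr => k _.
rewrite /b /bump /= add1n subSS exprS.
have := mul_bin_diag n.+1 k; rewrite /= => /(congr1 (fun m => m%:R : R)).
rewrite add0n !natrM => E.
transitivity (k.+1%:R * 'C(n.+1, k.+1)%:R * (x * x ^+ k * (1 - x) ^+ (n - k) * h k)).
  by ring.
by rewrite -E; ring.
Qed.

(** The variance of the binomial distribution, assembled from the means of K and K (K - 1). *)
Lemma bernstein_var x n :
  \sum_(k < n.+2) (k%:R - n.+1%:R * x) ^+ 2 * b x n.+1 k = n.+1%:R * (x * (1 - x)).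
Proof.
have s0 := bernstein_sum1 x n.+1.
have s1 : \sum_(k < n.+2) k%:R * b x n.+1 k = n.+1%:R * x.
  have := bernstein_sumS x n (fun=> 1).
  under eq_bigr do rewrite mulr1.
  by move=> ->; under eq_bigr do rewrite mul1r; rewrite bernstein_sum1 mulr1.
have s2 : \sum_(k < n.+2) k%:R * (k.-1)%:R * b x n.+1 k = n.+1%:R * x * (n%:R * x).
  rewrite (bernstein_sumS x n (fun k => k%:R)); congr (_ * _).
  case: n {s0 s1} => [|n]; first by rewrite big_ord1 !mul0r.
  have := bernstein_sumS x n (fun=> 1).
  under eq_bigr do rewrite mulr1.
  by move=> ->; under eq_bigr do rewrite mul1r; rewrite bernstein_sum1 mulr1.
transitivity (\sum_(k < n.+2) (k%:R * (k.-1)%:R * b x n.+1 k +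
   ((1 - 2 * n.+1%:R * x) * (k%:R * b x n.+1 k) + (n.+1%:R * x) ^+ 2 * b x n.+1 k))).
  apply: eq_bigr => -[[|k] /= _] _; first by ring.
  by rewrite -[k.+1%:R]natr1; ring.
rewrite !big_split /= -!mulr_sumr s0 s1 s2 -[n.+1%:R]natr1; ring.
Qed.

Lemma weierstrass (f : R -> R) (e : R) : continuous f -> 0 < e ->
  exists p : {poly R}, forall x, 0 <= x <= 1 -> `|f x - p.[x]| <= e.
Proof.
move=> cf e0; have e2 : 0 < e / 2 by rewrite divr_gt0.
have [d d0 hd] := unif_continuous01 cf e2.
have [M M0 hM] : exists2 M, 0 < M & forall x, 0 <= x <= 1 -> `|f x| <= M.
  have [c _ hc] := @EVT_max R (fun x => `|f x|) 0 1 ler01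
    (continuous_subspaceT (fun x => cvg_norm (cf x))).
  exists (`|f c| + 1) => [|x x01]; first by rewrite ltr_wpDl.
  by rewrite (le_trans (hc x _)) ?in_itv //= lerDl.
(* Makes the Chebyshev term 2 M x (1 - x) / ((n + 1) d^2) at most e / 2, using x (1 - x) <= 1. *)
pose n := Num.truncn (4 * M / (d ^+ 2 * e)).
have hn : 4 * M <= n.+1%:R * (d ^+ 2 * e).
  rewrite -ler_pdivrMr ?mulr_gt0 ?exprn_gt0 //; apply: ltW; exact: truncnS_gt.
exists (\sum_(k < n.+2) (f (k%:R / n.+1%:R) * 'C(n.+1, k)%:R)%:P * 'X^k * (1 - 'X) ^+ (n.+1 - k)).
move=> x /[dup] x01 /andP[x0 x1].
have -> : (\sum_(k < n.+2) (f (k%:R / n.+1%:R) * 'C(n.+1, k)%:R)%:P * 'X^k *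
     (1 - 'X) ^+ (n.+1 - k)).[x] = \sum_(k < n.+2) f (k%:R / n.+1%:R) * b x n.+1 k.
  rewrite horner_sum; apply: eq_bigr => k _.
  by rewrite 2!hornerM hornerC hornerXn horner_exp hornerD hornerN hornerX hornerC /b; ring.
have b0 k : 0 <= b x n.+1 k.
  by rewrite /b !mulr_ge0 // exprn_ge0 // subr_ge0.
have -> : f x - \sum_(k < n.+2) f (k%:R / n.+1%:R) * b x n.+1 k =
    \sum_(k < n.+2) (f x - f (k%:R / n.+1%:R)) * b x n.+1 k.
  rewrite -[X in X - _]mulr1 -(bernstein_sum1 x n.+1) mulr_sumr -sumrB.
  by apply: eq_bigr => k _; rewrite mulrBl.
apply: le_trans (ler_norm_sum _ _ _) _.
have n0 : 0 < n.+1%:R :> R by [].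
have [m Em] : exists m : R, m = n.+1%:R by exists n.+1%:R.
have bv := bernstein_var x n; rewrite -Em in bv hn n0 *.
have m1 : m != 0 by rewrite gt_eqF.
have d1 : d != 0 by rewrite gt_eqF.
apply: (@le_trans _ _ (\sum_(k < n.+2) (e / 2 * b x n.+1 k +
    2 * M / (m * d) ^+ 2 * ((k%:R - m * x) ^+ 2 * b x n.+1 k)))).
  apply: ler_sum => k _; rewrite normrM (ger0_norm (b0 k)).
  rewrite [X in _ <= _ + X]mulrA -mulrDl ler_wpM2r //.
  (* Nodes closer than [d] are handled by uniform continuity; for the others the factor ((x - k / m)
     / d)^2 is at least 1 and brings in the variance. *)
  have [lt|ge] := ltP `|x - k%:R / m| d.
    by rewrite (le_trans (hd _ _ x01 lt)) // lerDl mulr_ge0 ?sqr_ge0 // divr_ge0 ?sqr_ge0 // mulr_ge0 // ltW.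
  have kn : 0 <= (k%:R / m : R) <= 1.
    by rewrite divr_ge0 ?(ltW n0) //= ler_pdivrMr // mul1r Em ler_nat -ltnS.
  have -> : k%:R - m * x = - (m * (x - k%:R / m)).
    by field.
  have -> : 2 * M / (m * d) ^+ 2 * (- (m * (x - k%:R / m))) ^+ 2 =
     2 * M * ((x - k%:R / m) / d) ^+ 2 by field; rewrite ?m1 ?d1.
  apply: (@le_trans _ _ (2 * M)).
    by have := ler_normB (f x) (f (k%:R / m)); have := hM _ x01; have := hM _ kn; lra.
  rewrite -[leLHS]add0r lerD ?(ltW e2) // ler_peMr ?mulr_ge0 ?(ltW M0) //.
  rewrite -real_normK ?num_real // exprn_ege1 // normrM normfV (gtr0_norm d0).
  by rewrite ler_pdivlMr // mul1r.
rewrite big_split /= -!mulr_sumr bernstein_sum1 bv mulr1.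
rewrite [leRHS]splitr lerD2l.
have -> : 2 * M / (m * d) ^+ 2 * (m * (x * (1 - x))) = 2 * M * (x * (1 - x)) / (m * d ^+ 2).
  by field; rewrite ?m1 ?d1.
rewrite ler_pdivrMr ?mulr_gt0 ?exprn_gt0 //.
apply: (@le_trans _ _ (2 * M)); last by nra.
by rewrite ler_piMr ?mulr_ge0 ?(ltW M0) //; nra.
Qed.

End bernstein.

(** * Test functions against the exponentials exp(- (s0 + n) t) *)

Section laplace_determines.
Context {R : realType}.

Lemma cvg_sumR (n : nat) (f : 'I_n -> nat -> R) (l : 'I_n -> R) :
  (forall i, f i j @[j --> \oo] --> l i) ->
  \sum_(i < n) f i j @[j --> \oo] --> \sum_(i < n) l i.
Proof.
move=> fl; elim: (index_enum _) => [|i s IH].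
  by under eq_fun do rewrite big_nil; rewrite big_nil; exact: cvg_cst.
by under eq_fun do rewrite big_cons; rewrite big_cons; apply: cvgD.
Qed.

Implicit Types (v h : R -> R).

Lemma expR_poly_approx (s0 T : R) v (e : R) : 0 <= T -> continuous v ->
  (forall t, T <= t -> v t = 0) -> 0 < e ->
  exists p : {poly R}, forall t, 0 <= t ->
    `|v t - expR (- (s0 * t)) * p.[expR (- t)]| <= e * expR (- (s0 * t)).
Proof.
move=> T0 cv vT e0.
(* The value of [t] at x = exp(- t), capped at [T]: this keeps the logarithm continuous at 0 and
   loses nothing, since [v] vanishes from [T] on. *)
pose tau (x : R) := - ln (Num.max x (expR (- T))).
have ctau : continuous tau.
  move=> x; apply: cvgN; apply: (@continuous_comp _ _ _ (fun x => Num.max x (expR (- T))) (@ln R)).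
    by apply: continuous_max; [exact: cvg_id|exact: cvg_cst].
  by apply: continuous_ln; rewrite lt_max expR_gt0 orbT.
pose phi (x : R) := expR (s0 * tau x) * v (tau x).
have cphi : continuous phi.
  move=> x; apply: cvgM.
    apply: (@continuous_comp _ _ _ (fun x => s0 * tau x) (@expR R)).
      by apply: cvgM; [exact: cvg_cst|exact: ctau].
    exact: continuous_expR.
  by apply: continuous_comp; [exact: ctau|exact: cv].
have [p hp] := weierstrass cphi e0; exists p => t t0.
have E : tau (expR (- t)) = Num.min t T.
  rewrite /tau; have [tT|Tt] := leP t T.
    by rewrite max_l ?expRK ?opprK // ler_expR lerN2.
  by rewrite max_r ?expRK ?opprK // ler_expR lerN2 ltW.
have := hp (expR (- t)); rewrite expR_ge0 -expR0 ler_expR lerNl oppr0 t0 => /(_ isT).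
have Ep : phi (expR (- t)) = expR (s0 * t) * v t.
  rewrite /phi E; have [//|Tt] := leP t T.
  by rewrite !vT ?mulr0 // ltW.
rewrite Ep => H.
have -> : v t - expR (- (s0 * t)) * p.[expR (- t)] =
   expR (- (s0 * t)) * (expR (s0 * t) * v t - p.[expR (- t)]).
  by rewrite mulrBr mulrA -expRD addNr expR0 mul1r.
by rewrite normrM gtr0_norm ?expR_gt0 // mulrC ler_wpM2r ?expR_ge0.
Qed.

(** Up to an error [e * exp(- s0 t)], the test function is a finite combination of the exponentials
    exp(- (s0 + i) t), for which convergence is assumed. The l^1 bound [M] controls the effect of
    the error on the sums; [|h0|] and the damped norm [I] of [h] control it on the limit. *)
Lemma laplace_weak (h : R -> R) (h0 M s0 : R) (E : nat -> {poly R})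
    (d : nat -> R) (v : R -> R) (T : R) :
  0 <= s0 -> (forall j, 0 <= d j) ->
  measurable_fun setT h -> causal h ->
  intg (fun t => h t * expR (- (s0 * t))) ->
  (forall j, \sum_(k < size (E j)) `|(E j)`_k| <= M) ->
  (forall n : nat, (E j).[expR (- ((s0 + n%:R) * d j))] @[j --> \oo] -->
     h0 + itg (fun t => h t * expR (- ((s0 + n%:R) * t)))) ->
  continuous v -> (forall t, T <= t -> v t = 0) ->
  \sum_(k < size (E j)) (E j)`_k * v (k%:R * d j) @[j --> \oo] -->
    h0 * v 0 + itg (fun t => h t * v t).
Proof.
move=> s00 d0 mh ch ih EM cE cv vT.
pose I := itg (fun t => `|h t * expR (- (s0 * t))|).
have M0 : 0 <= M by apply: le_trans (EM 0%N); apply: sumr_ge0.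
have I0 : 0 <= I by apply: itg_ge0.
apply/cvgrPdist_le => eps eps0.
(* The errors on the two sides add up to at most [e * (M + |h0| + I)], hence to [eps / 2]; the 1
   keeps [B] positive. *)
pose B := M + `|h0| + I + 1.
have B0 : 0 < B by rewrite /B ltr_wpDl // !addr_ge0.
pose e := eps / 2 / B.
have e0 : 0 < e by rewrite /e !divr_gt0.
have [||p hp] := @expR_poly_approx s0 (Num.max T 0) v e _ cv _ e0.
- by rewrite le_max lexx orbT.
- by move=> t; rewrite ge_max => /andP[/vT].
pose q (t : R) := expR (- (s0 * t)) * p.[expR (- t)].
have qE t : q t = \sum_(i < size p) p`_i * expR (- ((s0 + i%:R) * t)).
  rewrite /q horner_coef mulr_sumr; apply: eq_bigr => i _.
  by rewrite mulrCA -expRM_natl -expRD; congr (_ * expR _); ring.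
have hq t : 0 <= t -> `|v t - q t| <= e * expR (- (s0 * t)) by exact: hp.
clearbody q.
have ihn (n : nat) : intg (fun t => h t * expR (- ((s0 + n%:R) * t))).
  apply: (@intg_le _ _ (fun t => `|h t * expR (- (s0 * t))|)).
  - apply: measurable_funM => //; apply: measurableT_comp => //.
    by apply: measurable_funN; apply: measurable_funM.
  - move=> t; have [t0|t0] := ltP t 0; first by rewrite ch // !mul0r normr0.
    by rewrite !normrM ler_wpM2l // !gtr0_norm ?expR_gt0 // ler_expR lerN2 ler_wpM2r // lerDl.
  - exact: intg_norm.
have iq : intg (fun t => h t * q t).
  apply: intg_eq (intg_sum (index_enum 'I_(size p))
     (fun i : 'I_(size p) => intgZ (p`_i) (ihn i))) => t.
  by rewrite qE mulr_sumr; apply: eq_bigr => i _; ring.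
have iqE : h0 * q 0 + itg (fun t => h t * q t) =
   \sum_(i < size p) p`_i * (h0 + itg (fun t => h t * expR (- ((s0 + i%:R) * t)))).
  have -> : itg (fun t => h t * q t) =
      \sum_(i < size p) p`_i * itg (fun t => h t * expR (- ((s0 + i%:R) * t))).
    transitivity (\sum_(i < size p) itg (fun t => p`_i * (h t * expR (- ((s0 + i%:R) * t))))).
      rewrite -itg_sum; last by move=> i; exact: intgZ (ihn i).
      by apply: itg_eq => t; rewrite qE mulr_sumr; apply: eq_bigr => i _; ring.
    by apply: eq_bigr => i _; exact: itgZ.
  rewrite qE mulr_sumr -big_split /=; apply: eq_bigr => i _.
  by rewrite mulr0 oppr0 expR0 mulr1 mulrDr mulrC.
have Eq j : \sum_(k < size (E j)) (E j)`_k * q (k%:R * d j) =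
   \sum_(i < size p) p`_i * (E j).[expR (- ((s0 + i%:R) * d j))].
  under [RHS]eq_bigr => i _ do rewrite horner_coef mulr_sumr.
  rewrite exchange_big /=; apply: eq_bigr => k _.
  rewrite qE mulr_sumr; apply: eq_bigr => i _.
  by rewrite mulrCA -expRM_natl; congr (_ * (_ * expR _)); ring.
have cvq : \sum_(k < size (E j)) (E j)`_k * q (k%:R * d j) @[j --> \oo] -->
    h0 * q 0 + itg (fun t => h t * q t).
  rewrite iqE; under eq_fun do rewrite Eq.
  by apply: cvg_sumR => i; apply: cvgM; [exact: cvg_cst|exact: cE].
have iv : intg (fun t => h t * v t).
  apply: (@intg_le _ _ (fun t => `|h t * q t| + e * `|h t * expR (- (s0 * t))|)).
  - by apply: measurable_funM => //; exact: continuous_measurable_fun.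
  - move=> t; have [t0|t0] := ltP t 0; first by rewrite ch // !mul0r normr0 mulr0 addr0.
    have H := hq t t0.
    rewrite (normrM (h t) (v t)) (normrM (h t) (q t)) (normrM (h t) (expR _)).
    rewrite [X in _ <= _ + X]mulrCA -mulrDr ler_wpM2l // (gtr0_norm (expR_gt0 _)).
    by rewrite -[X in `|X|](subrK (q t)) (le_trans (ler_normD _ _)) // addrC lerD2l.
  - by apply: intgD; [exact: intg_norm|exact/intgZ/intg_norm].
have D2 : `|h0 * v 0 + itg (fun t => h t * v t) - (h0 * q 0 + itg (fun t => h t * q t))| <=
    e * (`|h0| + I).
  rewrite opprD addrACA -mulrBr -itgB // (le_trans (ler_normD _ _)) // [leRHS]mulrDr lerD //.
    rewrite normrM mulrC ler_wpM2r // (le_trans (hq 0 (lexx 0))) //.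
    by rewrite mulr0 oppr0 expR0 mulr1.
  rewrite -itgZ; last exact: intg_norm.
  apply: itg_norm_le; [exact: intgB|by apply: intgZ; exact: intg_norm|].
  move=> t; have [t0|t0] := ltP t 0; first by rewrite ch // !mul0r subrr normr0 mulr0.
  by rewrite -mulrBr !normrM mulrCA ler_wpM2l // (gtr0_norm (expR_gt0 _)) hq.
have D1 j : `|\sum_(k < size (E j)) (E j)`_k * v (k%:R * d j) -
    \sum_(k < size (E j)) (E j)`_k * q (k%:R * d j)| <= e * M.
  rewrite -sumrB (le_trans (ler_norm_sum _ _ _)) // mulrC (le_trans _ (ler_wpM2r (ltW e0) (EM j))) //.
  rewrite mulr_suml; apply: ler_sum => k _; rewrite -mulrBr normrM ler_wpM2l //.
  have kd : 0 <= k%:R * d j by rewrite mulr_ge0.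
  rewrite (le_trans (hq _ kd)) // ler_piMr ?(ltW e0) //.
  by rewrite -[leRHS]expR0 ler_expR lerNl oppr0 mulr_ge0.
have e2 : 0 < eps / 2 by rewrite divr_gt0.
have /cvgrPdist_le /(_ _ e2) := cvq; apply: filterS => j hj.
have eB : e * (M + (`|h0| + I)) <= eps / 2.
  rewrite /e mulrAC ler_pdivrMr // ler_wpM2l ?(ltW e2) // /B addrA lerDl //.
set X := h0 * v 0 + _ in D2 *; set Y := h0 * q 0 + _ in D2 hj.
set S := \sum_(k < _) _ in D1 *.
have := D1 j; move: hj; set Sv := \sum_(k < _) _ * v _; set Sq := \sum_(k < _) _ => hj D1j.
have -> : X - Sv = (X - Y) + ((Y - Sq) - (Sv - Sq)) by ring.
rewrite (le_trans (ler_normD _ _)) // [leRHS]splitr.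
rewrite (le_trans (lerD D2 (ler_normB _ _))) //.
rewrite (le_trans (lerD (lexx _) (lerD hj D1j))) //; lra.
Qed.

(** Uniqueness of the transform, read off from the constant sequence of zero polynomials: both
    limits of the same sequence must agree. *)
Lemma laplace_weak0 (h : R -> R) (h0 s0 : R) (v : R -> R) (T : R) :
  0 <= s0 -> measurable_fun setT h -> causal h ->
  intg (fun t => h t * expR (- (s0 * t))) ->
  (forall n : nat, h0 + itg (fun t => h t * expR (- ((s0 + n%:R) * t))) = 0) ->
  continuous v -> (forall t, T <= t -> v t = 0) ->
  h0 * v 0 + itg (fun t => h t * v t) = 0.
Proof.
move=> s00 mh ch ih h00 cv vT.
have H : \sum_(k < size (0 : {poly R})) (0 : {poly R})`_k * v (k%:R * 0) @[j --> \oo] -->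
    h0 * v 0 + itg (fun t => h t * v t).
  apply: (@laplace_weak h h0 0 s0 (fun=> 0) (fun=> 0) v T) => //.
  - by move=> j; rewrite size_poly0 big_ord0.
  - by move=> n; rewrite h00; under eq_fun do rewrite horner0; exact: cvg_cst.
have E0 : (fun j : nat => \sum_(k < size (0 : {poly R})) (0 : {poly R})`_k * v (k%:R * 0)) = fun=> 0.
  by apply/funext => j; rewrite size_poly0 big_ord0.
rewrite E0 in H; exact: cvg_unique H (cvg_cst 0).
Qed.

End laplace_determines.

(** * Positivity in the right half-plane *)

Section trigonometric_integrals.
Context {R : realType}.
Notation mu := (@lebesgue_measure R).

Lemma measurable_cos_fun : measurable_fun setT (@cos R).
Proof. by apply: continuous_measurable_fun; exact: continuous_cos. Qed.

Definition cexp (p t : R) : R := if 0 <= t then expR (- (p * t)) else 0.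

Lemma cexp_ge0 p t : 0 <= cexp p t.
Proof. by rewrite /cexp; case: ifP => // _; exact: expR_ge0. Qed.

Lemma causal_cexp p : causal (cexp p).
Proof. by move=> t t0; rewrite /cexp leNgt t0. Qed.

Lemma cexpE p : cexp p = (fun t => expR (- (p * t))) \_ `[0, +oo[.
Proof.
apply/funext => t; rewrite /cexp patchE mem_setE in_itv /= andbT.
by case: ifP.
Qed.

Lemma measurable_cexp p : measurable_fun setT (cexp p).
Proof.
rewrite cexpE; apply/(measurable_restrictT _ _).1 => //.
apply: measurable_funTS; apply: measurableT_comp => //.
by apply: measurable_funN; exact: measurable_funM.
Qed.

Lemma derive_expM (p x : R) : is_derive x 1 (fun t => expR (- (p * t))) (- p * expR (- (p * x))).
Proof.
have h : is_derive x (1:R) (fun t => - (p * t)) (- p).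
  have : is_derive x (1:R) (fun t : R => - p * t) (- p *: 1).
    exact: is_deriveZ.
  by rewrite /GRing.scale /= mulr1; have -> : (fun t : R => - p * t) = (fun t => - (p * t))
    by apply/funext => t; rewrite mulNr.
rewrite mulrC; exact: is_derive1_comp.
Qed.

Lemma continuous_expM (p : R) : continuous (fun t : R => expR (- (p * t))).
Proof.
move=> x; apply/differentiable_continuous/derivable1_diffP.
exact: (@ex_derive _ _ _ _ _ _ _ (derive_expM p x)).
Qed.

Lemma expR_cvg0 (p : R) : 0 < p -> expR (- (p * n%:R)) @[n --> \oo] --> 0.
Proof.
move=> p0.
have -> : (fun n : nat => expR (- (p * n%:R))) = (fun n => (expR (- p)) ^+ n).
  by apply/funext => n; rewrite -expRM_natl; congr expR; ring.
apply: cvg_expr; rewrite ger0_norm ?expR_ge0 //.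
by rewrite -[ltRHS]expR0 ltr_expR oppr_lt0.
Qed.

Lemma intg_cexp p : 0 < p -> intg (cexp p).
Proof.
move=> p0; apply: intg_nneg; [exact: measurable_cexp|exact: cexp_ge0|].
have -> : (\int[mu]_x (cexp p x)%:E = \int[mu]_(x in `[0%R, +oo[) (expR (- (p * x)))%:E)%E.
  by rewrite [RHS]integral_mkcond; apply: eq_integral => x _; rewrite cexpE restrict_EFin.
rewrite (@ge0_continuous_FTC2y R _ (fun t => - p^-1 * expR (- (p * t))) 0 0) ?ltry //.
- by apply: continuous_subspaceT; exact: continuous_expM.
- rewrite -(mulr0 (- p^-1)); apply: cvgM; first exact: cvg_cst.
  apply: (@cvg_comp _ _ _ (fun x => p * x) (fun y => expR (- y)) _ (pinfty_nbhs R)).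
    by apply/cvgryPge => A; near=> x; rewrite mulrC -ler_pdivrMr //; near: x; apply: nbhs_pinfty_ge; rewrite num_real.
  exact: cvgr_expR.
- apply: cvg_at_right_filter; apply: cvgM; first exact: cvg_cst.
  exact: continuous_expM.
- move=> x _; rewrite derive1E.
  have h := is_deriveZ (- p^-1) (derive_expM p x).
  rewrite (@derive_val _ _ _ _ _ _ _ h) /GRing.scale /= mulrA mulrNN mulVf ?mul1r //.
  by rewrite gt_eqF.
Unshelve. all: by end_near. Qed.

(* Truncation to [0, n] reduces an oscillating integral over [0, +oo[ to the
   fundamental theorem of calculus on compact intervals. *)
Lemma itg_cexp_FTC (p : R) (k F : R -> R) : 0 < p ->
  continuous k -> (forall x, `|k x| <= 1) ->
  (forall x : R, is_derive x 1 F (expR (- (p * x)) * k x)) ->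
  F n%:R @[n --> \oo] --> 0 ->
  itg (fun t => cexp p t * k t) = - F 0.
Proof.
move=> p0 ck k1 dF F0.
have mk : measurable_fun setT k by exact: continuous_measurable_fun.
pose u (n : nat) (t : R) := (cexp p t * k t) * \1_(`[0, n%:R]%classic) t.
have mfk : measurable_fun setT (fun t => cexp p t * k t).
  by apply: measurable_funM => //; exact: measurable_cexp.
have [||||_ cv] := @itg_dct R u (fun t => cexp p t * k t) (cexp p) _ _ _ (intg_cexp p0).
- by move=> n; apply: measurable_funM.
- exact: mfk.
- move=> x; have [x0|x0] := ltP x 0.
    rewrite (_ : (fun n => u n x) = fun=> 0); last first.
      by apply/funext => n; rewrite /u causal_cexp ?mul0r.
    by rewrite causal_cexp // mul0r; exact: cvg_cst.
  apply: cvg_near_cst; exists (Num.truncn x).+1 => // n /= hn.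
  rewrite /u indicE mem_setE in_itv /= x0 /= ltW ?mulr1 //.
  by rewrite (lt_le_trans (truncnS_gt _)) // ler_nat.
- move=> n x; rewrite /u indicE normrM normrM (ger0_norm (cexp_ge0 _ _)).
  rewrite -mulrA ler_piMr ?cexp_ge0 // mulr_ile1 //.
  by case: (_ \in _); rewrite ?normr1 ?normr0.
have un n : itg (u n) = F n%:R - F 0.
  have [->|n0] := eqVneq n 0%N.
    rewrite subrr /itg /u (_ : (fun x => _) = (fun t => cexp p t * k t) \_ [set 0]).
      by rewrite -Rintegral_mkcond Rintegral_set1.
    apply/funext => t; rewrite patchE indicE set_itv1.
    by case: (_ \in _); rewrite ?mulr1 ?mulr0.
  have n0' : 0 < n%:R :> R by rewrite ltr0n lt0n.
  rewrite /itg (_ : u n = (fun t => expR (- (p * t)) * k t) \_ `[0, n%:R]); last first.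
    apply/funext => t; rewrite /u patchE indicE mem_setE in_itv /= /cexp.
    by case: (0 <= t); case: (t <= n%:R); rewrite /= ?mulr1 ?mulr0.
  rewrite -Rintegral_mkcond /Rintegral.
  have cFx x : {for x, continuous F}.
    by apply/differentiable_continuous/derivable1_diffP; exact: (@ex_derive _ _ _ _ _ _ _ (dF x)).
  rewrite (@continuous_FTC2 R _ F) //.
  - apply: continuous_subspaceT => x; apply: cvgM; last exact: ck.
    exact: continuous_expM.
  - split.
    + by move=> x _; exact: (@ex_derive _ _ _ _ _ _ _ (dF x)).
    + by apply: cvg_at_right_filter; exact: cFx.
    + by apply: cvg_at_left_filter; exact: cFx.
  - by move=> x _; rewrite derive1E (@derive_val _ _ _ _ _ _ _ (dF x)).
apply: (cvg_unique _ cv) => //.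
rewrite (_ : (fun n => itg (u n)) = (fun n => F n%:R - F 0)); last exact/funext.
have : F n%:R - F 0 @[n --> \oo] --> 0 - F 0 by apply: cvgB => //; exact: cvg_cst.
by rewrite sub0r.
Qed.

Lemma is_derive_cosM (w x : R) : is_derive x 1 (fun t => cos (w * t)) (- (w * sin (w * x))).
Proof.
have h : is_derive x (1:R) (fun t : R => w * t) (w *: 1) by exact: is_deriveZ.
rewrite /GRing.scale /= mulr1 in h.
rewrite -mulrN mulrC; exact: is_derive1_comp.
Qed.

Lemma is_derive_sinM (w x : R) : is_derive x 1 (fun t => sin (w * t)) (w * cos (w * x)).
Proof.
have h : is_derive x (1:R) (fun t : R => w * t) (w *: 1) by exact: is_deriveZ.
rewrite /GRing.scale /= mulr1 in h.
rewrite mulrC; exact: is_derive1_comp.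
Qed.

Lemma cos_norm_le1 (x : R) : `|cos x| <= 1.
Proof. by rewrite ler_norml cos_geN1 cos_le1. Qed.

Lemma sin_norm_le1 (x : R) : `|sin x| <= 1.
Proof. by rewrite ler_norml sin_geN1 sin_le1. Qed.

Lemma continuous_cosM (w : R) : continuous (fun t => cos (w * t)).
Proof.
by move=> x; apply/differentiable_continuous/derivable1_diffP;
  exact: (@ex_derive _ _ _ _ _ _ _ (is_derive_cosM w x)).
Qed.

Lemma continuous_sinM (w : R) : continuous (fun t => sin (w * t)).
Proof.
by move=> x; apply/differentiable_continuous/derivable1_diffP;
  exact: (@ex_derive _ _ _ _ _ _ _ (is_derive_sinM w x)).
Qed.

Lemma damped_cvg0 (p : R) (k : R -> R) (B : R) : 0 < p -> (forall x, `|k x| <= B) ->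
  expR (- (p * n%:R)) * k n%:R @[n --> \oo] --> 0.
Proof.
move=> p0 kB; apply/norm_cvg0P.
apply: (@squeeze_cvgr _ _ _ _ (fun=> 0) (fun n => expR (- (p * n%:R)) * B)).
- apply: nearW => n; rewrite normr_ge0 /= normrM ger0_norm ?expR_ge0 //.
  by rewrite ler_wpM2l ?expR_ge0.
- exact: cvg_cst.
- rewrite -[X in _ --> X](mul0r B); apply: cvgM; [exact: expR_cvg0|exact: cvg_cst].
Qed.

Lemma itg_cexp_cos (p w : R) : 0 < p ->
  itg (fun t => cexp p t * cos (w * t)) = p / (p ^+ 2 + w ^+ 2).
Proof.
move=> p0; have D0 : p ^+ 2 + w ^+ 2 != 0.
  by rewrite gt_eqF // ltr_wpDr ?sqr_ge0 // exprn_gt0.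
pose F t := expR (- (p * t)) * ((p ^+ 2 + w ^+ 2)^-1 * (w * sin (w * t) - p * cos (w * t))).
have dF (x : R) : is_derive x 1 F (expR (- (p * x)) * cos (w * x)).
  have h1 := derive_expM p x.
  have h2 : is_derive x 1 (fun t => (p ^+ 2 + w ^+ 2)^-1 * (w * sin (w * t) - p * cos (w * t)))
     ((p ^+ 2 + w ^+ 2)^-1 * (w * (w * cos (w * x)) - p * (- (w * sin (w * x))))).
    exact: (is_deriveZ _ (is_deriveB (is_deriveZ _ (is_derive_sinM w x)) (is_deriveZ _ (is_derive_cosM w x)))).
  have h3 := is_deriveM h1 h2.
  apply: (@is_derive_eq _ _ _ _ _ _ _ _ h3).
  by rewrite /GRing.scale /=; field.
have F0 : F n%:R @[n --> \oo] --> 0.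
  apply: (@damped_cvg0 p (fun t => (p ^+ 2 + w ^+ 2)^-1 * (w * sin (w * t) - p * cos (w * t))) (`|(p ^+ 2 + w ^+ 2)^-1| * (`|w| + `|p|))) => // x.
  rewrite normrM ler_wpM2l // (le_trans (ler_normB _ _)) // !normrM.
  by rewrite lerD // ler_piMr // ?sin_norm_le1 ?cos_norm_le1.
rewrite (itg_cexp_FTC p0 (@continuous_cosM w) (fun x => cos_norm_le1 _) dF F0).
by rewrite /F mulr0 oppr0 expR0 mulr0 sin0 cos0; field.
Qed.

Lemma itg_cexp_sin (p w : R) : 0 < p ->
  itg (fun t => cexp p t * sin (w * t)) = w / (p ^+ 2 + w ^+ 2).
Proof.
move=> p0; have D0 : p ^+ 2 + w ^+ 2 != 0.
  by rewrite gt_eqF // ltr_wpDr ?sqr_ge0 // exprn_gt0.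
pose F t := expR (- (p * t)) * (- (p ^+ 2 + w ^+ 2)^-1 * (p * sin (w * t) + w * cos (w * t))).
have dF (x : R) : is_derive x 1 F (expR (- (p * x)) * sin (w * x)).
  have h1 := derive_expM p x.
  have h2 : is_derive x 1 (fun t => - (p ^+ 2 + w ^+ 2)^-1 * (p * sin (w * t) + w * cos (w * t)))
     (- (p ^+ 2 + w ^+ 2)^-1 * (p * (w * cos (w * x)) + w * (- (w * sin (w * x))))).
    exact: (is_deriveZ _ (is_deriveD (is_deriveZ _ (is_derive_sinM w x)) (is_deriveZ _ (is_derive_cosM w x)))).
  have h3 := is_deriveM h1 h2.
  apply: (@is_derive_eq _ _ _ _ _ _ _ _ h3).
  by rewrite /GRing.scale /=; field.
have F0 : F n%:R @[n --> \oo] --> 0.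
  apply: (@damped_cvg0 p (fun t => - (p ^+ 2 + w ^+ 2)^-1 * (p * sin (w * t) + w * cos (w * t))) (`|- (p ^+ 2 + w ^+ 2)^-1| * (`|p| + `|w|))) => // x.
  rewrite normrM ler_wpM2l // (le_trans (ler_normD _ _)) // !normrM.
  by rewrite lerD // ler_piMr // ?sin_norm_le1 ?cos_norm_le1.
rewrite (itg_cexp_FTC p0 (@continuous_sinM w) (fun x => sin_norm_le1 _) dF F0).
by rewrite /F mulr0 oppr0 expR0 mulr0 sin0 cos0; field.
Qed.

Lemma itg_cexp p : 0 < p -> itg (cexp p) = p^-1.
Proof.
move=> p0; have := itg_cexp_cos 0 p0.
rewrite (_ : (fun t => _) = cexp p); last first.
  by apply/funext => t; rewrite mul0r cos0 mulr1.
move=> ->; rewrite expr0n addr0; field; exact: lt0r_neq0.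
Qed.

End trigonometric_integrals.

(** * The Poisson kernel and the minimum principle on the half-plane *)

Section poisson_kernel.
Context {R : realType}.
Notation mu := (@lebesgue_measure R).

Lemma ge0_itg_eq0 (f : R -> R) : intg f -> (forall x, 0 <= f x) -> itg f = 0 ->
  {ae mu, forall x, f x = 0}.
Proof.
move=> fi f0 fz; have mf := intg_meas fi.
have /(_ measurableT (EFin \o f)) H := @ae_eq_integral_abs _ _ R mu setT.
have [h _] := H (proj2 (measurable_EFinP _ _) mf).
have : (\int[mu]_x `|(EFin \o f) x| = 0)%E.
  under eq_integral => x _ do rewrite /= ger0_norm //.
  by rewrite (intg_EFin fi) fz.
by move/h; apply: aeS => x /(_ I) /= [].
Qed.

(** This is pi times the Poisson kernel of the right half-plane at distance [s] from the
    boundary. *)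
Definition poisson (s y : R) : R := s / (s ^+ 2 + y ^+ 2).

Lemma poisson_den_gt0 (s y : R) : 0 < s -> 0 < s ^+ 2 + y ^+ 2.
Proof. by move=> s0; rewrite ltr_wpDr ?sqr_ge0 // exprn_gt0. Qed.

Lemma poisson_ge0 (s y : R) : 0 < s -> 0 <= poisson s y.
Proof. by move=> s0; rewrite divr_ge0 ?(ltW s0) // ltW // poisson_den_gt0. Qed.

Lemma continuous_poisson (s : R) : 0 < s -> continuous (poisson s).
Proof.
move=> s0 y; apply: cvgM; first exact: cvg_cst.
apply: cvgV; first by rewrite gt_eqF // poisson_den_gt0.
by apply: cvgD; [exact: cvg_cst|exact: exprn_continuous].
Qed.

Lemma integral_poisson (s : R) : 0 < s -> (\int[mu]_x (poisson s x)%:E = pi%:E)%E.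
Proof.
move=> s0.
rewrite ge0_symfun_integralT; first last.
- by move=> x /=; rewrite /poisson sqrrN.
- exact: continuous_poisson.
- by move=> x; exact: poisson_ge0.
have -> : [set x : R | 0 <= x] = `[0%R, +oo[%classic.
  by apply/seteqP; split => x /=; rewrite in_itv /= andbT.
have dF (x : R) : is_derive x 1 (fun x => atan (s^-1 * x)) (poisson s x).
  have h : is_derive x (1:R) (fun t : R => s^-1 * t) (s^-1 *: 1) by exact: is_deriveZ.
  rewrite /GRing.scale /= mulr1 in h.
  have h2 : is_derive (s^-1 * x) (1:R) (@atan R) ((1 + (s^-1 * x) ^+ 2)^-1) by exact: is_derive1_atan.
  have h3 := is_derive1_comp h2 h.
  apply: (@is_derive_eq _ _ _ _ _ _ _ _ h3).
  have p0 := poisson_den_gt0 x s0.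
  have q0 : 1 + (s^-1 * x) ^+ 2 != 0 by rewrite gt_eqF // ltr_wpDr ?sqr_ge0.
  rewrite /poisson.
  have -> : 1 + (s^-1 * x) ^+ 2 = (s ^+ 2 + x ^+ 2) / s ^+ 2 by field; exact: lt0r_neq0.
  by field; rewrite ?(gt_eqF p0) ?(gt_eqF s0).
have cF : continuous (fun x => atan (s^-1 * x)).
  by move=> x; apply/differentiable_continuous/derivable1_diffP;
    exact: (@ex_derive _ _ _ _ _ _ _ (dF x)).
have lim : atan (s^-1 * x) @[x --> +oo] --> pi / 2.
  apply: (@cvg_comp _ _ _ (fun x => s^-1 * x) (@atan R) _ (pinfty_nbhs R)); last exact: cvgy_atan.
  have si : 0 < s^-1 by rewrite invr_gt0.
  by apply/cvgryPge => A; near=> x; rewrite mulrC -ler_pdivrMr //; near: x; apply: nbhs_pinfty_ge; rewrite num_real.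
rewrite (ge0_continuous_FTC2y _ _ lim).
- by rewrite mulr0 atan0 sube0 -EFinM mulrCA divff ?mulr1.
- by move=> x _; exact: poisson_ge0.
- by apply: continuous_subspaceT; exact: continuous_poisson.
- by move=> x _; exact: (@ex_derive _ _ _ _ _ _ _ (dF x)).
- by apply: cvg_at_right_filter; exact: cF.
- by move=> x _; rewrite derive1E (@derive_val _ _ _ _ _ _ _ (dF x)).
Unshelve. all: by end_near. Qed.

Lemma intg_poisson (s : R) : 0 < s -> intg (poisson s).
Proof.
move=> s0; apply: intg_nneg.
- by apply: continuous_measurable_fun; exact: continuous_poisson.
- by move=> x; exact: poisson_ge0.
- by rewrite integral_poisson // ltry.
Qed.

Lemma itg_poisson (s : R) : 0 < s -> itg (poisson s) = pi.
Proof. by move=> s0; rewrite /itg /Rintegral integral_poisson. Qed.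

(** Up to powers of pi, the semigroup law of the Poisson kernels at the origin. The strict
    inequality keeps the partial fractions nondegenerate. *)
Lemma itg_poisson_mul (s p : R) : 0 < s -> s < p ->
  itg (fun y => poisson s y * poisson p y) = pi / (p + s).
Proof.
move=> s0 sp; have p0 : 0 < p by exact: lt_trans sp.
have D : p ^+ 2 - s ^+ 2 != 0.
  by rewrite subr_sqr mulf_neq0 // ?subr_eq0 gt_eqF // addr_gt0.
have D1 : p - s != 0 by rewrite subr_eq0 gt_eqF.
have D2 : p + s != 0 by rewrite gt_eqF // addr_gt0.
rewrite (@itg_eq _ _ (fun y => p / (p ^+ 2 - s ^+ 2) * poisson s y -
     s / (p ^+ 2 - s ^+ 2) * poisson p y)).
  have is0 := intg_poisson s0; have ip0 := intg_poisson p0.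
  rewrite itgB; [|exact: intgZ is0|exact: intgZ ip0].
  rewrite (itgZ _ is0) (itgZ _ ip0) !itg_poisson //.
  by rewrite subr_sqr; field; rewrite ?D1 ?D2.
move=> y; rewrite /poisson.
have := poisson_den_gt0 y s0; have := poisson_den_gt0 y p0.
move=> /lt0r_neq0 A /lt0r_neq0 B.
by field; rewrite ?A ?B ?D.
Qed.

Let E (s t : R) : R := itg (fun y => poisson s y * cos (t * y)).

Let iE (s t : R) : 0 < s -> intg (fun y => poisson s y * cos (t * y)).
Proof.
move=> s0; apply: (@intgM_bdd _ _ _ 1 (intg_poisson s0)).
- by apply: continuous_measurable_fun; exact: continuous_cosM.
- by move=> x; exact: cos_norm_le1.
Qed.

Let cE (s : R) : 0 < s -> continuous (E s).
Proof.
move=> s0 t; apply/(@cvg_nbhsP _ R^o) => u ut.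
have [||||_] := @itg_dct R (fun n y => poisson s y * cos (u n * y))
  (fun y => poisson s y * cos (t * y)) (poisson s) _ _ _ (intg_poisson s0).
- by move=> n; exact: intg_meas (iE _ s0).
- exact: intg_meas (iE _ s0).
- move=> y; apply: cvgM; first exact: cvg_cst.
  have ht : (u n : R) * y @[n --> \oo] --> t * y by apply: cvgM => //; exact: cvg_cst.
  exact: (cvg_comp _ _ ht (@continuous_cos R _)).
- move=> n y; rewrite normrM (ger0_norm (poisson_ge0 _ s0)) ler_piMr ?poisson_ge0 //.
  exact: cos_norm_le1.
by [].
Qed.

Let bE (s t : R) : 0 < s -> `|E s t| <= pi.
Proof.
move=> s0; rewrite -(itg_poisson s0); apply: itg_norm_le; [exact: iE|exact: intg_poisson|].
move=> y; rewrite normrM (ger0_norm (poisson_ge0 _ s0)) ler_piMr ?poisson_ge0 //.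
exact: cos_norm_le1.
Qed.

(* The Laplace transforms in [t] of both sides agree, by partial fractions. *)
Lemma poisson_cos (s : R) : 0 < s ->
  {ae mu, forall t, 0 <= t -> itg (fun y => poisson s y * cos (t * y)) = pi * expR (- (s * t))}.
Proof.
move=> s0.
(* The absolute value keeps [H] bounded on the whole line; [h] below is its causal part. *)
pose H (t : R) := E s t - pi * expR (- (s * `|t|)).
have cH : continuous H.
  move=> t; apply: cvgB; first exact: cE.
  apply: cvgM; first exact: cvg_cst.
  apply: (@continuous_comp _ _ _ (fun t : R => `|t|) (fun t => expR (- (s * t)))).
    exact: norm_continuous.
  exact: continuous_expM.
have bH t : `|H t| <= pi + pi.
  rewrite (le_trans (ler_normB _ _)) // lerD ?bE // normrM gtr0_norm ?pi_gt0 //.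
  rewrite ler_piMr ?pi_ge0 // gtr0_norm ?expR_gt0 // -[leRHS]expR0 ler_expR lerNl oppr0.
  by rewrite mulr_ge0 // ltW.
pose h (t : R) := H t * \1_(`[0, +oo[%classic) t.
have mh : measurable_fun setT h.
  by apply: measurable_funM => //; exact: continuous_measurable_fun.
have h1 (t : R) : 0 <= t -> h t = H t.
  by move=> t0; rewrite /h indicE mem_setE in_itv /= t0 mulr1.
have h0 : causal h.
  by move=> t t0; rewrite /h indicE mem_setE in_itv /= leNgt t0 mulr0.
have ih (p : R) : 0 < p -> intg (fun t => h t * expR (- (p * t))).
  move=> p0; apply: (@intg_le _ _ (fun t => (pi + pi) * cexp p t)).
  - by apply: measurable_funM => //; apply: continuous_measurable_fun; exact: continuous_expM.
  - move=> t; have [t0|t0] := ltP t 0; first by rewrite h0 // causal_cexp // mul0r normr0 mulr0.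
    by rewrite h1 // normrM /cexp t0 (gtr0_norm (expR_gt0 _)) ler_wpM2r ?expR_ge0.
  - exact/intgZ/intg_cexp.
have L (p : R) : s < p -> itg (fun t => h t * expR (- (p * t))) = 0.
  move=> sp; have p0 : 0 < p by exact: lt_trans sp.
  have iEp : intg (fun t => cexp p t * E s t).
    apply: (@intgM_bdd _ _ _ pi (intg_cexp p0)).
    - by apply: continuous_measurable_fun; exact: cE.
    - by move=> t; exact: bE.
  have ps0 : 0 < p + s by rewrite addr_gt0.
  rewrite (@itg_eq _ _ (fun t => cexp p t * E s t - pi * cexp (p + s) t)); last first.
    move=> t; have [t0|t0] := ltP t 0; first by rewrite h0 // !causal_cexp // !mul0r mulr0 subr0.
    rewrite h1 // /H /cexp t0 (ger0_norm t0) mulrBl mulrC -mulrA -expRD.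
    by congr (_ - _ * expR _); ring.
  rewrite itgB //; last by apply: intgZ; exact: intg_cexp.
  rewrite itgZ ?itg_cexp //; last exact: intg_cexp.
  have -> : itg (fun t => cexp p t * E s t) = itg (fun y => poisson s y * poisson p y).
    have [||||_ _ ->] := @fubini_bdd R (cexp p) (poisson s) (fun t y => cos (t * y)) 1.
    - exact: intg_cexp.
    - exact: intg_poisson.
    - by apply: (measurableT_comp measurable_cos_fun); exact: measurable_funM.
    - by move=> x y; exact: cos_norm_le1.
    apply: itg_eq => y; congr (_ * _).
    rewrite [RHS]/poisson -(itg_cexp_cos y p0).
    by apply: itg_eq => t; rewrite [y * t]mulrC.
  by rewrite itg_poisson_mul // subrr.
have Z v (T : R) : continuous v -> (forall t, T <= t -> v t = 0) -> itg (fun t => h t * v t) = 0.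
  move=> cv vT.
  have := @laplace_weak0 R h 0 (s + 1) v T _ mh h0.
  rewrite mul0r add0r; apply => //.
  - by rewrite addr_ge0 // ltW.
  - by apply: ih; rewrite addr_gt0.
  - by move=> n; rewrite add0r L // -addrA ltrDl ltr_wpDr.
(* Testing against [H t * max 0 (n - t)] makes the integrand nonnegative, so its zero integral makes
   it vanish almost everywhere; some [n] beyond [t] then forces [H t = 0]. *)
have Zn (n : nat) : {ae mu, forall t, h t * (H t * Num.max 0 (n%:R - t)) = 0}.
  pose v (t : R) := H t * Num.max 0 (n%:R - t).
  have cv : continuous v.
    have cm : continuous (fun t : R => Num.max 0 (n%:R - t)).
      move=> t; apply: (@continuous_max R R (fun=> 0) (fun t => n%:R - t)); first exact: cvg_cst.
      by apply: cvgB; [exact: cvg_cst|exact: cvg_id].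
    by move=> t; apply: cvgM; [exact: cH|exact: cm].
  have vT t : n%:R <= t -> v t = 0.
    by move=> nt; rewrite /v max_l ?mulr0 // subr_le0.
  apply: ge0_itg_eq0; last exact: Z cv vT.
  - apply: (@intg_le _ _ (fun t => ((pi + pi) ^+ 2 * n%:R * expR n%:R) * cexp 1 t)).
    + by apply: measurable_funM => //; exact: continuous_measurable_fun.
    + move=> t; have [t0|t0] := ltP t 0; first by rewrite h0 // mul0r normr0 causal_cexp // mulr0.
      have C0 : 0 <= (pi + pi) ^+ 2 * n%:R :> R by rewrite mulr_ge0 ?sqr_ge0.
      have [nt|tn] := leP n%:R t.
        have -> : H t * Num.max 0 (n%:R - t) = 0 by exact: vT.
        by rewrite mulr0 normr0 mulr_ge0 ?cexp_ge0 // mulr_ge0 ?expR_ge0.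
      have nt0 : 0 <= n%:R - t by rewrite subr_ge0 ltW.
      rewrite h1 // max_r // normrM normrM (ger0_norm nt0).
      apply: (@le_trans _ _ ((pi + pi) ^+ 2 * n%:R)).
        rewrite expr2 -mulrA ler_pM ?mulr_ge0 // ler_pM //.
        by rewrite lerBlDr lerDl.
      rewrite -[leRHS]mulrA ler_peMr // /cexp t0 -expRD -[leLHS]expR0 ler_expR.
      by rewrite mul1r.
    + by apply: intgZ; exact: intg_cexp.
  - move=> t; have [t0|t0] := ltP t 0; first by rewrite h0 // mul0r.
    by rewrite h1 // mulrA -expr2 mulr_ge0 ?sqr_ge0 // le_max lexx.
have := @ae_foralln _ _ _ mu _ Zn; apply: aeS => t Ht t0.
have /eqP := Ht (Num.truncn t).+1.
have tn : t < (Num.truncn t).+1%:R by exact: truncnS_gt.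
rewrite h1 // max_r ?subr_ge0 ?(ltW tn) // mulrA -expr2 mulf_eq0 sqrf_eq0.
move=> /orP[/eqP/subr0_eq|/eqP/subr0_eq Et]; first by rewrite (ger0_norm t0).
by move: tn; rewrite Et ltxx.
Qed.

(* Poisson's formula: Re A(s + i w) is an average of the values of Re A on the imaginary axis. *)
Lemma halfplane_min (a0 : R) (a : R -> R) (e : R) : intg a -> causal a ->
  (forall w, e <= a0 + itg (fun t => a t * cos (w * t))) ->
  forall s w, 0 <= s -> e <= a0 + itg (fun t => a t * (expR (- (s * t)) * cos (w * t))).
Proof.
move=> ia ca ea s w; rewrite le_eqVlt => /predU1P[<-|s0].
  have := ea w; congr (_ <= _ + _); apply: itg_eq => t.
  by rewrite mul0r oppr0 expR0 mul1r.
have ip := intg_poisson s0.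
have bc (y : R) : intg (fun t => a t * cos ((w + y) * t)).
  apply: (@intgM_bdd _ _ _ 1 ia).
  - by apply: continuous_measurable_fun; exact: continuous_cosM.
  - by move=> x; exact: cos_norm_le1.
have mk : measurable_fun setT (fun z : R * R => cos ((w + z.1) * z.2)).
  apply: (measurableT_comp measurable_cos_fun).
  by apply: measurable_funM => //; exact: measurable_funD.
pose J := itg (fun y => poisson s y * itg (fun t => a t * cos ((w + y) * t))).
have [||||iJ iJ' JE] := @fubini_bdd R (poisson s) a (fun y t => cos ((w + y) * t)) 1.
- exact: ip.
- exact: ia.
- exact: mk.
- by move=> x y; exact: cos_norm_le1.
rewrite -/J in JE.
have inner : {ae mu, forall t, 0 <= t -> itg (fun y => poisson s y * cos ((w + y) * t)) =
    pi * (expR (- (s * t)) * cos (w * t))}.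
  apply: aeS (poisson_cos s0) => t Et t0.
  have isn : intg (fun y => poisson s y * sin (t * y)).
    apply: (@intgM_bdd _ _ _ 1 ip).
    - by apply: continuous_measurable_fun; exact: continuous_sinM.
    - by move=> x; exact: sin_norm_le1.
  (* The integrand is odd, so reflection changes the sign of the integral. *)
  have sn0 : itg (fun y => poisson s y * sin (t * y)) = 0.
    have [_] := itg_refl 0 isn; set X := itg _; set Y := itg _ => XY.
    have : X = - Y.
      rewrite -mulN1r -itgZ //; apply: itg_eq => y.
      by rewrite sub0r /poisson sqrrN mulrN sinN; ring.
    by rewrite XY => /eqP; rewrite -subr_eq0 opprK -mulr2n mulrn_eq0 /= => /eqP.
  rewrite (@itg_eq _ _ (fun y => cos (w * t) * (poisson s y * cos (t * y)) -
      sin (w * t) * (poisson s y * sin (t * y)))); last first.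
    by move=> y; rewrite mulrDl cosD [y * t]mulrC; ring.
  rewrite itgB; [|exact/intgZ/iE|exact: intgZ].
  by rewrite !itgZ //; [rewrite sn0 Et //; ring|exact: iE].
have mkern : measurable_fun setT (fun t : R => expR (- (s * t)) * cos (w * t)).
  by apply: continuous_measurable_fun => x; apply: cvgM; [exact: continuous_expM|exact: continuous_cosM].
have JE2 : J = pi * itg (fun t => a t * (expR (- (s * t)) * cos (w * t))).
  rewrite JE -itgZ; last first.
    apply: (@intg_le _ _ (fun t => `|a t|)).
    - by apply: measurable_funM => //; exact: intg_meas.
    - move=> t; have [t0|t0] := ltP t 0; first by rewrite ca // !mul0r.
      rewrite normrM ler_piMr // normrM mulr_ile1 ?cos_norm_le1 //.
      by rewrite gtr0_norm ?expR_gt0 // -[leRHS]expR0 ler_expR lerNl oppr0 mulr_ge0 // ltW.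
    - exact: intg_norm.
  apply: itg_ae.
  - exact: intg_meas iJ'.
  - apply: measurable_funM => //; apply: measurable_funM => //; exact: intg_meas.
  - apply: aeS inner => t Et; have [t0|t0] := ltP t 0; first by rewrite ca // !mul0r mulr0.
    by rewrite Et //; ring.
have LB : pi * (e - a0) <= J.
  rewrite mulrC -(itg_poisson s0) -itgZ //; apply: itg_le.
  - exact: intgZ.
  - exact: iJ.
  - by move=> y; rewrite mulrC ler_wpM2l ?poisson_ge0 // lerBlDl.
by move: LB; rewrite JE2 ler_pM2l ?pi_gt0 // lerBlDl.
Qed.

End poisson_kernel.

(** * The Wiener algebra of the closed right half-plane *)

Section half_plane_transform.
Context {R : realType}.
Notation mu := (@lebesgue_measure R).
Implicit Types (a b f g : R -> R) (s : R[i]).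

Definition lapc f (x w : R) : R := itg (fun t => f t * (expR (- (x * t)) * cos (w * t))).
Definition laps f (x w : R) : R := itg (fun t => f t * (expR (- (x * t)) * sin (w * t))).
Definition lap f s : R[i] :=
  lapc f (complex.Re s) (complex.Im s) +i* (- laps f (complex.Re s) (complex.Im s)).

Lemma continuous_kerc (x w : R) : continuous (fun t => expR (- (x * t)) * cos (w * t)).
Proof. by move=> t; apply: cvgM; [exact: continuous_expM|exact: continuous_cosM]. Qed.

Lemma continuous_kers (x w : R) : continuous (fun t => expR (- (x * t)) * sin (w * t)).
Proof. by move=> t; apply: cvgM; [exact: continuous_expM|exact: continuous_sinM]. Qed.

Lemma expR_neg_le1 (x t : R) : 0 <= x -> 0 <= t -> expR (- (x * t)) <= 1.
Proof. by move=> x0 t0; rewrite -[leRHS]expR0 ler_expR lerNl oppr0 mulr_ge0. Qed.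

Lemma causal_ker_le f (k : R -> R) (x t : R) : causal f -> 0 <= x -> `|k t| <= 1 ->
  `|f t * (expR (- (x * t)) * k t)| <= `|f t|.
Proof.
move=> cf x0 kt; have [t0|t0] := ltP t 0; first by rewrite cf // !mul0r.
rewrite normrM ler_piMr // normrM mulr_ile1 //.
by rewrite gtr0_norm ?expR_gt0 // expR_neg_le1.
Qed.

Lemma intg_kerc f (x w : R) : intg f -> causal f -> 0 <= x ->
  intg (fun t => f t * (expR (- (x * t)) * cos (w * t))).
Proof.
move=> fi cf x0; apply: (@intg_le _ _ (fun t => `|f t|)).
- apply: measurable_funM; first exact: intg_meas.
  by apply: continuous_measurable_fun; exact: continuous_kerc.
- by move=> t; apply: (@causal_ker_le f (fun t => cos (w * t))) => //; exact: cos_norm_le1.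
- exact: intg_norm.
Qed.

Lemma intg_kers f (x w : R) : intg f -> causal f -> 0 <= x ->
  intg (fun t => f t * (expR (- (x * t)) * sin (w * t))).
Proof.
move=> fi cf x0; apply: (@intg_le _ _ (fun t => `|f t|)).
- apply: measurable_funM; first exact: intg_meas.
  by apply: continuous_measurable_fun; exact: continuous_kers.
- by move=> t; apply: (@causal_ker_le f (fun t => sin (w * t))) => //; exact: sin_norm_le1.
- exact: intg_norm.
Qed.

Lemma laplace_lap f s : causal f -> laplace f s = lap f s.
Proof.
move=> cf; have E (k : R -> R) : \int[mu]_(t in `[0, +oo[) (expR (- complex.Re s * t) * k t * f t) =
    itg (fun t => f t * (expR (- (complex.Re s * t)) * k t)).
  rewrite Rintegral_mkcond; apply: itg_eq => t; rewrite patchE mem_setE in_itv /= andbT.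
  have [t0|t0] := leP 0 t; first by rewrite mulrC mulNr.
  by rewrite cf // mul0r.
by rewrite /laplace /lap (E (fun t => cos (complex.Im s * t))) (E (fun t => sin (complex.Im s * t))).
Qed.

Lemma causal_cnv a b : causal a -> causal b -> causal (cnv a b).
Proof.
move=> ca cb t t0; rewrite /cnv -[RHS](@itg0 R); apply: itg_eq => x.
have [x0|x0] := ltP x 0; first by rewrite ca // mul0r.
by rewrite cb ?mulr0 // subr_lt0 (lt_le_trans t0).
Qed.

(** The kernels exp(- x t) cos(w t) and exp(- x t) sin(w t) split over t = y + (t - y) by the
    addition formulas. Real and imaginary parts of the product are then integrals of convolutions of
    damped functions, evaluated by [intg_conv]. *)
Lemma lap_cnv a b s : intg a -> causal a -> intg b -> causal b -> 0 <= complex.Re s ->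
  lap (cnv a b) s = lap a s * lap b s.
Proof.
move=> ia ca ib cb; case: s => x w /= x0.
have iac := intg_kerc w ia ca x0; have ias := intg_kers w ia ca x0.
have ibc := intg_kerc w ib cb x0; have ibs := intg_kers w ib cb x0.
have [icc ecc aecc] := intg_conv iac ibc.
have [iss ess aess] := intg_conv ias ibs.
have [ics ecs aecs] := intg_conv iac ibs.
have [isc esc aesc] := intg_conv ias ibc.
have [iab _ aeab] := intg_conv ia ib.
have cab := causal_cnv ca cb.
have eC : lapc (cnv a b) x w = lapc a x w * lapc b x w - laps a x w * laps b x w.
  rewrite /lapc /laps -ecc -ess -itgB //; apply: itg_ae.
  - exact: intg_meas (intg_kerc w iab cab x0).
  - exact: intg_meas (intgB icc iss).
  - apply: aeS2 (aeS2 (fun t => @conj _ _) aecc aess) aeab => t [h1 h2] h3.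
    rewrite /cnv -itgB // mulrC.
    rewrite -itgZ //; apply: itg_eq => y.
    have -> : cos (w * t) = cos (w * y + w * (t - y)) by congr cos; ring.
    have -> : expR (- (x * t)) = expR (- (x * y)) * expR (- (x * (t - y))).
      by rewrite -expRD; congr expR; ring.
    by rewrite cosD; ring.
have eS : laps (cnv a b) x w = lapc a x w * laps b x w + laps a x w * lapc b x w.
  rewrite /lapc /laps -ecs -esc -itgD //; apply: itg_ae.
  - exact: intg_meas (intg_kers w iab cab x0).
  - exact: intg_meas (intgD ics isc).
  - apply: aeS2 (aeS2 (fun t => @conj _ _) aecs aesc) aeab => t [h1 h2] h3.
    rewrite /cnv -itgD // mulrC.
    rewrite -itgZ //; apply: itg_eq => y.
    have -> : sin (w * t) = sin (w * y + w * (t - y)) by congr sin; ring.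
    have -> : expR (- (x * t)) = expR (- (x * y)) * expR (- (x * (t - y))).
      by rewrite -expRD; congr expR; ring.
    by rewrite sinD; ring.
rewrite /lap /= eC eS; apply/eqP; rewrite eq_complex /=; apply/andP; split; apply/eqP; ring.
Qed.

(** Transforms of a Dirac mass at 0 plus an integrable causal density, considered up to and
    including the imaginary axis; a ring under pointwise operations. *)
Definition wiener (H : R[i] -> R[i]) : Prop := exists (a0 : R) (a : R -> R), [/\ intg a, causal a &
  forall s, 0 <= complex.Re s -> H s = a0%:C + lap a s].

Lemma lap0 s : lap (fun=> 0) s = 0.
Proof.
rewrite /lap /lapc /laps (@itg_eq _ _ (fun=> 0)) ?(@itg_eq _ (fun t => 0 * (_ * sin _)) (fun=> 0)) ?itg0 ?oppr0 //.
  by move=> t; rewrite mul0r.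
by move=> t; rewrite mul0r.
Qed.

Lemma lapD a b s : intg a -> causal a -> intg b -> causal b -> 0 <= complex.Re s ->
  lap (fun t => a t + b t) s = lap a s + lap b s.
Proof.
move=> ia ca ib cb s0; rewrite /lap /lapc /laps.
rewrite (@itg_eq _ _ (fun t => a t * (expR (- (complex.Re s * t)) * cos (complex.Im s * t)) +
   b t * (expR (- (complex.Re s * t)) * cos (complex.Im s * t)))); last by move=> t; rewrite mulrDl.
rewrite (@itg_eq _ (fun t => (_ + _) * (_ * sin _)) (fun t => a t * (expR (- (complex.Re s * t)) * sin (complex.Im s * t)) +
   b t * (expR (- (complex.Re s * t)) * sin (complex.Im s * t)))); last by move=> t; rewrite mulrDl.
rewrite !itgD; [|exact: intg_kers|exact: intg_kers|exact: intg_kerc|exact: intg_kerc].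
by apply/eqP; rewrite eq_complex /= opprD !eqxx.
Qed.

Lemma lapZ (c : R) a s : intg a -> causal a -> 0 <= complex.Re s ->
  lap (fun t => c * a t) s = c%:C * lap a s.
Proof.
move=> ia ca s0; rewrite /lap /lapc /laps.
rewrite (@itg_eq _ _ (fun t => c * (a t * (expR (- (complex.Re s * t)) * cos (complex.Im s * t))))); last by move=> t; rewrite -!mulrA.
rewrite (@itg_eq _ (fun t => c * a t * (_ * sin _)) (fun t => c * (a t * (expR (- (complex.Re s * t)) * sin (complex.Im s * t))))); last by move=> t; rewrite -!mulrA.
rewrite !itgZ; [|exact: intg_kers|exact: intg_kerc].
by apply/eqP; rewrite eq_complex /= !mul0r subr0 addr0 mulrN !eqxx.
Qed.

Lemma wiener_cst (c : R) : wiener (fun=> c%:C).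
Proof.
by exists c, (fun=> 0); split; [exact: intg0| |move=> s _; rewrite lap0 addr0].
Qed.

Lemma wiener_lap (c : R) a : intg a -> causal a -> wiener (fun s => c%:C + lap a s).
Proof. by exists c, a. Qed.

Lemma wienerD H K : wiener H -> wiener K -> wiener (fun s => H s + K s).
Proof.
move=> [a0 [a [ia ca Ha]]] [b0 [b [ib cb Hb]]].
exists (a0 + b0), (fun t => a t + b t); split; first exact: intgD.
- by move=> t t0; rewrite ca // cb // addr0.
- by move=> s s0; rewrite Ha // Hb // lapD // rmorphD /= addrACA.
Qed.

Lemma wienerM H K : wiener H -> wiener K -> wiener (fun s => H s * K s).
Proof.
move=> [a0 [a [ia ca Ha]]] [b0 [b [ib cb Hb]]].
have [iab _ _] := intg_conv ia ib; have cab := causal_cnv ca cb.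
have ib' := intgZ a0 ib; have ia' := intgZ b0 ia.
have cb' : causal (fun t => a0 * b t) by move=> t t0; rewrite cb // mulr0.
have ca' : causal (fun t => b0 * a t) by move=> t t0; rewrite ca // mulr0.
exists (a0 * b0), (fun t => (a0 * b t + b0 * a t) + cnv a b t); split.
- exact: intgD (intgD ib' ia') iab.
- by move=> t t0; rewrite cb' // ca' // cab // !addr0.
- move=> s s0; rewrite Ha // Hb // lapD //; [|exact: intgD|by move=> t t0; rewrite cb' // ca' // addr0].
  by rewrite lapD // !lapZ // lap_cnv // rmorphM /=; ring.
Qed.

Lemma wienerZ (c : R) H : wiener H -> wiener (fun s => c%:C * H s).
Proof. by move=> wH; apply: wienerM wH; exact: wiener_cst. Qed.

Lemma wiener_exp n H : wiener H -> wiener (fun s => H s ^+ n).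
Proof.
move=> wH; elim: n => [|n IH].
  by have -> : (fun s => H s ^+ 0) = (fun=> 1%:C) by []; exact: wiener_cst.
have -> : (fun s => H s ^+ n.+1) = (fun s => H s * H s ^+ n) by apply/funext => s; rewrite exprS.
exact: wienerM.
Qed.

Lemma wiener_sum (n : nat) (H : nat -> R[i] -> R[i]) : (forall i, (i < n)%N -> wiener (H i)) ->
  wiener (fun s => \sum_(i < n) H i s).
Proof.
elim: n => [|n IH] h.
  have -> : (fun s => \sum_(i < 0) H i s) = (fun=> 0%:C) by apply/funext => s; rewrite big_ord0.
  exact: wiener_cst.
have -> : (fun s => \sum_(i < n.+1) H i s) = (fun s => \sum_(i < n) H i s + H n s).
  by apply/funext => s; rewrite big_ord_recr.
by apply: wienerD; [apply: IH => i /ltnW; exact: h|exact: h].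
Qed.

Lemma s1_neq0 s : 0 <= complex.Re s -> s + 1 != 0.
Proof.
case: s => x w /= x0; rewrite eq_complex /= negb_and; apply/orP; left.
by rewrite gt_eqF // ltr_wpDl.
Qed.

Lemma wiener_inv_s1 : wiener (fun s => (s + 1)^-1).
Proof.
exists 0, (cexp 1); split; [exact: intg_cexp|exact: causal_cexp|].
move=> s s0; rewrite add0r; apply: (mulfI (s1_neq0 s0)); rewrite divff ?s1_neq0 //.
case: s s0 => x w /= x0; have p0 : 0 < x + 1 by rewrite ltr_wpDl.
have D := poisson_den_gt0 w p0.
have E (k : R -> R) : itg (fun t => cexp 1 t * (expR (- (x * t)) * k t)) = itg (fun t => cexp (x + 1) t * k t).
  apply: itg_eq => t; rewrite mulrA /cexp; case: ifP => _; last by rewrite !mul0r.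
  by rewrite -expRD; congr (expR _ * _); ring.
rewrite /lap /lapc /laps /= (E (fun t => cos (w * t))) (E (fun t => sin (w * t))).
rewrite itg_cexp_cos // itg_cexp_sin //; apply/eqP; rewrite eq_complex /= addr0.
by apply/andP; split; apply/eqP; field; rewrite ?(gt_eqF D).
Qed.

(** Since s / (s + 1) = 1 - 1 / (s + 1), each s^i / (s + 1)^N with i <= N is a polynomial in 1 / (s
    + 1), the transform of exp(- t). *)
Lemma wiener_poly (p : {poly R}) (N : nat) : (size p <= N)%N ->
  wiener (fun s => (map_poly (real_complex R) p).[s] / (s + 1) ^+ N).
Proof.
move=> pN.
have H : wiener (fun s => \sum_(i < size p)
    ((p`_i)%:C * ((1%:C + (-1)%:C * (s + 1)^-1) ^+ i * ((s + 1)^-1) ^+ (N - i)))).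
  apply: (@wiener_sum _ (fun i s => (p`_i)%:C * ((1%:C + (-1)%:C * (s + 1)^-1) ^+ i * ((s + 1)^-1) ^+ (N - i)))).
  move=> i _; apply: wienerZ; apply: wienerM; apply: wiener_exp; last exact: wiener_inv_s1.
  by apply: wienerD; [exact: wiener_cst|apply: wienerZ; exact: wiener_inv_s1].
case: H => a0 [a [ia ca Ha]]; exists a0, a; split => // s s0; rewrite -Ha //.
have D := s1_neq0 s0.
rewrite horner_coef size_map_poly mulr_suml; apply: eq_bigr => i _.
rewrite coef_map /= -mulrA; congr (_ * _).
have -> : 1%:C + (-1)%:C * (s + 1)^-1 = s / (s + 1).
  have -> : (-1)%:C = -1 :> R[i] by rewrite rmorphN rmorph1.
  by field.
have iN : (i <= N)%N by rewrite (leq_trans _ pN) // ltnW.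
rewrite exprMn -mulrA -exprD subnKC // exprVn //.
Qed.

(** The zeros at [x0 + n] annihilate the measure on continuous test functions that vanish for large
    [t]; the cutoffs [chi n] and dominated convergence extend this to the bounded kernels of the
    transform, on the imaginary axis included. *)
Lemma wiener_eq0 H (x0 : R) : wiener H -> 0 <= x0 ->
  (forall n : nat, H (x0 + n%:R)%:C = 0) -> forall s, 0 <= complex.Re s -> H s = 0.
Proof.
move=> [a0 [a [ia ca Ha]]] x00 Hn.
have ma := intg_meas ia.
have Z v (T : R) : continuous v -> (forall t, T <= t -> v t = 0) ->
    a0 * v 0 + itg (fun t => a t * v t) = 0.
  move=> cv vT; apply: (@laplace_weak0 R a a0 x0 v T) => //.
  - have := intg_kerc 0 ia ca x00; apply: intg_eq => t.
    by rewrite mul0r cos0 mulr1.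
  - move=> n; have xn : 0 <= x0 + n%:R by rewrite addr_ge0.
    have := Hn n; rewrite Ha //= => /eqP; rewrite eq_complex /= => /andP[/eqP h _].
    rewrite -[RHS]h; congr (_ + _); rewrite /lapc; apply: itg_eq => t.
    by rewrite mul0r cos0 mulr1.
have C (k : R -> R) (x : R) : continuous k -> (forall t, `|k t| <= 1) -> 0 <= x ->
    a0 * k 0 + itg (fun t => a t * (expR (- (x * t)) * k t)) = 0.
  move=> ck k1 xx0.
  pose chi (n : nat) (t : R) : R := Num.min 1 (Num.max 0 (n.+1%:R - t)).
  have cchi n : continuous (chi n).
    move=> t; apply: (@continuous_min R R (fun=> 1) (fun t => Num.max 0 (n.+1%:R - t))); first exact: cvg_cst.
    apply: (@continuous_max R R (fun=> 0) (fun t => n.+1%:R - t)); first exact: cvg_cst.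
    by apply: cvgB; [exact: cvg_cst|exact: cvg_id].
  have chi1 n t : `|chi n t| <= 1.
    by rewrite ger0_norm /chi ?le_min ?ler01 /= ?le_max ?lexx // ge_min lexx.
  pose v n t := (expR (- (x * t)) * k t) * chi n t.
  have ck' : continuous (fun t => expR (- (x * t)) * k t).
    by move=> t; apply: cvgM; [exact: continuous_expM|exact: ck].
  have cv n : continuous (v n) by move=> t; apply: cvgM; [exact: ck'|exact: cchi].
  have vT n t : n.+1%:R <= t -> v n t = 0.
    by move=> nt; rewrite /v /chi max_l ?subr_le0 // min_r ?ler01 // mulr0.
  have [||||_ lim] := @itg_dct R (fun n t => a t * v n t)
     (fun t => a t * (expR (- (x * t)) * k t)) (fun t => `|a t|) _ _ _ (intg_norm ia).
  - by move=> n; apply: measurable_funM => //; exact: continuous_measurable_fun.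
  - by apply: measurable_funM => //; exact: continuous_measurable_fun.
  - move=> t; apply: cvg_near_cst; exists (Num.truncn `|t|).+1 => // n /= hn.
    rewrite /v /chi; congr (_ * _); rewrite min_l ?mulr1 // le_max; apply/orP; right.
    rewrite lerBrDr -natr1 addrC lerD2r.
    rewrite (le_trans (ler_norm t)) // ltW // (lt_le_trans (truncnS_gt _)) // ler_nat.
    exact: hn.
  - move=> n t; rewrite /v -mulrA; apply: (@causal_ker_le a (fun t => k t * chi n t)) => //.
    by rewrite normrM mulr_ile1.
  have E n : itg (fun t => a t * v n t) = - (a0 * k 0).
    have v0 : v n 0 = k 0.
      rewrite /v /chi mulr0 oppr0 expR0 mul1r addr0 max_r ?ler0n // min_l ?mulr1 //.
      by rewrite ler1n.
    by have := Z _ _ (cv n) (@vT n); rewrite v0 addrC => /eqP; rewrite addr_eq0 => /eqP.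
  have Ef : (fun n => itg (fun t => a t * v n t)) = fun=> - (a0 * k 0) by exact/funext.
  rewrite Ef in lim; have := cvg_unique _ lim (cvg_cst _) => -> //.
  by rewrite addrN.
move=> s s0; rewrite Ha // /lap; apply/eqP; rewrite eq_complex /=.
have h1 := C (fun t => cos (complex.Im s * t)) _ (@continuous_cosM R _) (fun t => cos_norm_le1 _) s0.
have h2 := C (fun t => sin (complex.Im s * t)) _ (@continuous_sinM R _) (fun t => sin_norm_le1 _) s0.
move: h1 h2; rewrite !mulr0 cos0 sin0 mulr1 mulr0 add0r -/(lapc _ _ _) -/(laps _ _ _) => -> ->.
by rewrite oppr0 addr0 eqxx.
Qed.

End half_plane_transform.

(** * Rational transfer functions up to the imaginary axis *)

Section rational_transfer_functions.
Context {R : realType}.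

Lemma intg_ir_fun (g : impulse R) : ir_L1 g -> intg (ir_fun g).
Proof. by move/Lfun1_integrable. Qed.

Lemma rf_den_root (G : ratfun R) (s : R[i]) :
  (map_poly (real_complex R) (rf_den G)).[s] = 0 ->
  (map_poly (real_complex R) (rf_num G)).[s] != 0.
Proof.
move=> ds; have := rf_coprime G; rewrite coprimep_sym -(coprimep_map (real_complex R)) => /coprimep_root.
by apply; apply/rootP.
Qed.

(** In place of continuation up to the boundary: den times the transform minus num, divided by (s +
    1)^N, lies in the Wiener algebra and vanishes at large real points, hence everywhere. At a zero
    of the denominator this identity would make the numerator vanish too, against coprimality. *)
Lemma ratfun_transform (G : ratfun R) (g : impulse R) :
  impulse_response (rf_eval G) g -> ir_L1 g ->
  forall s, 0 <= complex.Re s -> rf_eval G s = (ir_dirac g)%:C + lap (ir_fun g) s.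
Proof.
move=> [mg cg [sigma Hs]] /intg_ir_fun ig.
set num := rf_num G; set den := rf_den G.
pose N := maxn (size num) (size den).
pose P s := (map_poly (real_complex R) den).[s] / (s + 1) ^+ N.
pose Q s := (map_poly (real_complex R) num).[s] / (s + 1) ^+ N.
pose K s := (ir_dirac g)%:C + lap (ir_fun g) s.
have wH : wiener (fun s => P s * K s + (-1)%:C * Q s).
  apply: wienerD.
    apply: wienerM; last exact: wiener_lap.
    by apply: wiener_poly; exact: leq_maxr.
  by apply: wienerZ; apply: wiener_poly; exact: leq_maxl.
(* Beyond [sigma] the transform identity is given; beyond the root bound the denominator is nonzero,
   so no conventional value of the quotient interferes. *)
pose x0 : R := Num.max 0 (Num.max sigma (polyrcf.cauchy_bound den)) + 1.
have x00 : 0 <= x0 by rewrite /x0 addr_ge0 // le_max lexx.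
have x0s : sigma < x0 by rewrite /x0 ltr_pwDr // !le_max lexx orbT.
have x0c : polyrcf.cauchy_bound den < x0 by rewrite /x0 ltr_pwDr // !le_max lexx !orbT.
have dE x : (map_poly (real_complex R) den).[x%:C] = (den.[x])%:C by rewrite horner_map.
have neg1 : (-1)%:C = -1 :> R[i] by rewrite rmorphN rmorph1.
have key : forall s, 0 <= complex.Re s -> P s * K s + (-1)%:C * Q s = 0.
  apply: (wiener_eq0 wH x00) => n.
  set x := x0 + n%:R; have xx0 : x0 <= x by rewrite lerDl.
  have [_ Gx] := Hs x%:C (lt_le_trans x0s xx0).
  have dx : (map_poly (real_complex R) den).[x%:C] != 0.
    rewrite dE; apply/eqP => /eqP; rewrite eq_complex /= eqxx andbT => /eqP d0.
    have := polyrcf.cauchy_boundP (rf_den_neq0 G) d0.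
    rewrite ger0_norm ?(le_trans x00) // => h.
    by have := lt_le_trans (lt_trans h x0c) xx0; rewrite ltxx.
  have x1 : (x%:C + 1 : R[i]) != 0 by apply: s1_neq0; rewrite /= (le_trans x00).
  rewrite /K -laplace_lap // -Gx /rf_eval /P /Q neg1 mulN1r -/num -/den.
  set d := _.[x%:C] in dx *; set m := _.[x%:C]; set y := (x%:C + 1) ^+ N.
  by rewrite mulrAC mulrCA divff // mulr1 subrr.
move=> s s0; have y0 : (s + 1) ^+ N != 0 by rewrite expf_neq0 // s1_neq0.
have := key s s0; rewrite neg1 mulN1r /P /Q => /subr0_eq.
rewrite mulrAC => /(mulIf (invr_neq0 y0)) E.
have dn : (map_poly (real_complex R) den).[s] != 0.
  apply/eqP => d0; move: (rf_den_root d0); rewrite -/num -E d0 mul0r eqxx //.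
by rewrite /rf_eval -/num -/den -E mulrAC divff // mul1r.
Qed.

Lemma Re_wiener_min (H : R[i] -> R[i]) (e : R) : wiener H ->
  (forall w : R, e <= complex.Re (H (0 +i* w))) ->
  forall s, 0 <= complex.Re s -> e <= complex.Re (H s).
Proof.
move=> [a0 [a [ia ca Ha]]] He [x w] /= x0; rewrite Ha //=.
apply: halfplane_min => // w'; have := He w'; rewrite Ha //=; congr (_ <= _ + _).
by rewrite /lapc; apply: itg_eq => t; rewrite mul0r oppr0 expR0 mul1r.
Qed.

(** The product (1 - Z) G is again in the Wiener algebra, so the minimum principle applies to it as
    a single transform. *)
Lemma multiplier_half_plane (G Z : ratfun R) (g z : impulse R) (e : R) :
  impulse_response (rf_eval G) g -> ir_L1 g ->
  impulse_response (rf_eval Z) z -> ir_L1 z ->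
  (forall w : R, e <= complex.Re ((1 - rf_eval Z (0 +i* w)) * rf_eval G (0 +i* w))) ->
  forall s, 0 <= complex.Re s ->
    e <= complex.Re ((1 - ((ir_dirac z)%:C + lap (ir_fun z) s)) *
                     ((ir_dirac g)%:C + lap (ir_fun g) s)).
Proof.
move=> Gg gL Zz zL He.
have [_ cg _] := Gg; have [_ cz _] := Zz.
have wH : wiener (fun s => (1%:C + (-1)%:C * ((ir_dirac z)%:C + lap (ir_fun z) s)) *
    ((ir_dirac g)%:C + lap (ir_fun g) s)).
  apply: wienerM; last by apply: wiener_lap => //; exact: intg_ir_fun.
  apply: wienerD; first exact: wiener_cst.
  by apply: wienerZ; apply: wiener_lap => //; exact: intg_ir_fun.
have neg1 : (-1)%:C = -1 :> R[i] by rewrite rmorphN rmorph1.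
move=> s s0; have := Re_wiener_min wH _ s0; rewrite neg1 mulN1r; apply => w.
rewrite mulN1r; have := He w.
by rewrite (ratfun_transform Gg gL) // (ratfun_transform Zz zL).
Qed.

End rational_transfer_functions.

(** * Delay approximants of the fractional system *)

Section exponential_series.
Context {R : realType}.

(** Taylor polynomial at 0 with prescribed derivatives [r n]: of exp for [r = 1], of the real or
    imaginary part of exp((a + ib) u) when [r n] is that part of (a + ib)^n. Differentiation merely
    shifts [r]. *)
Definition epoly (r : nat -> R) (m : nat) : {poly R} := \poly_(n < m) (r n / n`!%:R).

Lemma epoly_deriv (r : nat -> R) m : (epoly r m.+1)^`() = epoly (fun n => r n.+1) m.
Proof.
apply/polyP => n; rewrite coef_deriv !coef_poly ltnS.
case: ifP => nm; last by rewrite mul0rn.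
have f0 : n`!%:R != 0 :> R by rewrite pnatr_eq0 -lt0n fact_gt0.
have n0 : n.+1%:R != 0 :> R by rewrite pnatr_eq0.
by rewrite factS natrM -mulr_natr; field; rewrite f0 /= addrC natr1.
Qed.

Lemma epoly_at0 (r : nat -> R) m : (epoly r m.+1).[0] = r 0%N.
Proof. by rewrite horner_coef0 coef_poly /= fact0 divr1. Qed.

Lemma epoly_comb (r r' : nat -> R) (a b : R) m u :
  (epoly (fun n => a * r n + b * r' n) m).[u] = a * (epoly r m).[u] + b * (epoly r' m).[u].
Proof.
rewrite -!hornerZ -hornerD; congr horner; apply/polyP => n.
rewrite coefD !coefZ !coef_poly; case: ifP => _; last by rewrite !mulr0 addr0.
by rewrite mulrDl !mulrA.
Qed.

Lemma is_derive_horner (p : {poly R}) (u : R) : is_derive u 1 (horner p) (p^`()).[u].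
Proof.
apply: DeriveDef; first exact: derivable_horner.
by rewrite -derive1E -derivE.
Qed.

(* Both sides vanish to order [m] at 0; the derivative of the inequality is
   the same inequality at order [m - 1] with p + iq multiplied by a + ib. *)
Lemma exp_tail (a b : R) (m : nat) (p q u : R) : a ^+ 2 + b ^+ 2 <= 1 ->
  p ^+ 2 + q ^+ 2 <= 1 -> 0 <= u ->
  p * (expR (a * u) * cos (b * u) - (epoly (fun n => complex.Re ((a +i* b) ^+ n)) m).[u]) -
  q * (expR (a * u) * sin (b * u) - (epoly (fun n => complex.Im ((a +i* b) ^+ n)) m).[u]) <=
  expR u - (epoly (fun=> 1) m).[u].
Proof.
pose c n := complex.Re ((a +i* b) ^+ n); pose s n := complex.Im ((a +i* b) ^+ n).
rewrite -/c -/s => ab pq u0; elim: m p q u pq u0 => [|m IH] p q u pq u0.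
  rewrite /epoly !poly_def !big_ord0 !horner0 !subr0.
  have h1 : p * cos (b * u) - q * sin (b * u) <= 1.
    by have := cos2Dsin2 (b * u); have := sqr_ge0 (p - cos (b * u));
      have := sqr_ge0 (q + sin (b * u)); nra.
  have a1 : a <= 1 by have := sqr_ge0 b; nra.
  have E : p * (expR (a * u) * cos (b * u)) - q * (expR (a * u) * sin (b * u)) =
     expR (a * u) * (p * cos (b * u) - q * sin (b * u)) by ring.
  rewrite E (@le_trans _ _ (expR (a * u))) //; first by rewrite ler_piMr ?expR_ge0.
  by rewrite ler_expR ler_piMl.
have cS n : c n.+1 = a * c n + (- b) * s n.
  by rewrite /c /s exprS; case: ((a +i* b) ^+ n) => x y /=; ring.
have sS n : s n.+1 = a * s n + b * c n.
  by rewrite /c /s exprS; case: ((a +i* b) ^+ n) => x y /=; ring.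
move: u0; rewrite le_eqVlt => /predU1P[<-|u0].
  rewrite !mulr0 expR0 cos0 sin0 !epoly_at0 /c /s expr0 /= ?mulr0 ?mulr1 ?subrr ?mulr0 ?subrr //.
pose D (u : R) := expR u - (epoly (fun=> 1) m.+1).[u] -
  (p * (expR (a * u) * cos (b * u) - (epoly c m.+1).[u]) -
  q * (expR (a * u) * sin (b * u) - (epoly s m.+1).[u])).
pose D' (u : R) := expR u - (epoly (fun=> 1) m).[u] -
  ((p * a - q * b) * (expR (a * u) * cos (b * u) - (epoly c m).[u]) -
   (p * b + q * a) * (expR (a * u) * sin (b * u) - (epoly s m).[u])).
have dD (x : R) : is_derive x 1 D (D' x).
  have he := is_derive_expR x.
  have hl : is_derive x (1:R) (fun t : R => a * t) (a *: 1) by exact: is_deriveZ.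
  rewrite /GRing.scale /= mulr1 in hl.
  have hea : is_derive x 1 (fun t => expR (a * t)) (expR (a * x) * a) by exact: is_derive1_comp.
  have hc := is_derive_cosM b x; have hs := is_derive_sinM b x.
  have h1 := is_deriveM hea hc; have h2 := is_deriveM hea hs.
  have p1 := is_derive_horner (epoly (fun=> 1) m.+1) x.
  have p2 := is_derive_horner (epoly c m.+1) x.
  have p3 := is_derive_horner (epoly s m.+1) x.
  have H := is_deriveB (is_deriveB he p1) (is_deriveB (is_deriveZ p (is_deriveB h1 p2))
     (is_deriveZ q (is_deriveB h2 p3))).
  apply: (@is_derive_eq _ _ _ _ _ _ _ _ H).
  rewrite !epoly_deriv /GRing.scale /= /D'.
  have -> : epoly (fun n => c n.+1) m = epoly (fun n => a * c n + (- b) * s n) m.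
    by rewrite /epoly; apply: eq_poly => n _; rewrite cS.
  have -> : epoly (fun n => s n.+1) m = epoly (fun n => a * s n + b * c n) m.
    by rewrite /epoly; apply: eq_poly => n _; rewrite sS.
  by rewrite !epoly_comb; ring.
have D'0 (x : R) : 0 <= x -> 0 <= D' x.
  move=> x0; rewrite /D' subr_ge0; apply: IH => //.
  have -> : (p * a - q * b) ^+ 2 + (p * b + q * a) ^+ 2 = (p ^+ 2 + q ^+ 2) * (a ^+ 2 + b ^+ 2) by ring.
  by rewrite mulr_ile1 // addr_ge0 ?sqr_ge0.
have cD : {within `[0, u], continuous D}.
  apply: continuous_subspaceT => x; apply/differentiable_continuous/derivable1_diffP.
  exact: (@ex_derive _ _ _ _ _ _ _ (dD x)).
have [v + Dv] := @MVT R D D' 0 u u0 (fun x _ => dD x) cD.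
rewrite in_itv /= => /andP[v0 _].
have D0 : D 0 = 0.
  by rewrite /D !mulr0 expR0 cos0 sin0 !epoly_at0 /c /s expr0 /= ?mulr0 ?mulr1 ?subrr ?mulr0 ?subrr ?subr0.
rewrite -subr_ge0; move: Dv; rewrite D0 subr0 subr0 /D => ->.
by rewrite mulr_ge0 ?D'0 ?(ltW v0) ?(ltW u0).
Qed.

Lemma epoly1_series u m : (epoly (fun=> 1) m).[u] = series (exp_coeff u) m.
Proof.
rewrite /epoly horner_poly /series /= big_mkord; apply: eq_bigr => i _.
by rewrite /exp_coeff /= mulrC mul1r.
Qed.

Lemma epoly1_cvg u : (epoly (fun=> 1) m).[u] @[m --> \oo] --> expR u.
Proof.
under eq_fun do rewrite epoly1_series.
exact: is_cvg_series_exp_coeff.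
Qed.

Lemma epoly1_le u m : 0 <= u -> (epoly (fun=> 1) m).[u] <= expR u.
Proof.
move=> u0; have := @exp_tail 0 0 m 0 0 u; rewrite expr0n addr0 => /(_ ler01 ler01 u0) /=.
by rewrite !mul0r subrr subr_ge0.
Qed.

Lemma epoly1_ge0 u m : 0 <= u -> 0 <= (epoly (fun=> 1) m).[u].
Proof.
move=> u0; rewrite /epoly horner_poly; apply: sumr_ge0 => i _.
by rewrite mulr_ge0 ?exprn_ge0 // mul1r invr_ge0.
Qed.

End exponential_series.

(** * Transforms as power series with Poisson weights *)

Section poisson_weights.
Context {R : realType}.
Variables (l : R) (l0 : 0 < l) (f : R -> R).
Hypotheses (fi : intg f) (cf : causal f).

(* sum_n x^n pweight n t = exp(- l (1 - x) t): the transform at l (1 - x) is a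
   power series in x with coefficients [pcoef n]. *)
Definition pweight (n : nat) (t : R) : R := cexp l t * ((l * t) ^+ n / n`!%:R).
Definition pcoef (n : nat) : R := itg (fun t => f t * pweight n t).
(** The mass of [|f|] weighted by the probability that a Poisson variable of mean [l * t] is at
    least [m]. It bounds the truncation error uniformly over the closed unit disc. *)
Definition ptail (m : nat) : R :=
  itg (fun t => `|f t| * (1 - cexp l t * (epoly (fun=> 1) m).[l * t])).

Let lt_ge0 t : 0 <= t -> 0 <= l * t.
Proof. by move=> t0; rewrite mulr_ge0 // ltW. Qed.

Let cexp1 t : 0 <= t -> cexp l t * expR (l * t) = 1.
Proof. by move=> t0; rewrite /cexp t0 -expRD addNr expR0. Qed.

Lemma pweight_ge0 n t : 0 <= pweight n t.
Proof.
rewrite /pweight; have [t0|t0] := leP 0 t; last by rewrite causal_cexp // mul0r.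
by rewrite mulr_ge0 ?cexp_ge0 // mulr_ge0 ?invr_ge0 // exprn_ge0 // lt_ge0.
Qed.

Lemma pweight_sum (r : nat -> R) m t :
  \sum_(n < m) r n * pweight n t = cexp l t * (epoly r m).[l * t].
Proof.
rewrite /epoly horner_poly mulr_sumr; apply: eq_bigr => n _.
by rewrite /pweight; ring.
Qed.

Lemma pweight_partial m t : 0 <= cexp l t * (epoly (fun=> 1) m).[l * t] <= 1.
Proof.
have [t0|t0] := leP 0 t; last by rewrite causal_cexp // mul0r lexx ler01.
rewrite mulr_ge0 ?cexp_ge0 ?epoly1_ge0 ?lt_ge0 //=.
rewrite -[leRHS](cexp1 t0) ler_wpM2l ?cexp_ge0 //.
exact/epoly1_le/lt_ge0.
Qed.

Lemma pweight_le1 n t : pweight n t <= 1.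
Proof.
have /andP[_] := pweight_partial n.+1 t; apply: le_trans.
rewrite -pweight_sum big_ord_recr /= mul1r lerDr; apply: sumr_ge0 => i _.
by rewrite mul1r pweight_ge0.
Qed.

Lemma measurable_pweight n : measurable_fun setT (pweight n).
Proof.
apply: measurable_funM; first exact: measurable_cexp.
by apply: measurable_funM => //; apply: measurable_funX; exact: measurable_funM.
Qed.

Lemma intg_pweight n : intg (fun t => f t * pweight n t).
Proof.
apply: (@intgM_bdd _ _ _ 1 fi); first exact: measurable_pweight.
by move=> t; rewrite ger0_norm ?pweight_ge0 // pweight_le1.
Qed.

Lemma intg_pweight_abs n : intg (fun t => `|f t| * pweight n t).
Proof.
apply: (@intgM_bdd _ _ _ 1 (intg_norm fi)); first exact: measurable_pweight.
by move=> t; rewrite ger0_norm ?pweight_ge0 // pweight_le1.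
Qed.

Lemma pcoef_sum (r : nat -> R) m : \sum_(n < m) pcoef n * r n =
  itg (fun t => f t * (cexp l t * (epoly r m).[l * t])).
Proof.
transitivity (\sum_(n < m) itg (fun t => r n * (f t * pweight n t))).
  by apply: eq_bigr => n _; rewrite (itgZ _ (intg_pweight n)) mulrC.
rewrite -itg_sum; last by move=> n; apply: intgZ; exact: intg_pweight.
by apply: itg_eq => t; rewrite -pweight_sum mulr_sumr; apply: eq_bigr => n _; ring.
Qed.

(** At each [t] the weights are Poisson probabilities, whose partial sums are at most 1. *)
Lemma pcoef_abs_sum m : \sum_(n < m) `|pcoef n| <= itg (fun t => `|f t|).
Proof.
apply: (@le_trans _ _ (\sum_(n < m) itg (fun t => `|f t| * pweight n t))).
  apply: ler_sum => n _; apply: itg_norm_le; [exact: intg_pweight|exact: intg_pweight_abs|].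
  by move=> t; rewrite normrM (ger0_norm (pweight_ge0 _ _)).
rewrite -itg_sum; last by move=> n; exact: intg_pweight_abs.
apply: itg_le; [by apply: intg_sum => n; exact: intg_pweight_abs|exact: intg_norm|].
move=> t; rewrite -mulr_sumr ler_piMr //.
have /andP[_] := pweight_partial m t; rewrite -pweight_sum.
by under eq_bigr do rewrite mul1r.
Qed.

Lemma pcoef_ge0 n : (forall t, 0 <= f t) -> 0 <= pcoef n.
Proof. by move=> f0; apply: itg_ge0 => t; rewrite mulr_ge0 ?pweight_ge0. Qed.

Let measurable_partial m : measurable_fun setT (fun t => cexp l t * (epoly (fun=> 1) m).[l * t]).
Proof.
have -> : (fun t => cexp l t * (epoly (fun=> 1) m).[l * t]) =
    (fun t => \sum_(n < m) 1 * pweight n t) by apply/funext => t; rewrite (pweight_sum (fun=> 1)).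
by apply: measurable_sum => n; apply: measurable_funM => //; exact: measurable_pweight.
Qed.

Lemma intg_ptail m : intg (fun t => `|f t| * (1 - cexp l t * (epoly (fun=> 1) m).[l * t])).
Proof.
apply: (@intgM_bdd _ _ _ 1 (intg_norm fi)).
  by apply: measurable_funB => //; exact: measurable_partial.
move=> t; have /andP[h0 h1] := pweight_partial m t.
by rewrite ger0_norm ?subr_ge0 // lerBlDr lerDl.
Qed.

Lemma ptail_cvg0 : ptail m @[m --> \oo] --> 0.
Proof.
have [||||_] := @itg_dct R (fun m t => `|f t| * (1 - cexp l t * (epoly (fun=> 1) m).[l * t]))
  (fun=> 0) (fun t => `|f t|) _ _ _ (intg_norm fi).
- by move=> m; exact: intg_meas (intg_ptail m).
- exact: measurable_cst.
- move=> t; have [t0|t0] := ltP t 0.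
    rewrite (_ : (fun m => _) = fun=> 0); first exact: cvg_cst.
    by apply/funext => m; rewrite cf // normr0 mul0r.
  rewrite -[X in _ --> X](mulr0 `|f t|); apply: cvgM; first exact: cvg_cst.
  rewrite -[X in _ --> X](subrr 1); apply: cvgB; first exact: cvg_cst.
  rewrite -[X in _ --> X](cexp1 t0); apply: cvgM; first exact: cvg_cst.
  exact: epoly1_cvg.
- move=> m t; have /andP[h0 h1] := pweight_partial m t.
  rewrite normrM normr_id ler_piMr // ger0_norm ?subr_ge0 //.
  by rewrite lerBlDr lerDl.
by rewrite itg0.
Qed.

Let ptail_bound (K : R -> R) (r : nat -> R) m :
  intg (fun t => f t * K t) ->
  (forall t, 0 <= t -> `|K t - cexp l t * (epoly r m).[l * t]| <=
     1 - cexp l t * (epoly (fun=> 1) m).[l * t]) ->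
  `|itg (fun t => f t * K t) - \sum_(n < m) pcoef n * r n| <= ptail m.
Proof.
move=> iK h; rewrite pcoef_sum.
have ir : intg (fun t => f t * (cexp l t * (epoly r m).[l * t])).
  apply: intg_eq (intg_sum (index_enum 'I_m) (fun n : 'I_m => intgZ (r n) (intg_pweight n))) => t.
  by rewrite -pweight_sum mulr_sumr; apply: eq_bigr => n _; ring.
rewrite -itgB //; apply: itg_norm_le; [exact: intgB|exact: intg_ptail|].
move=> t; have [t0|t0] := ltP t 0; first by rewrite cf // !mul0r subrr normr0 mul0r.
by rewrite -mulrBr normrM ler_wpM2l // h.
Qed.

(** For x = a + ib in the closed disc, [exp_tail] dominates the Taylor remainder of exp(l t x) by
    that of exp(l t); its parameters (1, 0), (-1, 0), (0, -1), (0, 1) select the real and imaginary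
    parts with either sign. *)
Lemma pcoef_approx (a b : R) (m : nat) : a ^+ 2 + b ^+ 2 <= 1 ->
  `|lapc f (l * (1 - a)) (l * b) - \sum_(n < m) pcoef n * complex.Re ((a +i* b) ^+ n)| <= ptail m /\
  `|laps f (l * (1 - a)) (l * b) - \sum_(n < m) pcoef n * complex.Im ((a +i* b) ^+ n)| <= ptail m.
Proof.
move=> ab; have a1 : a <= 1 by have := sqr_ge0 b; nra.
have la : 0 <= l * (1 - a) by rewrite mulr_ge0 ?(ltW l0) // subr_ge0.
have E t : 0 <= t -> expR (- (l * (1 - a) * t)) = cexp l t * expR (a * (l * t)).
  by move=> t0; rewrite /cexp t0 -expRD; congr expR; ring.
split.
- apply: (@ptail_bound (fun t => expR (- (l * (1 - a) * t)) * cos (l * b * t))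
    (fun n => complex.Re ((a +i* b) ^+ n)) m); first exact: intg_kerc.
  move=> t t0; rewrite E // -mulrA -mulrBr normrM (ger0_norm (cexp_ge0 _ _)).
  have -> : 1 - cexp l t * (epoly (fun=> 1) m).[l * t] =
      cexp l t * (expR (l * t) - (epoly (fun=> 1) m).[l * t]) by rewrite mulrBr cexp1.
  rewrite ler_wpM2l ?cexp_ge0 //.
  have -> : l * b * t = b * (l * t) by ring.
  have h1 := @exp_tail R a b m 1 0 (l * t) ab; have h2 := @exp_tail R a b m (-1) 0 (l * t) ab.
  move: h1 h2; rewrite sqrrN expr1n expr0n addr0 => /(_ (lexx 1) (lt_ge0 t0)) h1 /(_ (lexx 1) (lt_ge0 t0)) h2.
  move: h1 h2; rewrite /= !mul0r !subr0 mul1r mulN1r => h1 h2.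
  by rewrite ler_norml h1 andbT lerNl.
- apply: (@ptail_bound (fun t => expR (- (l * (1 - a) * t)) * sin (l * b * t))
    (fun n => complex.Im ((a +i* b) ^+ n)) m); first exact: intg_kers.
  move=> t t0; rewrite E // -mulrA -mulrBr normrM (ger0_norm (cexp_ge0 _ _)).
  have -> : 1 - cexp l t * (epoly (fun=> 1) m).[l * t] =
      cexp l t * (expR (l * t) - (epoly (fun=> 1) m).[l * t]) by rewrite mulrBr cexp1.
  rewrite ler_wpM2l ?cexp_ge0 //.
  have -> : l * b * t = b * (l * t) by ring.
  have h1 := @exp_tail R a b m 0 (-1) (l * t) ab; have h2 := @exp_tail R a b m 0 1 (l * t) ab.
  move: h1 h2; rewrite sqrrN expr1n expr0n add0r => /(_ (lexx 1) (lt_ge0 t0)) h1 /(_ (lexx 1) (lt_ge0 t0)) h2.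
  move: h1 h2; rewrite /= !mul0r !sub0r mul1r mulN1r opprK => h1 h2.
  by rewrite ler_norml h1 andbT lerNl.
Qed.

End poisson_weights.

(** * The l^1 norm and nonnegativity of coefficients *)

Section coefficient_norm.
Context {R : realType}.
Implicit Types p q : {poly R}.

Definition pl1 p : R := \sum_(i < size p) `|p`_i|.

Lemma pl1_widen p n : (size p <= n)%N -> pl1 p = \sum_(i < n) `|p`_i|.
Proof.
move=> pn; rewrite /pl1 (big_ord_widen n (fun i => `|p`_i|) pn) big_mkcond /=.
apply: eq_bigr => i _; case: ltnP => // h.
by rewrite nth_default // normr0.
Qed.

Lemma pl1_ge0 p : 0 <= pl1 p.
Proof. exact: sumr_ge0. Qed.

Lemma pl1D p q : pl1 (p + q) <= pl1 p + pl1 q.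
Proof.
pose n := maxn (size p) (size q).
rewrite (@pl1_widen (p + q) n) ?size_polyD // (@pl1_widen p n) ?leq_maxl //.
rewrite (@pl1_widen q n) ?leq_maxr // -big_split /=; apply: ler_sum => i _.
by rewrite coefD ler_normD.
Qed.

Lemma pl1_0 : pl1 0 = 0.
Proof. by rewrite /pl1 size_poly0 big_ord0. Qed.

Lemma pl1_sum n (F : nat -> {poly R}) : pl1 (\sum_(i < n) F i) <= \sum_(i < n) pl1 (F i).
Proof.
elim: n => [|n IH]; first by rewrite !big_ord0 pl1_0.
by rewrite !big_ord_recr /=; apply: le_trans (pl1D _ _) _; rewrite lerD2r.
Qed.

Lemma pl1Z a p : pl1 (a *: p) <= `|a| * pl1 p.
Proof.
rewrite (@pl1_widen (a *: p) (size p)) ?size_scale_leq // /pl1 mulr_sumr.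
by apply: ler_sum => i _; rewrite coefZ normrM.
Qed.

Lemma pl1C a : pl1 a%:P = `|a|.
Proof.
rewrite (@pl1_widen _ 1) ?size_polyC_leq1 // big_ord_recr big_ord0 /= add0r.
by rewrite coefC.
Qed.

Lemma pl1_XnM n p : pl1 ('X^n * p) <= pl1 p.
Proof.
rewrite (@pl1_widen ('X^n * p) (n + size p)); last first.
  by apply: leq_trans (size_polyMleq _ _) _; rewrite size_polyXn.
rewrite big_split_ord /= big1 ?add0r => [|i _]; last by rewrite coefXnM ltn_ord normr0.
by apply: ler_sum => i _; rewrite coefXnM ltnNge leq_addr /= addKn.
Qed.

Lemma pl1M p q : pl1 (p * q) <= pl1 p * pl1 q.
Proof.
rewrite -{1}[p]coefK poly_def mulr_suml; apply: le_trans (pl1_sum _ (fun i => p`_i *: 'X^i * q)) _.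
rewrite /pl1 -/(pl1 q) mulr_suml; apply: ler_sum => i _.
rewrite -scalerAl; apply: le_trans (pl1Z _ _) _.
by rewrite ler_wpM2l // pl1_XnM.
Qed.

Lemma pl1X p n : pl1 p <= 1 -> pl1 (p ^+ n) <= 1.
Proof.
move=> p1; elim: n => [|n IH]; first by rewrite expr0 -polyC1 pl1C normr1.
by rewrite exprS; apply: le_trans (pl1M _ _) _; rewrite mulr_ile1 ?pl1_ge0.
Qed.

(** All powers of [q] stay in the unit ball. Bounds on the series in x thus survive the substitution
    of the truncated binomial series. *)
Lemma pl1_comp p q : pl1 q <= 1 -> pl1 (p \Po q) <= pl1 p.
Proof.
move=> q1; rewrite comp_polyE; apply: le_trans (pl1_sum _ (fun i => p`_i *: q ^+ i)) _.
apply: ler_sum => i _; apply: le_trans (pl1Z _ _) _.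
by rewrite ler_piMr // pl1X.
Qed.

Definition pnneg p := forall i, 0 <= p`_i.

Lemma pnnegM p q : pnneg p -> pnneg q -> pnneg (p * q).
Proof.
move=> p0 q0 i; rewrite coefM; apply: sumr_ge0 => j _; exact: mulr_ge0.
Qed.

Lemma pnnegX p n : pnneg p -> pnneg (p ^+ n).
Proof.
move=> p0; elim: n => [|n IH]; last by rewrite exprS; exact: pnnegM.
by move=> i; rewrite expr0 coef1 ler0n.
Qed.

Lemma pnneg_comp p q : pnneg p -> pnneg q -> pnneg (p \Po q).
Proof.
move=> p0 q0 i; rewrite comp_polyE coef_sum; apply: sumr_ge0 => j _.
by rewrite coefZ mulr_ge0 //; exact: pnnegX.
Qed.

Lemma horner_norm_le (p : {poly R}) (x : R[i]) : `|x| <= 1 ->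
  `|(map_poly (real_complex R) p).[x]| <= (pl1 p)%:C.
Proof.
move=> x1; rewrite (@horner_coef_wide _ (size p)); last by rewrite size_map_poly.
apply: le_trans (ler_norm_sum _ _ _) _.
rewrite /pl1 (rmorph_sum (real_complex R)) /=; apply: ler_sum => i _.
rewrite coef_map normrM normrX /= normc_def /= expr0n addr0 sqrtr_sqr.
by rewrite ler_piMr ?exprn_ile1 // lecR.
Qed.

End coefficient_norm.

(** * Gruenwald-Letnikov weights of the fractional power *)

Section grunwald.
Context {R : realType}.
Variables (al : R) (al01 : 0 < al < 1).

(** The coefficient of X^k in (1 - X)^(al - 1). By [gl_weight_sum] it is also the mass left over
    after the first [k] weights. *)
Fixpoint gl_rest (k : nat) : R :=
  if k is k'.+1 then gl_rest k' * (1 - al / k'.+1%:R) else 1.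

(** The coefficient of X^(k + 1) in 1 - (1 - X)^al. *)
Definition gl_weight (k : nat) : R := al / k.+1%:R * gl_rest k.

(* Truncation of the binomial series of 1 - (1 - X)^al. *)
Definition gl_poly (K : nat) : {poly R} := \sum_(k < K) gl_weight k *: 'X^(k.+1).

Lemma gl_rest_bounds k : 0 <= gl_rest k <= 1.
Proof.
elim: k => [|k /andP[h0 h1]] /=; first by rewrite ler01 lexx.
have /andP[a0 a1] := al01.
have h : 0 <= 1 - al / k.+1%:R <= 1.
  rewrite subr_ge0 ler_pdivrMr ?ltr0n // mul1r gerDl oppr_le0.
  rewrite divr_ge0 ?(ltW a0) // andbT (le_trans (ltW a1)) // ler1n //.
have /andP[h2 h3] := h.
by rewrite mulr_ge0 //= mulr_ile1.
Qed.

Lemma gl_weight_ge0 k : 0 <= gl_weight k.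
Proof.
have /andP[a0 a1] := al01; have /andP[h _] := gl_rest_bounds k.
by rewrite mulr_ge0 ?divr_ge0 ?(ltW a0).
Qed.

Lemma gl_weight_sum K : \sum_(k < K) gl_weight k = 1 - gl_rest K.
Proof.
elim: K => [|K IH]; first by rewrite big_ord0 subrr.
by rewrite big_ord_recr /= IH /gl_weight; ring.
Qed.

Lemma gl_poly_coef K i : (gl_poly K)`_i =
  if i is j.+1 then (if (j < K)%N then gl_weight j else 0) else 0.
Proof.
rewrite /gl_poly coef_sum.
under eq_bigr do rewrite coefZ coefXn.
case: i => [|j]; first by rewrite big1 // => k _; rewrite mulr0.
case: ltnP => jK.
  rewrite (bigD1 (Ordinal jK)) //= eqxx mulr1 big1 ?addr0 // => k kj.
  rewrite eqSS (_ : (j == k) = false) ?mulr0 //.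
  by apply: contraNF kj => /eqP E; apply/eqP/val_inj.
rewrite big1 // => k _; rewrite eqSS (_ : (j == k) = false) ?mulr0 //.
by apply/negbTE; rewrite neq_ltn (leq_trans (ltn_ord k) jK) orbT.
Qed.

Lemma gl_poly_nneg K : pnneg (gl_poly K).
Proof. by move=> [|i]; rewrite gl_poly_coef //; case: ifP => // _; exact: gl_weight_ge0. Qed.

Lemma gl_poly_pl1 K : pl1 (gl_poly K) <= 1.
Proof.
rewrite (@pl1_widen R _ K.+1); last first.
  by apply/leq_sizeP => -[//|j] h; rewrite gl_poly_coef ltnNge -ltnS h.
rewrite big_ord_recl gl_poly_coef normr0 add0r.
rewrite (eq_bigr (fun k : 'I_K => gl_weight k)); last first.
  by move=> k _; rewrite lift0 gl_poly_coef ltn_ord ger0_norm // gl_weight_ge0.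
by rewrite gl_weight_sum gerDl oppr_le0; have /andP[] := gl_rest_bounds K.
Qed.

(** (1 - X)^al solves (1 - X) y' + al y = 0. For the truncation y = 1 - [gl_poly K] the
    contributions telescope and a single term of degree [K] is left. *)
Lemma gl_poly_ode K (q : R) :
  - (1 - q) * ((gl_poly K)^`()).[q] + al * (1 - (gl_poly K).[q]) = al * gl_rest K * q ^+ K.
Proof.
elim: K => [|K IH]; first by rewrite /gl_poly big_ord0 deriv0 !horner0 /= expr0; ring.
rewrite /gl_poly big_ord_recr /= -/(gl_poly K) derivD derivZ derivXn !hornerE /=.
rewrite hornerMn hornerXn -mulr_natl.
have K0 : K.+1%:R != 0 :> R by rewrite pnatr_eq0.
have E : gl_weight K * (K.+1%:R * q ^+ K) = al * gl_rest K * q ^+ K.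
  by rewrite /gl_weight; field; rewrite addrC natr1.
transitivity (- (1 - q) * ((gl_poly K)^`()).[q] + al * (1 - (gl_poly K).[q])
  - (1 - q) * (gl_weight K * (K.+1%:R * q ^+ K)) - al * gl_weight K * q ^+ K.+1).
  by rewrite -mulr_natl; ring.
rewrite IH E /gl_weight exprS; field; by rewrite addrC natr1.
Qed.

(* For q = 1 - exp(-x), the derivative of exp(al x) (1 - N_K(q)) is al r_K q^K exp(al x). *)
Lemma gl_poly_bound (K : nat) (x : R) : 0 <= x ->
  let q := 1 - expR (- x) in
  expR (- (al * x)) <= 1 - (gl_poly K).[q] <= expR (- (al * x)) + x * q ^+ K.
Proof.
rewrite le_eqVlt => /predU1P[<-|x0] /=.
  rewrite mulr0 oppr0 expR0 subrr mul0r addr0.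
  suff -> : (gl_poly K).[0] = 0 by rewrite subr0 lexx.
  by rewrite horner_coef0 gl_poly_coef.
pose D (x : R) := expR (al * x) * (1 - (gl_poly K).[1 - expR (- x)]).
pose D' (x : R) := expR (al * x) * (al * gl_rest K * (1 - expR (- x)) ^+ K).
have dD (y : R) : is_derive y 1 D (D' y).
  have hl : is_derive y (1:R) (fun t : R => al * t) (al *: 1) by exact: is_deriveZ.
  rewrite /GRing.scale /= mulr1 in hl.
  have hea : is_derive y 1 (fun t : R => expR (al * t)) (expR (al * y) * al) by exact: is_derive1_comp.
  have hn : is_derive y (1:R) (fun t : R => - t) (- 1) by exact: is_deriveN.
  have hen : is_derive y 1 (fun t : R => expR (- t)) (expR (- y) * - 1) by exact: is_derive1_comp.
  have hq := is_deriveB (is_derive_cst (1 : R) y (1 : R)) hen.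
  have hp : is_derive y 1 (fun t : R => (gl_poly K).[1 - expR (- t)])
      (((gl_poly K)^`()).[1 - expR (- y)] * (0 - expR (- y) * - 1)).
    by apply: (@is_derive1_comp R (horner (gl_poly K)) (fun t : R => 1 - expR (- t))); exact: is_derive_horner.
  have H := is_deriveM hea (is_deriveB (is_derive_cst (1 : R) y (1 : R)) hp).
  apply: (@is_derive_eq _ _ _ _ _ _ _ _ H).
  rewrite /D' -gl_poly_ode.
  change (expR (al * y) * (0 - ((gl_poly K)^`()).[1 - expR (- y)] * (0 - expR (- y) * - 1)) +
    (1 - (gl_poly K).[1 - expR (- y)]) * (expR (al * y) * al) =
    expR (al * y) * (- (1 - (1 - expR (- y))) * ((gl_poly K)^`()).[1 - expR (- y)] +
    al * (1 - (gl_poly K).[1 - expR (- y)]))).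
  by ring.
have cD : {within `[0, x], continuous D}.
  apply: continuous_subspaceT => y; apply/differentiable_continuous/derivable1_diffP.
  exact: (@ex_derive _ _ _ _ _ _ _ (dD y)).
(* The mean value theorem gives [D x = 1 + D' v * x]: the lower bound is the sign of [D' v], the
   upper one the estimate [h2]. *)
have [v + Dv] := @MVT R D D' 0 x x0 (fun y _ => dD y) cD.
rewrite in_itv /= => /andP[v0 vx].
have /andP[a0 a1] := al01; have /andP[r0 r1] := gl_rest_bounds K.
have D0 : D 0 = 1.
  rewrite /D !mulr0 oppr0 expR0 subrr mul1r horner_coef0 gl_poly_coef subr0 //.
have q0 (y : R) : 0 <= y -> 0 <= 1 - expR (- y).
  by move=> y0; rewrite subr_ge0 -[leRHS](@expR0 R) ler_expR oppr_le0.
have E : 1 - (gl_poly K).[1 - expR (- x)] = expR (- (al * x)) * D x.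
  by rewrite /D mulrA -expRD addNr expR0 mul1r.
have Dx : D x = 1 + D' v * x by rewrite -[x in RHS]subr0 -Dv D0; ring.
rewrite E Dx mulrDr mulr1 lerDl lerD2l.
have h1 : 0 <= D' v.
  by rewrite mulr_ge0 ?expR_ge0 // mulr_ge0 ?exprn_ge0 ?q0 ?(ltW v0) // mulr_ge0 ?(ltW a0).
have h2 : expR (- (al * x)) * D' v <= (1 - expR (- x)) ^+ K.
  rewrite /D' mulrA -expRD -[leRHS]mul1r; apply: ler_pM.
  - exact: expR_ge0.
  - by rewrite mulr_ge0 ?exprn_ge0 ?q0 ?(ltW v0) // mulr_ge0 ?(ltW a0).
  - by rewrite -[leRHS](@expR0 R) ler_expR addrC -mulrBr mulr_ge0_le0 ?(ltW a0) // subr_le0 ltW.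
  rewrite -[leRHS]mul1r; apply: ler_pM.
  - by rewrite mulr_ge0 ?(ltW a0).
  - by rewrite exprn_ge0 // q0 // ltW.
  - by rewrite mulr_ile1 ?(ltW a0) // ltW.
  rewrite lerXn2r ?nnegrE ?q0 ?(ltW v0) ?(ltW x0) //.
  by rewrite lerD2l lerN2 ler_expR lerN2 ltW.
apply/andP; split; first by rewrite mulr_ge0 ?expR_ge0 // mulr_ge0 // ltW.
by rewrite mulrA [leLHS]mulrC ler_wpM2l // ltW.
Qed.

End grunwald.

(** * Parseval's identity over roots of unity *)

Section discrete_parseval.
Context {C : numClosedFieldType}.

(** X^n - 1 is separable in characteristic 0, and n distinct roots of it must include one of order
    n. *)
Lemma primitive_root_exists (n : nat) : (0 < n)%N -> exists z : C, n.-primitive_root z.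
Proof.
move=> n_gt0; have [r Dp] := closed_field_poly_normal ('X^n - 1 : {poly C}).
rewrite (monicP _) ?monicXnsubC // scale1r in Dp.
have rn1 : all n.-unity_root r by apply/allP => z; rewrite -root_prod_XsubC -Dp.
have sz_r : (n < (size r).+1)%N by rewrite -(size_prod_XsubC r id) -Dp size_XnsubC.
have [|z zr zn] := hasP (cyclic.has_prim_root n_gt0 rn1 _ sz_r); last by exists z.
by rewrite -separable.separable_prod_XsubC -Dp cyclotomic.separable_Xn_sub_1 // pnatr_eq0 -lt0n.
Qed.

Lemma primitive_root_norm (n : nat) (z : C) : n.-primitive_root z -> `|z| = 1.
Proof.
move=> zn; have n0 := prim_order_gt0 zn; have := prim_expr_order zn.
move=> /(congr1 (fun x : C => `|x|)); rewrite normrX normr1 => /eqP.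
by rewrite pexpr_eq1 // => /eqP.
Qed.

Lemma primitive_root_sum (M n m : nat) (w : C) : M.-primitive_root w -> (n < M)%N -> (m < M)%N ->
  \sum_(l < M) (w ^+ l) ^+ n * ((w ^+ l) ^+ m)^*%R = if n == m then M%:R else 0.
Proof.
move=> wM nM mM; have w1 := primitive_root_norm wM.
have w0 : w != 0 by rewrite -normr_eq0 w1 oner_eq0.
have wc : w^*%R = w^-1 by apply: (mulfI w0); rewrite -normCK w1 expr1n divff.
pose y := w ^+ n * w^-1 ^+ m.
have -> : \sum_(l < M) (w ^+ l) ^+ n * ((w ^+ l) ^+ m)^*%R = \sum_(l < M) y ^+ l.
  apply: eq_bigr => l _; rewrite !rmorphXn /= wc /y exprMn -!exprM.
  by rewrite [(l * n)%N]mulnC [(l * m)%N]mulnC.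
case: eqP => [nm|/eqP nm].
  rewrite (eq_bigr (fun=> 1)) ?sumr_const ?card_ord // => l _.
  by rewrite /y nm -exprMn divff // !expr1n.
have y1 : y - 1 != 0.
  rewrite subr_eq0; apply: contra nm => /eqP E.
  have : w ^+ n == w ^+ m.
    by apply/eqP; rewrite -[RHS]mul1r -E /y -mulrA -exprMn mulVf // expr1n mulr1.
  by rewrite (eq_prim_root_expr wM) !modn_small.
have : y ^+ M - 1 = 0.
  by rewrite /y exprMn -!exprM ![(_ * M)%N]mulnC !exprM exprVn (prim_expr_order wM) invr1 !expr1n mulr1 subrr.
by rewrite subrX1 => /eqP; rewrite mulf_eq0 (negPf y1) => /eqP.
Qed.

(** Exponents below [M] give pairwise distinct characters of the M-th roots of unity, so this finite
    sum computes the coefficient pairing exactly. *)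
Lemma parseval (A B : {poly C}) (M : nat) (w : C) : M.-primitive_root w ->
  (size A <= M)%N -> (size B <= M)%N ->
  \sum_(l < M) B.[w ^+ l] * (A.[w ^+ l])^*%R = M%:R * \sum_(n < M) B`_n * (A`_n)^*%R.
Proof.
move=> wM sA sB.
transitivity (\sum_(l < M) \sum_(n < M) \sum_(m < M)
   B`_n * (A`_m)^*%R * ((w ^+ l) ^+ n * ((w ^+ l) ^+ m)^*%R)).
  apply: eq_bigr => l _; rewrite (horner_coef_wide _ sA) (horner_coef_wide _ sB).
  rewrite rmorph_sum mulr_suml; apply: eq_bigr => n _.
  by rewrite mulr_sumr; apply: eq_bigr => m _; rewrite rmorphM mulrACA.
rewrite exchange_big mulr_sumr; apply: eq_bigr => n _.
rewrite exchange_big (bigD1 n) //= [X in _ + X]big1 ?addr0.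
  by rewrite -mulr_sumr (primitive_root_sum wM) // eqxx mulrC.
move=> m mn; rewrite -mulr_sumr (primitive_root_sum wM) //.
by rewrite (_ : (n == m :> nat) = false) ?mulr0 //; apply/negbTE; rewrite eq_sym.
Qed.

End discrete_parseval.

(** * Toeplitz forms and autocorrelations *)

Section toeplitz.
Context {R : realType}.

(** With [M] above the sizes of [a] and [p * a], Parseval turns both sides into sums over the M-th
    roots of unity, where Re (p |a|^2) >= e |a|^2 holds term by term. *)
Lemma toeplitz_ge (p a : {poly R}) (e : R) (N : nat) :
  (forall x : R[i], `|x| = 1 -> e <= complex.Re (map_poly (real_complex R) p).[x]) ->
  (size a <= N)%N ->
  e * \sum_(i < N) a`_i ^+ 2 <= \sum_(i < N) (p * a)`_i * a`_i.
Proof.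
move=> pe aN; pose M := (N + size (p * a)%R).+1.
have [w wM] := @primitive_root_exists R[i] M isT.
have sa : (size a <= M)%N by rewrite (leq_trans aN) // /M -addnS leq_addr.
have spa : (size (p * a)%R <= M)%N by rewrite /M -addSn leq_addl.
have w1 (l : nat) : `|w ^+ l| = 1 by rewrite normrX (primitive_root_norm wM) expr1n.
have conjE (z : R[i]) : (z^*)%R = conjc z by [].
pose mp (q : {poly R}) := map_poly (real_complex R) q.
have P (q : {poly R}) : (size q <= M)%N ->
    \sum_(l < M) (mp q).[w ^+ l] * ((mp a).[w ^+ l])^*%R = (M%:R * \sum_(n < N) q`_n * a`_n)%:C.
  move=> qM; rewrite (parseval wM) ?size_map_poly // rmorphM rmorph_nat; congr (_ * _).
  rewrite rmorph_sum (big_ord_widen M (fun n => real_complex R (q`_n * a`_n))) /=; last first.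
    by rewrite /M -addnS leq_addr.
  rewrite [RHS]big_mkcond /=; apply: eq_bigr => n _; rewrite !coef_map /=.
  case: ltnP => nN; first by rewrite conjE conjc_real -rmorphM.
  by rewrite (nth_default _ (leq_trans aN nN)) !rmorph0 mulr0.
have M0 : 0 < M%:R :> R by rewrite ltr0n.
have H1 : M%:R * \sum_(n < N) a`_n * a`_n = \sum_(l < M) complex.Re ((mp a).[w ^+ l] * ((mp a).[w ^+ l])^*%R).
  by rewrite -(raddf_sum (@complex.Re R : Rcomplex R -> R)) P.
have H2 : M%:R * \sum_(n < N) (p * a)`_n * a`_n =
    \sum_(l < M) complex.Re ((mp (p * a)).[w ^+ l] * ((mp a).[w ^+ l])^*%R).
  by rewrite -(raddf_sum (@complex.Re R : Rcomplex R -> R)) P.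
rewrite -(ler_pM2l M0) H2 mulrCA.
under eq_bigr do rewrite expr2.
rewrite H1 mulr_sumr; apply: ler_sum => l _.
rewrite /mp rmorphM hornerM -mulrA -/(mp _) -/(mp _) !conjE.
have := pe _ (w1 l); rewrite -/(mp p).
case: ((mp p).[w ^+ l]) => x y; case: ((mp a).[w ^+ l]) => u v /= ex.
have := sqr_ge0 u; have := sqr_ge0 v; nra.
Qed.

(* The Toeplitz form applied to the samples w(t - i delta), i < N, and integrated
   over t; the boundary terms are bounded independently of N. *)
Lemma autocorrelation_ge (p : {poly R}) (e d : R) (w : R -> R) :
  (forall x : R[i], `|x| = 1 -> e <= complex.Re (map_poly (real_complex R) p).[x]) ->
  sqi w ->
  e * itg (fun t => w t ^+ 2) <= \sum_(n < size p) p`_n * itg (fun t => w t * w (t - n%:R * d)).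
Proof.
move=> pe w2; pose c (n : nat) := itg (fun t => w t * w (t - n%:R * d)).
have shi (i : nat) : sqi (fun t => w (t - i%:R * d)) by exact: sqi_shift.
have im (i j : nat) : intg (fun t => w (t - i%:R * d) * w (t - j%:R * d)) by exact: sqiM.
have cE (i j : nat) : (j <= i)%N -> itg (fun t => w (t - (i - j)%N%:R * d) * w (t - i%:R * d)) = c j.
  move=> ji; rewrite /c.
  have ic : intg (fun t => w t * w (t - j%:R * d)).
    by apply: intg_eq (im 0%N j) => t; rewrite mul0r subr0.
  rewrite -[RHS](itg_shift ((i - j)%N%:R * d) ic).
  apply: itg_eq => t; congr (_ * w _); rewrite natrB //; ring.
(* Sample [i] can be paired only with the delays [j <= i]; from [i = size p] on the sum is complete
   and no longer depends on [i]. *)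
pose S (i : nat) := \sum_(j < i.+1) p`_j * c j.
have SN (N : nat) : e * (N%:R * itg (fun t => w t ^+ 2)) <= \sum_(i < N) S i.
  have i2 (i : nat) : intg (fun t => w (t - i%:R * d) ^+ 2) by exact: (im i i).
  have iS (i : nat) : intg (fun t => \sum_(j < i.+1) p`_j * (w (t - (i - j)%N%:R * d) * w (t - i%:R * d))).
    by apply: intg_sum => j; apply: intgZ; exact: im.
  have -> : \sum_(i < N) S i =
      itg (fun t => \sum_(i < N) \sum_(j < i.+1) p`_j * (w (t - (i - j)%N%:R * d) * w (t - i%:R * d))).
    rewrite (itg_sum _ (fun i : 'I_N => iS i)); apply: eq_bigr => i _.
    rewrite (itg_sum _ (fun j : 'I_i.+1 => intgZ (p`_j) (im (i - j)%N i))); apply: eq_bigr => j _.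
    by rewrite (itgZ _ (im _ _)) cE // -ltnS.
  have -> : e * (N%:R * itg (fun t => w t ^+ 2)) = itg (fun t => e * \sum_(i < N) w (t - i%:R * d) ^+ 2).
    rewrite (itgZ _ (intg_sum _ (fun i : 'I_N => i2 i))) (itg_sum _ (fun i : 'I_N => i2 i)); congr (_ * _).
    rewrite (eq_bigr (fun=> itg (fun t => w t ^+ 2))) ?sumr_const ?card_ord ?mulr_natl // => i _.
    rewrite (@itg_shift R (i%:R * d) (fun t => w t ^+ 2)) //.
    by apply: intg_eq (im 0%N 0%N) => t; rewrite mul0r subr0.
  apply: itg_le; [by apply: intgZ; apply: intg_sum => i; exact: i2|by apply: intg_sum => i; exact: iS|].
  move=> t; pose a : {poly R} := \poly_(i < N) w (t - i%:R * d).
  have := @toeplitz_ge p a e N pe (size_poly _ _).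
  congr (_ <= _).
    by congr (_ * _); apply: eq_bigr => i _; rewrite coef_poly ltn_ord.
  apply: eq_bigr => i _; rewrite coefM mulr_suml; apply: eq_bigr => j _.
  rewrite !coef_poly ltn_ord (_ : (i - j < N)%N = true) ?mulrA //.
  by rewrite (leq_ltn_trans (leq_subr _ _)).
pose s := \sum_(n < size p) p`_n * c n; rewrite -/s.
have Ss (i : nat) : (size p <= i)%N -> S i = s.
  move=> pi; rewrite /S /s [RHS](big_ord_widen i.+1 (fun n => p`_n * c n)) ?(leq_trans pi) //.
  rewrite [RHS]big_mkcond /=; apply: eq_bigr => j _; case: ltnP => // h.
  by rewrite nth_default // mul0r.
pose D := \sum_(i < size p) S i.
have SD (N : nat) : \sum_(i < size p + N) S i = D + N%:R * s.
  rewrite big_split_ord /=; congr (_ + _).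
  rewrite (eq_bigr (fun=> s)) ?sumr_const ?card_ord ?mulr_natl // => i _.
  by rewrite Ss // leq_addr.
(* Were [s] below the claimed bound, [N] copies of the deficit would outgrow the boundary term,
   which is fixed. *)
rewrite leNgt; apply/negP => lt.
pose q := e * itg (fun t => w t ^+ 2).
have lt' : 0 < q - s by rewrite subr_gt0.
have [N NB] : exists N : nat, (D - (size p)%:R * q) / (q - s) < N%:R.
  by exists (Num.truncn ((D - (size p)%:R * q) / (q - s))).+1; exact: truncnS_gt.
have := SN (size p + N)%N; rewrite SD natrD.
move: NB; rewrite ltr_pdivrMr // /q; nra.
Qed.

End toeplitz.

(** * Polynomial approximation of transforms on the disc *)

Section poisson_polynomial.
Context {R : realType}.
Implicit Types (f : R -> R) (p : {poly R}).

Lemma horner_ReIm p (x : R[i]) n : (size p <= n)%N ->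
  complex.Re (map_poly (real_complex R) p).[x] = \sum_(i < n) p`_i * complex.Re (x ^+ i) /\
  complex.Im (map_poly (real_complex R) p).[x] = \sum_(i < n) p`_i * complex.Im (x ^+ i).
Proof.
move=> pn; rewrite (@horner_coef_wide _ n); last by rewrite size_map_poly.
split.
  rewrite (raddf_sum (@complex.Re R : Rcomplex R -> R)); apply: eq_bigr => i _.
  by rewrite coef_map; case: (x ^+ i) => u v /=; rewrite mul0r subr0.
rewrite (raddf_sum (@complex.Im R : Rcomplex R -> R)); apply: eq_bigr => i _.
by rewrite coef_map; case: (x ^+ i) => u v /=; rewrite mul0r addr0.
Qed.

Lemma Re_Im_norm_le (x : R[i]) r : `|x| <= r%:C -> `|complex.Re x| <= r /\ `|complex.Im x| <= r.
Proof.
move=> xr; split; rewrite -lecR; apply: le_trans xr; first exact: normc_ge_Re.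
rewrite normc_def lecR -[leLHS]sqrtr_sqr ler_sqrt ?addr_ge0 ?sqr_ge0 //.
by rewrite lerDr sqr_ge0.
Qed.

(** The power series in X of c0 plus the transform of [f] at l (1 - X), cut at order [m]; a Dirac
    part becomes a constant term. *)
Definition ppoly (c0 l : R) f m : {poly R} := c0%:P + \poly_(n < m) pcoef l f n.

Lemma ppoly_pl1 c0 l f m : 0 < l -> intg f -> pl1 (ppoly c0 l f m) <= `|c0| + itg (fun t => `|f t|).
Proof.
move=> l0 fi; apply: le_trans (pl1D _ _) _; rewrite pl1C lerD2l.
rewrite (@pl1_widen R _ m) ?size_poly //.
under eq_bigr => i _ do rewrite coef_poly ltn_ord.
exact: pcoef_abs_sum.
Qed.

Lemma ppoly_nneg c0 l f m : 0 < l -> 0 <= c0 -> (forall t, 0 <= f t) -> pnneg (ppoly c0 l f m).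
Proof.
move=> l0 c00 f0 i; rewrite coefD coefC coef_poly addr_ge0 //; first by case: eqP.
by case: ifP => // _; exact: pcoef_ge0.
Qed.

Lemma ppoly_approx c0 l f m a b : 0 < l -> intg f -> causal f -> a ^+ 2 + b ^+ 2 <= 1 ->
  let y := (map_poly (real_complex R) (ppoly c0 l f m)).[a +i* b] in
  let w := c0%:C + lap f ((l * (1 - a)) +i* (- (l * b))) in
  `|complex.Re w - complex.Re y| <= ptail l f m /\
  `|complex.Im w - complex.Im y| <= ptail l f m.
Proof.
move=> l0 fi cf ab y w; have [h1 h2] := pcoef_approx l0 fi cf m ab.
have Ew : w = (c0 + lapc f (l * (1 - a)) (l * b)) +i* laps f (l * (1 - a)) (l * b).
  rewrite /w /lap /=; apply/eqP; rewrite eq_complex /= add0r; apply/andP; split; apply/eqP.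
    by congr (_ + _); apply: itg_eq => t; rewrite mulNr cosN.
  rewrite /laps -[RHS]opprK; congr (- _); rewrite -[RHS]mulN1r -itgZ.
    by apply: itg_eq => t; rewrite mulNr sinN; ring.
  by apply: intg_kers => //; rewrite mulr_ge0 ?(ltW l0) // subr_ge0; have := sqr_ge0 b; nra.
have ReD (u v : R[i]) : complex.Re (u + v) = complex.Re u + complex.Re v by case: u; case: v.
have ImD (u v : R[i]) : complex.Im (u + v) = complex.Im u + complex.Im v by case: u; case: v.
have [E1 E2] := @horner_ReIm (\poly_(n < m) pcoef l f n) (a +i* b) m (size_poly _ _).
have Ey : y = (c0 + \sum_(n < m) pcoef l f n * complex.Re ((a +i* b) ^+ n)) +i*
   (\sum_(n < m) pcoef l f n * complex.Im ((a +i* b) ^+ n)).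
  rewrite /y /ppoly rmorphD /= map_polyC hornerD hornerC /=.
  apply/eqP; rewrite eq_complex; apply/andP; split; apply/eqP.
    rewrite ReD E1 /=; congr (_ + _).
    by apply: eq_bigr => n _; rewrite coef_poly ltn_ord.
  rewrite ImD E2 /= add0r.
  by apply: eq_bigr => n _; rewrite coef_poly ltn_ord.
rewrite Ew Ey /=; split => //.
by rewrite opprD addrACA subrr add0r.
Qed.

Lemma prod_norm_le (x y X Y : R) : `|x| <= X -> `|y| <= Y -> - (X * Y) <= x * y.
Proof.
move=> hx hy; have : `|x * y| <= X * Y by rewrite normrM ler_pM.
by rewrite ler_norml => /andP[].
Qed.

(** The four error terms are at most (2 + A) t, (1 + A) t, B t and B t, whence the constant. The
    bound [t <= 1] transfers the estimates on [pr] and [pi] to [zr] and [zi]. *)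
Lemma Re_prod_perturb (e t A B zr zi gr gi pr pi qr qi : R) : 0 <= t -> t <= 1 ->
  e <= (1 - zr) * gr + zi * gi ->
  `|zr - pr| <= t -> `|zi - pi| <= t -> `|gr - qr| <= t -> `|gi - qi| <= t ->
  `|pr| <= A -> `|pi| <= A -> `|qr| <= B -> `|qi| <= B ->
  e - t * (3 + 2 * A + 2 * B) <= (1 - pr) * qr + pi * qi.
Proof.
move=> t0 t1 he zp zpi gq gqi pA piA qB qiB.
have zr1 : `|1 - zr| <= 2 + A.
  move: pA zp; rewrite !ler_norml; lra.
have zi1 : `|zi| <= 1 + A by move: piA zpi; rewrite !ler_norml; lra.
have q1 : `|qr - gr| <= t by rewrite distrC.
have q2 : `|qi - gi| <= t by rewrite distrC.
have z1 : `|pi - zi| <= t by rewrite distrC.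
have h1 := prod_norm_le zr1 q1; have h2 := prod_norm_le zi1 q2.
have h3 := prod_norm_le zp qB; have h4 := prod_norm_le z1 qiB.
have E : (1 - pr) * qr + pi * qi = ((1 - zr) * gr + zi * gi) + (1 - zr) * (qr - gr)
  + zi * (qi - gi) + (zr - pr) * qr + (pi - zi) * qi by ring.
rewrite E; nra.
Qed.

End poisson_polynomial.

(** * Construction of E and zeta *)

Section fractional_approximants.
Context {R : realType}.
Variables (g0 z0 : R) (g z : R -> R) (eps al : R).
Hypotheses (gi : intg g) (cg : causal g) (zi : intg z) (cz : causal z).
Hypotheses (z00 : 0 <= z0) (zz0 : forall t, 0 <= z t) (al01 : 0 < al < 1) (eps0 : 0 < eps).
Hypothesis multiplier : forall s : R[i], 0 <= complex.Re s ->
  eps <= complex.Re ((1 - (z0%:C + lap z s)) * (g0%:C + lap g s)).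

(** For a fixed delay two truncations are tuned: [K] for the binomial series, uniformly over the
    real points [s >= s0], and [m] for the Poisson series, uniformly over the unit disc. The point
    [sg] is l (1 - N) at exp(- s d). *)
Lemma fractional_step (d s0 tau : R) : 0 < d -> 0 < s0 -> 0 < tau ->
  exists E zeta : {poly R},
  [/\ pl1 E <= `|g0| + itg (fun t => `|g t|), pnneg zeta, pl1 zeta <= z0 + itg z,
    (forall x : R[i], `|x| = 1 ->
      eps / 2 <= complex.Re (map_poly (real_complex R) ((1 - zeta) * E)).[x]) &
    forall s : R, s0 <= s -> exists sg : R,
      [/\ ((1 - expR (- (s * d))) / d) `^ al <= sg,
        sg <= ((1 - expR (- (s * d))) / d) `^ al + tau &
        `|E.[expR (- (s * d))] - (g0 + lapc g sg 0)| <= tau]].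
Proof.
move=> d0 s00 tau0; have /andP[a0 a1] := al01.
pose l := (d^-1) `^ al.
have l0 : 0 < l by rewrite powR_gt0 // invr_gt0.
pose q0 := expR (- (s0 * d)).
have q01 : 0 < q0 < 1 by rewrite expR_gt0 -[ltRHS](@expR0 R) ltr_expR oppr_lt0 mulr_gt0.
have /andP[q0_gt0 q0_lt1] := q01.
(* With q = 1 - exp(- x) as in [gl_poly_bound], the truncation costs at most [x * q ^+ K]. This
   grows with [q], and [q] decreases in [s], so the value at [s0] controls all [s >= s0]. *)
pose x0 := - ln (1 - q0).
have [K HK] : exists K : nat, l * (x0 * q0 ^+ K) <= tau.
  have : l * (x0 * q0 ^+ n) @[n --> \oo] --> l * (x0 * 0).
    apply: cvgM; first exact: cvg_cst.
    apply: cvgM; first exact: cvg_cst.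
    by apply: cvg_expr; rewrite gtr0_norm.
  rewrite !mulr0 => /cvgrPdist_le /(_ _ tau0)[K _ /(_ K (leqnn K))].
  by rewrite sub0r normrN => /(le_trans (ler_norm _)) h; exists K.
pose A := z0 + itg (fun t => `|z t|); pose B := `|g0| + itg (fun t => `|g t|).
have A0 : 0 <= A by rewrite addr_ge0 // itg_ge0.
have B0 : 0 <= B by rewrite addr_ge0 // itg_ge0.
have C0 : 0 < 3 + 2 * A + 2 * B by lra.
(* [tau] serves the real points, 1 is required by [Re_prod_perturb], and the last entry limits the
   loss on the circle to [eps / 2]. *)
pose t := Num.min tau (Num.min 1 (eps / 2 / (3 + 2 * A + 2 * B))).
have t0 : 0 < t by rewrite !lt_min tau0 ltr01 !divr_gt0.
have t1 : t <= 1 by rewrite /t !ge_min lexx orbT.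
have ttau : t <= tau by rewrite /t ge_min lexx.
have tC : t * (3 + 2 * A + 2 * B) <= eps / 2.
  by rewrite -ler_pdivlMr // /t !ge_min lexx !orbT.
have [m [Hg Hz]] : exists m, ptail l g m <= t /\ ptail l z m <= t.
  have /cvgrPdist_le/(_ _ t0)[m1 _ H1] := ptail_cvg0 l0 gi cg.
  have /cvgrPdist_le/(_ _ t0)[m2 _ H2] := ptail_cvg0 l0 zi cz.
  exists (maxn m1 m2); split.
    have := H1 (maxn m1 m2) (leq_maxl _ _).
    by rewrite sub0r normrN => /(le_trans (ler_norm _)).
  have := H2 (maxn m1 m2) (leq_maxr _ _).
  by rewrite sub0r normrN => /(le_trans (ler_norm _)).
pose N := gl_poly al K; pose Q := ppoly g0 l g m; pose P := ppoly z0 l z m.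
have N1 : pl1 N <= 1 by exact: gl_poly_pl1.
exists (Q \Po N), (P \Po N); split.
- by apply: le_trans (pl1_comp _ N1) _; exact: ppoly_pl1.
- by apply: pnneg_comp; [exact: ppoly_nneg|exact: gl_poly_nneg].
- apply: le_trans (pl1_comp _ N1) _; apply: le_trans (ppoly_pl1 _ _ l0 zi) _.
  rewrite ger0_norm // lerD2l (@itg_eq R (fun t => `|z t|) z) // => u.
  by rewrite ger0_norm.
- move=> x x1; have := @horner_norm_le R N x; rewrite x1 => /(_ (lexx _)) Nx.
  rewrite rmorphM rmorphB rmorph1 /= !map_comp_poly hornerM hornerD hornerN hornerC !horner_comp.
  set y := (map_poly _ N).[x] in Nx *.
  have y1 : `|y| <= 1 by apply: le_trans Nx _; rewrite lecR.
  have ab : complex.Re y ^+ 2 + complex.Im y ^+ 2 <= 1.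
    by rewrite -lecR add_Re2_Im2 expr_le1.
  case: y Nx y1 ab => a b _ y1 /= ab.
  have /Re_Im_norm_le[Q1 Q2] : `|(map_poly (real_complex R) Q).[a +i* b]| <= B%:C.
    by apply: (le_trans (horner_norm_le Q y1)); rewrite lecR; exact: ppoly_pl1.
  have /Re_Im_norm_le[P1 P2] : `|(map_poly (real_complex R) P).[a +i* b]| <= A%:C.
    by apply: (le_trans (horner_norm_le P y1)); rewrite lecR /A -{1}(ger0_norm z00); exact: ppoly_pl1.
  have [G1 G2] := @ppoly_approx R g0 l g m a b l0 gi cg ab.
  have [Z1 Z2] := @ppoly_approx R z0 l z m a b l0 zi cz ab.
  have Hs : 0 <= complex.Re ((l * (1 - a)) +i* (- (l * b))).
    by rewrite /= mulr_ge0 ?(ltW l0) // subr_ge0; have := sqr_ge0 b; nra.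
  have := multiplier Hs.
  move: Q1 Q2 P1 P2 G1 G2 Z1 Z2; rewrite -/Q -/P.
  case: ((map_poly _ Q).[_]) => qr qi; case: ((map_poly _ P).[_]) => pr pi.
  case: (g0%:C + lap g _) => gr gim; case: (z0%:C + lap z _) => zr zim /=.
  move=> Q1 Q2 P1 P2 G1 G2 Z1 Z2 He.
  have := @Re_prod_perturb R eps t A B zr zim gr gim pr pi qr qi (ltW t0) t1.
  have -> : (1 - zr) * gr + zim * gim = (1 - zr) * gr - (0 - zim) * gim by ring.
  move=> /(_ He (le_trans Z1 Hz) (le_trans Z2 Hz) (le_trans G1 Hg) (le_trans G2 Hg) P1 P2 Q1 Q2).
  move=> h; rewrite (_ : _ - _ = (1 - pr) * qr + pi * qi); last by ring.
  lra.
move=> s ss; set q := expR (- (s * d)).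
have s0' : 0 < s by exact: lt_le_trans ss.
have /andP[qgt0 qlt1] : 0 < q < 1 by rewrite expR_gt0 -[ltRHS](@expR0 R) ltr_expR oppr_lt0 mulr_gt0.
pose x := - ln (1 - q).
have q1 : 0 < 1 - q by rewrite subr_gt0.
have xq : q = 1 - expR (- x) by rewrite /x opprK lnK ?posrE //; ring.
have x_ge0 : 0 <= x by rewrite oppr_ge0 ln_le0 // gerDl oppr_le0 ltW.
have qq0 : q <= q0 by rewrite ler_expR lerN2 ler_wpM2r ?(ltW d0).
have xx0 : x <= x0.
  by rewrite lerN2 ler_ln ?posrE ?subr_gt0 // lerD2l lerN2.
have := gl_poly_bound al01 K x_ge0; rewrite -xq -/N => /andP[f1 f2].
have El : l * expR (- (al * x)) = ((1 - q) / d) `^ al.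
  rewrite powRM ?invr_ge0 ?(ltW d0) ?(ltW q1) // mulrC; congr (_ * _).
  by rewrite /powR gt_eqF // /x mulrN opprK.
exists (l * (1 - N.[q])); split.
- by rewrite -El ler_wpM2l // ltW.
- rewrite -El; apply: le_trans (ler_wpM2l (ltW l0) f2) _; rewrite mulrDr lerD2l.
  apply: le_trans HK; rewrite ler_wpM2l ?(ltW l0) //.
  apply: ler_pM => //; first by rewrite exprn_ge0 // ltW.
  by rewrite lerXn2r // nnegrE ltW.
rewrite horner_comp; set a := N.[q].
have Na : (map_poly (real_complex R) N).[q%:C] = a%:C by rewrite horner_map.
have a2 : a ^+ 2 + 0 ^+ 2 <= 1.
  have : `|(map_poly (real_complex R) N).[q%:C]| <= 1.
    apply: le_trans (horner_norm_le N _) _; last by rewrite lecR.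
    by rewrite normc_def /= expr0n addr0 sqrtr_sqr lecR gtr0_norm // ltW.
  rewrite Na => h.
  have -> : a ^+ 2 + 0 ^+ 2 = complex.Re a%:C ^+ 2 + complex.Im a%:C ^+ 2 by [].
  by rewrite -lecR add_Re2_Im2 expr_le1.
have [+ _] := @ppoly_approx R g0 l g m a 0 l0 gi cg a2.
rewrite mulr0 oppr0 (_ : a +i* 0 = a%:C) // horner_map /= -/Q distrC => h.
by apply: le_trans h (le_trans Hg ttau).
Qed.

(** The quotient lies between s / (1 + s d) and s, by exp(c) >= 1 + c at c = s d and at c = - s
    d. *)
Lemma difference_quotient_cvg (s : R) (d : nat -> R) : 0 < s -> (forall j, 0 < d j) ->
  d j @[j --> \oo] --> 0 ->
  ((1 - expR (- (s * d j))) / d j) `^ al @[j --> \oo] --> s `^ al.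
Proof.
move=> s0 d0 dc.
have H : (1 - expR (- (s * d j))) / d j @[j --> \oo] --> s.
  apply: (@squeeze_cvgr _ _ _ _ (fun j => s / (1 + s * d j)) (fun=> s)).
  - near=> j; have dj := d0 j; set c := s * d j.
    have c0 : 0 < c by rewrite mulr_gt0.
    have -> : s / (1 + s * d j) = (c / (1 + c)) / d j.
      by rewrite /c; field; rewrite !gt_eqF // addr_gt0.
    apply/andP; split.
      rewrite ler_pM2r ?invr_gt0 // lerBrDl -lerBrDr.
      have -> : 1 - c / (1 + c) = (1 + c)^-1 by field; rewrite gt_eqF // addr_gt0.
      by rewrite expRN lef_pV2 ?posrE ?expR_gt0 ?addr_gt0 // expR_ge1Dx.
    rewrite ler_pdivrMr // -/c; have := expR_ge1Dx (- c); lra.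
  - rewrite [X in _ --> X](_ : s = s / (1 + s * 0)); last by rewrite mulr0 addr0 divr1.
    apply: cvgM; first exact: cvg_cst.
    apply: cvgV; first by rewrite mulr0 addr0 oner_neq0.
    apply: cvgD; first exact: cvg_cst.
    by apply: cvgM; first exact: cvg_cst.
  - exact: cvg_cst.
have E x : 0 < x -> x `^ al = expR (al * ln x) by move=> x0; rewrite /powR gt_eqF.
have X0 j : 0 < (1 - expR (- (s * d j))) / d j.
  by rewrite divr_gt0 // subr_gt0 -[ltRHS](@expR0 R) ltr_expR oppr_lt0 mulr_gt0.
rewrite E //; under eq_fun do rewrite E //.
have h : al * ln ((1 - expR (- (s * d j))) / d j) @[j --> \oo] --> al * ln s.
  apply: cvgM; first exact: cvg_cst.
  exact: (cvg_comp _ _ H (continuous_ln s0)).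
exact: (cvg_comp _ _ h (@continuous_expR R _)).
Unshelve. all: by end_near.
Qed.

Lemma fractional_approximants (s0 : R) : 0 < s0 -> exists E zeta : nat -> {poly R},
  (forall j, [/\ pl1 (E j) <= `|g0| + itg (fun t => `|g t|), pnneg (zeta j),
    pl1 (zeta j) <= z0 + itg z &
    forall x : R[i], `|x| = 1 ->
      eps / 2 <= complex.Re (map_poly (real_complex R) ((1 - zeta j) * E j)).[x]]) /\
  forall s : R, s0 <= s -> (E j).[expR (- (s * j.+1%:R^-1))] @[j --> \oo] -->
    g0 + lapc g (s `^ al) 0.
Proof.
move=> s00; pose d (j : nat) : R := j.+1%:R^-1.
have d0 j : 0 < d j by rewrite invr_gt0 ltr0n.
have dc : d j @[j --> \oo] --> 0 by exact: cvg_harmonic.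
(* The delay 1 / (j + 1) doubles as the tolerance. *)
have step j := fractional_step (d0 j) s00 (d0 j).
have /choice[E] := step => /choice[zeta H].
exists E, zeta; split; first by move=> j; have [] := H j.
move=> s ss; have sp : 0 < s by exact: lt_le_trans ss.
have /choice[sg Hsg] : forall j, exists sg : R,
      [/\ ((1 - expR (- (s * d j))) / d j) `^ al <= sg,
        sg <= ((1 - expR (- (s * d j))) / d j) `^ al + d j &
        `|(E j).[expR (- (s * d j))] - (g0 + lapc g sg 0)| <= d j].
  by move=> j; have [_ _ _ _ /(_ s ss)] := H j.
have sgc : sg j @[j --> \oo] --> s `^ al.
  have hq := difference_quotient_cvg sp d0 dc.
  have hd := cvgD hq dc; rewrite addr0 in hd.
  apply: (@squeeze_cvgr _ _ _ _ (fun j => ((1 - expR (- (s * d j))) / d j) `^ al)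
    (fun j => ((1 - expR (- (s * d j))) / d j) `^ al + d j)); [|exact: hq|exact: hd].
  by apply: nearW => j; have [h1 h2 _] := Hsg j; apply/andP; split.
have sg0 j : 0 <= sg j by have [h _ _] := Hsg j; apply: le_trans h; exact: powR_ge0.
have lc : lapc g (sg j) 0 @[j --> \oo] --> lapc g (s `^ al) 0.
  have [||||_] := @itg_dct R (fun j t => g t * (expR (- (sg j * t)) * cos (0 * t)))
    (fun t => g t * (expR (- (s `^ al * t)) * cos (0 * t))) (fun t => `|g t|) _ _ _ (intg_norm gi).
  - by move=> j; apply: intg_meas; exact: intg_kerc.
  - by apply: intg_meas; apply: intg_kerc => //; exact: powR_ge0.
  - move=> t; apply: cvgM; first exact: cvg_cst.
    apply: cvgM; last exact: cvg_cst.
    have h : - (sg j * t) @[j --> \oo] --> - (s `^ al * t).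
      by apply: cvgN; apply: cvgM; [exact: sgc|exact: cvg_cst].
    exact: (cvg_comp _ _ h (@continuous_expR R _)).
  - by move=> j t; apply: (@causal_ker_le _ g (fun t => cos (0 * t))) => //; exact: cos_norm_le1.
  by [].
have h1 : (E j).[expR (- (s * d j))] - (g0 + lapc g (sg j) 0) @[j --> \oo] --> 0.
  apply/norm_cvg0P; apply: (@squeeze_cvgr _ _ _ _ (fun=> 0) d); [|exact: cvg_cst|exact: dc].
  by apply: nearW => j; have [_ _ h] := Hsg j; rewrite normr_ge0 h.
have h2 : g0 + lapc g (sg j) 0 @[j --> \oo] --> g0 + lapc g (s `^ al) 0.
  by apply: cvgD; [exact: cvg_cst|exact: lc].
have h3 := cvgD h1 h2; rewrite add0r in h3.
suff -> : (fun j => (E j).[expR (- (s * j.+1%:R^-1))]) =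
  (fun j => ((E j).[expR (- (s * d j))] - (g0 + lapc g (sg j) 0)) + (g0 + lapc g (sg j) 0)) by exact: h3.
by apply/funext => j; rewrite subrK.
Qed.

End fractional_approximants.

(** * Strong convergence of the delay operators *)

Section approximation_on_the_line.
Context {R : realType}.
Notation mu := (@lebesgue_measure R).

Lemma mono_intg (u : nat -> R -> R) (f : R -> R) (B : R) : measurable_fun setT f ->
  (forall n, intg (u n)) -> (forall n x, 0 <= u n x) ->
  (forall x n m, (n <= m)%N -> u n x <= u m x) ->
  (forall x, u n x @[n --> \oo] --> f x) -> (forall n, itg (u n) <= B) ->
  intg f /\ itg f <= B.
Proof.
move=> mf ui u0 um uf uB.
have f0 x : 0 <= f x by apply: (cvgr_to_ge (uf x)); exact: nearW.
have H : (\int[mu]_x (u n x)%:E @[n --> \oo] --> \int[mu]_x (f x)%:E)%E.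
  have -> : (\int[mu]_x (f x)%:E = \int[mu]_x limn (fun n => (u n x)%:E))%E.
    apply: eq_integral => x _; apply/esym/cvg_lim => //.
    exact: (cvg_EFin (nearW _ (fun _ => _)) (uf x)).
  apply: (@cvg_monotone_convergence _ _ R mu setT measurableT (fun n x => (u n x)%:E)).
  - by move=> n; apply/measurable_EFinP; exact: intg_meas.
  - by move=> n x _; rewrite lee_fin.
  - by move=> x _ n m nm; rewrite lee_fin um.
have HB : (\int[mu]_x (f x)%:E <= B%:E)%E.
  apply: (cvge_le _ H); apply: nearW => n.
  by rewrite (intg_EFin (ui n)) lee_fin.
have fi : intg f by apply: intg_nneg => //; exact: le_lt_trans HB (ltry _).
by split => //; rewrite -lee_fin -intg_EFin.
Qed.

Definition ramp (x : R) : R := Num.min 1 (Num.max 0 x).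

Lemma ramp_bounds x : 0 <= ramp x <= 1.
Proof. by rewrite /ramp le_min ler01 le_max lexx ge_min lexx. Qed.

Lemma ramp_le0 x : x <= 0 -> ramp x = 0.
Proof. by move=> x0; rewrite /ramp (max_idPl x0) (min_idPr ler01). Qed.

Lemma ramp_ge1 x : 1 <= x -> ramp x = 1.
Proof.
by move=> x1; rewrite /ramp (max_idPr (le_trans ler01 x1)) (min_idPl x1).
Qed.

Lemma ramp_mono x y : x <= y -> ramp x <= ramp y.
Proof.
by move=> xy; rewrite /ramp le_min ge_min lexx /= ge_min; apply/orP; right; rewrite ge_max !le_max lexx xy orbT.
Qed.

Lemma continuous_ramp (f : R -> R) : continuous f -> continuous (fun t => ramp (f t)).
Proof.
move=> cf t.
have h : {for t, continuous (fun t : R => Num.max 0 (f t))}.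
  by apply: (@continuous_max R R (fun=> 0) f); [exact: cvg_cst|exact: cf].
by apply: (@continuous_min R R (fun=> 1) (fun t => Num.max 0 (f t))); [exact: cvg_cst|exact: h].
Qed.

Definition box (a b t : R) : R := (a <= t <= b)%R%:R.

Lemma box_ge0 a b t : 0 <= box a b t.
Proof. exact: ler0n. Qed.

Lemma boxE a b : box a b = \1_(`[a, b]%classic : set R).
Proof. by apply/funext => t; rewrite indicE mem_setE. Qed.

Lemma intg_box a b : intg (box a b).
Proof.
rewrite boxE; apply: integrable_indic_itv.
Qed.

Lemma itg_box a b : a <= b -> itg (box a b) = b - a.
Proof.
move=> ab; have E : mu `[a, b]%classic = (b - a)%:E.
  by rewrite lebesgue_measure_itv /= lte_fin; case: ltgtP ab => // -> _; rewrite subrr.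
by rewrite /itg boxE /Rintegral integral_indic // setIT [X in fine X]E.
Qed.

Lemma box_norm_le1 a b t : `|box a b t| <= 1.
Proof. by rewrite /box; case: (_ <= _ <= _); rewrite ?normr1 ?normr0. Qed.

Lemma intg_box_mul a b f : intg f -> intg (fun t => box a b t * f t).
Proof.
move=> fi; apply: intg_eq (@intgM_bdd R f (box a b) 1 fi _ _) => [t||t]; first exact: mulrC.
  exact: intg_meas (intg_box a b).
exact: box_norm_le1.
Qed.

Lemma continuous_approx (f : R -> R) (a b e : R) : intg f -> 0 < e ->
  exists c : R -> R, [/\ continuous c, intg (fun t => box a b t * `|f t - c t|) &
    itg (fun t => box a b t * `|f t - c t|) <= e].
Proof.
move=> fi e0.
have mE : measurable (`[a, b]%classic : set (measurableTypeR R)) by exact: measurable_itv.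
have fE : mu.-integrable `[a, b]%classic (EFin \o f) by exact: integrableS fi.
have Eoo : (mu `[a, b]%classic < +oo)%E.
  by rewrite lebesgue_measure_itv /=; case: ifP => _; rewrite ?ltry.
have [c [cc ci cv]] := @approximation_continuous_integrable R _ f mE Eoo fE.
have icn n : intg (fun t => box a b t * c n t).
  have := (integrable_mkcond _ mE).1 (ci n); apply: eq_integrable => // t _ /=.
  by rewrite patchE mem_setE /box in_itv; case: ifP => _; rewrite ?mul1r ?mul0r.
have ni n : intg (fun t => box a b t * `|f t - c n t|).
  apply: intg_eq (intg_norm (intgB (intg_box_mul a b fi) (icn n))) => t.
  by rewrite -mulrBr normrM (ger0_norm (box_ge0 _ _ _)).
have E n : (\int[mu]_(t in `[a, b]) `|(f t - c n t)%:E| = (itg (fun t => box a b t * `|f t - c n t|))%:E)%E.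
  rewrite -(intg_EFin (ni n)) integral_mkcond; apply: eq_integral => t _.
  by rewrite patchE mem_setE /box in_itv; case: ifP => _; rewrite ?mul1r ?mul0r.
have cv' : itg (fun t => box a b t * `|f t - c n t|) @[n --> \oo] --> 0.
  move: cv; under eq_fun do rewrite E; move/fine_cvg; exact.
have /cvgrPdist_le/(_ _ e0)[n _ /(_ n (leqnn n))] := cv'.
by rewrite sub0r normrN => /(le_trans (ler_norm _)) h; exists (c n).
Qed.

(** c / (|c| + d) is a continuous substitute for the sign of [c], and nearly one for the sign of [x]
    when [c] is close to [x]. *)
Lemma sign_approx (x c d : R) : 0 < d ->
  `|c / (`|c| + d)| <= 1 /\ `|x| - 2 * `|x - c| - d <= x * (c / (`|c| + d)).
Proof.
move=> d0; have n0 := normr_ge0 c; have p0 : 0 < `|c| + d by lra.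
set k := c / _; have k1 : `|k| <= 1.
  by rewrite /k normrM normfV (gtr0_norm p0) ler_pdivrMr // mul1r lerDl ltW.
split=> //.
have ck : `|c| - d <= c * k.
  rewrite /k mulrA -expr2 -(real_normK (num_real c)) ler_pdivlMr //.
  by have := sqr_ge0 d; nra.
have h1 : - `|x - c| <= (x - c) * k.
  have : `|(x - c) * k| <= `|x - c| by rewrite normrM ler_piMr.
  by rewrite ler_norml => /andP[].
have h2 : `|x| <= `|x - c| + `|c| by rewrite -{1}(subrK c x) ler_normD.
have -> : x * k = (x - c) * k + c * k by ring.
lra.
Qed.

(** The L1 norm by duality. Damped integrability makes [h] integrable on bounded intervals; there a
    continuous approximate sign of [h], cut off by [phi n], is an admissible test function, and
    monotone convergence in [n] removes the cutoff. *)
Lemma intg_of_test (h : R -> R) (s0 B : R) : 0 <= s0 -> measurable_fun setT h -> causal h ->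
  intg (fun t => h t * expR (- (s0 * t))) ->
  (forall (v : R -> R) (T : R), continuous v -> (forall t, T <= t -> v t = 0) ->
     (forall t, `|v t| <= 1) -> itg (fun t => h t * v t) <= B) ->
  intg h /\ itg (fun t => `|h t|) <= B.
Proof.
move=> s00 mh ch ih HB.
pose phi (n : nat) (t : R) := ramp (n%:R - t).
have cphi n : continuous (phi n).
  by apply: continuous_ramp => t; apply: cvgB; [exact: cvg_cst|exact: cvg_id].
have phi0 (n : nat) (t : R) : n%:R <= t -> phi n t = 0 by move=> nt; rewrite /phi ramp_le0 // subr_le0.
have ibh n : intg (fun t => box 0 n%:R t * h t).
  apply: (@intg_le _ _ (fun t => expR (s0 * n%:R) * `|h t * expR (- (s0 * t))|)).
  - by apply: measurable_funM => //; exact: intg_meas (intg_box _ _).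
  - move=> t; rewrite /box; case: (boolP (0 <= t <= n%:R)) => [/andP[t0 tn]|_]; last first.
      by rewrite mul0r normr0 mulr_ge0 ?expR_ge0.
    rewrite mul1r [X in _ * X]normrM (gtr0_norm (expR_gt0 _)) mulrCA ler_peMr //.
    by rewrite -expRD -[leLHS](@expR0 R) ler_expR -mulrBr mulr_ge0 // subr_ge0.
  - by apply: intgZ; exact: intg_norm.
have hb (n : nat) (k : R -> R) (t : R) : h t * (phi n t * k t) = box 0 n%:R t * h t * (phi n t * k t).
  rewrite /box; case: (boolP (0 <= t <= n%:R)) => [_|]; first by rewrite mul1r.
  rewrite negb_and -!ltNge => /orP[t0|tn]; first by rewrite ch // mul0r mulr0 mul0r.
  by rewrite phi0 ?(ltW tn) // !mul0r !mulr0.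
have iphi n : intg (fun t => phi n t * `|h t|).
  have := @intgM_bdd R _ (phi n) 1 (intg_norm (ibh n)).
  move=> /(_ _ _) H; apply: intg_eq (H _ _) => [t||t].
  - rewrite normrM (ger0_norm (box_ge0 _ _ _)) /box; case: (boolP (0 <= t <= n%:R)) => [_|].
      by rewrite mul1r mulrC.
    rewrite negb_and -!ltNge => /orP[t0|tn]; first by rewrite ch // normr0 !mulr0 mul0r.
    by rewrite phi0 ?(ltW tn) // mul0r mulr0.
  - exact: continuous_measurable_fun.
  - by have /andP[p0 p1] := ramp_bounds (n%:R - t); rewrite ger0_norm.
have iB n : itg (fun t => phi n t * `|h t|) <= B.
  apply/ler_addgt0Pr => e e0.
  have e4 : 0 < e / 4 by lra.
  have [c [cc ic ce]] := continuous_approx 0 n%:R (ibh n) e4.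
  (* Smoothing the sign costs [d * n <= e / 2] on [0, n], and the L1 approximation costs
     [2 * (e / 4)]. *)
  pose d := e / 2 / n.+1%:R.
  have n1 : 0 < n.+1%:R :> R by rewrite ltr0n.
  have d0 : 0 < d by rewrite !divr_gt0.
  pose k t := c t / (`|c t| + d).
  have ck : continuous k.
    move=> t; apply: cvgM; first exact: cc.
    apply: cvgV; first by rewrite gt_eqF // ltr_wpDl.
    by apply: cvgD; [apply: cvg_norm; exact: cc|exact: cvg_cst].
  have cv : continuous (fun t => phi n t * k t).
    by move=> t; apply: cvgM; [exact: cphi|exact: ck].
  have p01 t : 0 <= phi n t <= 1 by exact: ramp_bounds.
  have v1 t : `|phi n t * k t| <= 1.
    have /andP[p0 p1] := p01 t.
    have [h1 _] := @sign_approx 0 (c t) d d0.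
    by rewrite normrM (ger0_norm p0) mulr_ile1 ?normr_ge0 //; exact: h1.
  have vn t : n%:R <= t -> phi n t * k t = 0 by move=> nt; rewrite phi0 // mul0r.
  have H := HB _ n%:R cv vn v1.
  have ihv : intg (fun t => h t * (phi n t * k t)).
    apply: intg_eq (@intgM_bdd R _ (fun t => phi n t * k t) 1 (ibh n) _ v1) => [t|].
      by rewrite -hb.
    exact: continuous_measurable_fun.
  apply: (@le_trans _ _ (itg (fun t => h t * (phi n t * k t) +
     (2 * (box 0 n%:R t * `|box 0 n%:R t * h t - c t|) + d * box 0 n%:R t)))).
    apply: itg_le => //.
      by apply: intgD => //; apply: intgD; apply: intgZ => //; exact: intg_box.
    move=> t; rewrite hb; have /andP[p0 p1] := p01 t.
    rewrite /box; case: (boolP (0 <= t <= n%:R)) => [_|].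
      rewrite !mul1r mulr1.
      have [_ ] := @sign_approx (h t) (c t) d d0; rewrite -/(k t) => hk.
      have -> : h t * (phi n t * k t) = phi n t * (h t * k t) by ring.
      have h0 : 0 <= 2 * `|h t - c t| + d by rewrite addr_ge0 ?mulr_ge0 // ltW.
      have h1 : phi n t * (`|h t| - 2 * `|h t - c t| - d) <= phi n t * (h t * k t) by rewrite ler_wpM2l.
      have h2 : phi n t * (2 * `|h t - c t| + d) <= 2 * `|h t - c t| + d by rewrite ler_piMl.
      lra.
    rewrite negb_and -!ltNge => /orP[t0|tn].
      by rewrite ch // normr0 !mul0r !mulr0 !addr0.
    by rewrite phi0 ?(ltW tn) // !mul0r !mulr0 !addr0.
  rewrite itgD //; last by apply: intgD; apply: intgZ => //; exact: intg_box.
  rewrite itgD; [|exact: intgZ|by apply: intgZ; exact: intg_box].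
  rewrite (itgZ _ ic) (itgZ _ (intg_box _ _)) itg_box // subr0.
  have dn : d * n%:R <= e / 2.
    rewrite /d -mulrA ler_piMr ?(ltW (divr_gt0 e0 _)) // mulrC ler_pdivrMr // mul1r ler_nat leqnSn //.
  lra.
suff [hi hB] : intg (fun t => `|h t|) /\ itg (fun t => `|h t|) <= B.
  by split => //; apply: intg_le hi.
apply: (@mono_intg (fun n t => phi n t * `|h t|)) => //.
- exact: measurableT_comp.
- by move=> n t; have /andP[p0 _] := ramp_bounds (n%:R - t); rewrite mulr_ge0.
- by move=> t n m nm; rewrite ler_wpM2r // ramp_mono // lerD2r ler_nat.
- move=> t; rewrite -[X in _ --> X]mul1r; apply: cvgM; last exact: cvg_cst.
  apply: cvg_near_cst; exists (Num.truncn (t + 1)).+1 => // n /= hn.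
  rewrite /phi ramp_ge1 // lerBrDr addrC ltW //.
  by apply: (lt_le_trans (truncnS_gt _)); rewrite ler_nat.
Qed.

End approximation_on_the_line.

(** * Continuous functions are dense in L2(0, T) *)

Section square_integrable_density.
Context {R : realType}.
Notation mu := (@lebesgue_measure R).

Definition clip (m x : R) : R := Num.max (- m) (Num.min m x).

Lemma clip_norm m x : 0 <= m -> `|clip m x| <= m.
Proof.
move=> m0; rewrite ler_norml /clip le_max lexx /= ge_max ge_min lexx /= andbT.
by rewrite -subr_ge0 opprK addr_ge0.
Qed.

Lemma clip_id m x : `|x| <= m -> clip m x = x.
Proof.
rewrite ler_norml => /andP[h1 h2].
by rewrite /clip (min_idPr h2) (max_idPr h1).
Qed.

Lemma clip_lipschitz m x y : `|clip m x - clip m y| <= `|x - y|.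
Proof.
have h1 (a b : R) : `|Num.min m a - Num.min m b| <= `|a - b|.
  have n1 := ler_norm (a - b); have n2 := ler_norm (- (a - b)); rewrite normrN in n2.
  by rewrite ler_norml; case: (leP m a) => ma; case: (leP m b) => mb; apply/andP; split; lra.
rewrite /clip; apply: le_trans (h1 x y); move: (Num.min m x) (Num.min m y) => a b.
have n1 := ler_norm (a - b); have n2 := ler_norm (- (a - b)); rewrite normrN in n2.
rewrite ler_norml; case: (leP (- m) a) => ma; case: (leP (- m) b) => mb; apply/andP; split; lra.
Qed.

(** [p * clip m x] lies between 0 and [x]; this supplies the dominating function for the cutoff
    error in [sqi_dense]. *)
Lemma clip_damped m x p : 0 <= m -> 0 <= p <= 1 -> `|x - p * clip m x| <= `|x|.
Proof.
move=> m0 /andP[p0 p1].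
have [x0|x0] := leP 0 x.
  have c0 : 0 <= clip m x <= x.
    rewrite /clip le_max ge_max le_min m0 x0 orbT /= ge_min lexx orbT andbT.
    by apply: le_trans x0; rewrite oppr_le0.
  have /andP[c1 c2] := c0; rewrite (ger0_norm x0) ger0_norm; last first.
    by rewrite subr_ge0; nra.
  by rewrite gerDl oppr_le0 mulr_ge0.
have c0 : x <= clip m x <= 0.
  rewrite /clip le_max ge_max le_min lexx ge_min (ltW x0) oppr_le0 m0 orbT !andbT.
  by rewrite (ltW (lt_le_trans x0 m0)) orbT.
have /andP[c1 c2] := c0; rewrite (ltr0_norm x0) ler0_norm; nra.
Qed.

Lemma continuous_clip (m : R) (f : R -> R) : continuous f -> continuous (fun t => clip m (f t)).
Proof.
move=> cf t.
have h : {for t, continuous (fun t : R => Num.min m (f t))}.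
  by apply: (@continuous_min R R (fun=> m) f); [exact: cvg_cst|exact: cf].
by apply: (@continuous_max R R (fun=> - m) (fun t => Num.min m (f t))); [exact: cvg_cst|exact: h].
Qed.

Lemma measurable_clip (m : R) (f : R -> R) : measurable_fun setT f ->
  measurable_fun setT (fun t => clip m (f t)).
Proof.
move=> mf; apply: (@measurable_funTS _ _ _ _ setT).
apply: (measurableT_comp _ mf); apply: continuous_measurable_fun.
by apply: (@continuous_clip m id) => t; exact: cvg_id.
Qed.

(** Damping and clipping first make [w] bounded with bounded support at a small L2 cost. Between
    functions bounded by [m] the squared difference is at most 2 m times the difference, so an L1
    approximation then suffices. *)
Lemma sqi_dense (w : R -> R) (T e : R) : 0 < T -> 0 < e -> sqi w ->
  (forall t, ~~ (0 < t <= T) -> w t = 0) ->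
  exists (c : R -> R) (B : R), [/\ continuous c, (forall t, t <= 0 -> c t = 0),
    (forall t, `|c t| <= B), sqi c & nrm (fun t => w t - c t) <= e].
Proof.
move=> T0 e0 sw w0; have [mw iw] := sw.
(* The first factor vanishes for [t <= 0] and tends to 1 for [t > 0]; the second leaves ]0, T]
   untouched and vanishes from [T + 1] on. *)
pose psi (m : nat) (t : R) := ramp (m%:R * t) * ramp (T + 1 - t).
have psi01 m t : 0 <= psi m t <= 1.
  have /andP[a0 a1] := ramp_bounds (m%:R * t); have /andP[b0 b1] := ramp_bounds (T + 1 - t).
  by rewrite mulr_ge0 //= mulr_ile1.
have cpsi m : continuous (psi m).
  move=> t; apply: cvgM.
    by apply: continuous_ramp => s; apply: cvgM; [exact: cvg_cst|exact: cvg_id].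
  by apply: (@continuous_ramp R (fun s => T + 1 - s)) => s; apply: cvgB; [exact: cvg_cst|exact: cvg_id].
have mpsi m : measurable_fun setT (psi m) by exact: continuous_measurable_fun.
have psi0 m t : ~~ (0 <= t <= T + 1) -> psi m t = 0.
  rewrite negb_and -!ltNge /psi => /orP[t0|tT].
    by rewrite ramp_le0 ?mul0r // mulr_ge0_le0 // ltW.
  by rewrite [ramp (T + 1 - t)]ramp_le0 ?mulr0 // subr_le0 ltW.
pose wm (m : nat) t := psi m t * clip m%:R (w t).
have mwm m : measurable_fun setT (wm m) by apply: measurable_funM => //; exact: measurable_clip.
have [m Hm] : exists m, nrm (fun t => w t - wm m t) <= e / 2.
  have [||||_ H] := @itg_dct R (fun m t => (w t - wm m t) ^+ 2) (fun=> 0) (fun t => w t ^+ 2) _ _ _ iw.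
  - by move=> m; apply: measurable_funX; exact: measurable_funB.
  - exact: measurable_cst.
  - move=> t; apply: cvg_near_cst.
    have [t0|t0] := boolP (0 < t <= T); last first.
      exists 0%N => // m _ /=; rewrite /wm w0 // clip_id ?normr0 ?ler0n //.
      by rewrite mulr0 subr0 expr0n.
    have /andP[tp tT] := t0.
    (* Beyond [|w t|] the clipping is inactive, and beyond [1 / t] the first ramp has reached 1. *)
    exists (Num.truncn (`|w t| + t^-1)).+1 => // m /= hm.
    have hm' : `|w t| + t^-1 <= m%:R.
      by apply: ltW; apply: (lt_le_trans (truncnS_gt _)); rewrite ler_nat.
    have ti : 0 < t^-1 by rewrite invr_gt0.
    rewrite /wm clip_id; last by apply: le_trans hm'; rewrite lerDl ltW.
    rewrite /psi !ramp_ge1 ?mul1r ?subrr ?expr0n //; first by lra.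
    rewrite -ler_pdivrMr // div1r; apply: le_trans hm'.
    by rewrite lerDr.
  - move=> m t; rewrite normrX -[leRHS]real_normK ?num_real // ler_pXn2r ?nnegrE //.
    exact: clip_damped.
  rewrite itg0 in H.
  have e2 : 0 < (e / 2) ^+ 2 by rewrite exprn_gt0 // divr_gt0.
  have /cvgrPdist_le/(_ _ e2)[m _ /(_ m (leqnn m))] := H.
  rewrite sub0r normrN => /(le_trans (ler_norm _)) h; exists m.
  rewrite -ler_sqr ?nnegrE ?nrm_ge0 ?divr_ge0 ?(ltW e0) // sqr_nrm //.
have wi : intg w.
  apply: (@intg_le _ _ (fun t => w t ^+ 2 + box 0 T t)) => //.
    move=> t; rewrite /box; case: (boolP (0 < t <= T)) => [/andP[t0 tT]|h].
      rewrite (ltW t0) tT /= -(real_normK (num_real (w t))).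
      have := sqr_ge0 (`|w t| - 1); have := normr_ge0 (w t); nra.
    by rewrite w0 // normr0 addr_ge0 ?sqr_ge0.
  by apply: intgD => //; exact: intg_box.
(* Chosen so that [2 * m * eta <= (e / 2)^2]; the extra 1 covers [m = 0]. *)
pose eta := (e / 2) ^+ 2 / (2 * m%:R + 1).
have m1 : 0 < 2 * m%:R + 1 :> R by rewrite ltr_wpDl // mulr_ge0.
have eta0 : 0 < eta by rewrite divr_gt0 // exprn_gt0 // divr_gt0.
have [c0 [cc ic ice]] := continuous_approx 0 (T + 1) wi eta0.
pose c t := psi m t * clip m%:R (c0 t).
have ccont : continuous c.
  by move=> t; apply: cvgM; [exact: cpsi|exact: continuous_clip].
have mc : measurable_fun setT c by exact: continuous_measurable_fun.
have cB t : `|c t| <= m%:R * box 0 (T + 1) t.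
  have /andP[p0 p1] := psi01 m t; rewrite /box.
  case: (boolP (0 <= t <= T + 1)) => h; last by rewrite /c psi0 // mul0r normr0 mulr0.
  by rewrite mulr1 /c normrM (ger0_norm p0) -[leRHS]mul1r ler_pM // clip_norm.
have bb t : box 0 (T + 1) t ^+ 2 = box 0 (T + 1) t.
  by rewrite /box; case: (_ <= _ <= _); rewrite ?expr1n ?expr0n.
have sc : sqi c.
  split => //; apply: (@intg_le _ _ (fun t => m%:R ^+ 2 * box 0 (T + 1) t)).
  - exact: measurable_funX.
  - move=> t; rewrite normrX -(bb t) -exprMn ler_pXn2r ?nnegrE //.
    by rewrite mulr_ge0 ?box_ge0.
  - by apply: intgZ; exact: intg_box.
exists c, m%:R; split => //.
- by move=> t t0; rewrite /c /psi ramp_le0 ?mul0r // mulr_ge0_le0.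
- move=> t; apply: le_trans (cB t) _; rewrite ler_piMr //.
  by have := box_norm_le1 0 (T + 1) t; rewrite ger0_norm ?box_ge0.
have swm : sqi (wm m).
  apply: (@sqi_le _ _ (fun t => m%:R * box 0 (T + 1) t)) => //.
    move=> t; rewrite [leRHS]ger0_norm ?mulr_ge0 ?box_ge0 // /box /wm.
    case: (boolP (0 <= t <= T + 1)) => h; last by rewrite psi0 // mul0r normr0 mulr0.
    have /andP[p0 p1] := psi01 m t.
    by rewrite mulr1 normrM (ger0_norm p0) -[leRHS]mul1r ler_pM // clip_norm.
  apply: sqiZ; split; first exact: intg_meas (intg_box _ _).
  by apply: intg_eq (intg_box 0 (T + 1)) => t; rewrite bb.
have sd : sqi (fun t => wm m t - c t) by exact: sqiB.
have Hd : nrm (fun t => wm m t - c t) <= e / 2.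
  rewrite -ler_sqr ?nnegrE ?nrm_ge0 ?divr_ge0 ?(ltW e0) // sqr_nrm.
  apply: (@le_trans _ _ (itg (fun t => 2 * m%:R * (box 0 (T + 1) t * `|w t - c0 t|)))).
    apply: itg_le; [exact: (proj2 sd)|exact: intgZ|] => t.
    rewrite /wm /c -mulrBr /box; case: (boolP (0 <= t <= T + 1)) => h; last first.
      by rewrite psi0 // mul0r expr0n !mul0r mulr0.
    have /andP[p0 p1] := psi01 m t.
    have h1 := clip_lipschitz m%:R (w t) (c0 t).
    have h2 : `|clip m%:R (w t) - clip m%:R (c0 t)| <= 2 * m%:R.
      apply: le_trans (ler_normB _ _) _; rewrite mulrDl mul1r.
      by rewrite lerD // clip_norm.
    rewrite mul1r -real_normK ?num_real // normrM (ger0_norm p0) expr2.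
    apply: ler_pM; [exact: (mulr_ge0 p0 (normr_ge0 _))|exact: (mulr_ge0 p0 (normr_ge0 _))| |].
      by apply: le_trans h2; rewrite ler_piMl.
    by apply: le_trans h1; rewrite ler_piMl.
  rewrite (itgZ _ ic); apply: (@le_trans _ _ (2 * m%:R * eta)).
    by rewrite ler_wpM2l // mulr_ge0.
  rewrite /eta mulrCA ler_piMr ?exprn_ge0 ?divr_ge0 ?(ltW e0) //.
  by rewrite ler_pdivrMr // mul1r lerDl.
have E : nrm (fun t => w t - c t) = nrm (fun t => (w t - wm m t) + (wm m t - c t)).
  by congr nrm; apply/funext => t; rewrite subrKA.
rewrite E; apply: le_trans (nrmD (sqiB sw swm) sd) _.
by rewrite [leRHS](splitr e) lerD.
Qed.

End square_integrable_density.

(** * Delay operators against convolution on L2(0, T) *)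

Section delay_operators.
Context {R : realType}.
Notation mu := (@lebesgue_measure R).

Definition dly (p : {poly R}) (d : R) (w : R -> R) (t : R) : R :=
  \sum_(k < size p) p`_k * w (t - k%:R * d).

Definition irop (h0 : R) (h w : R -> R) (t : R) : R := h0 * w t + cnv h w t.

Lemma sqi_dly p d w : sqi w -> sqi (dly p d w).
Proof. by move=> sw; apply: sqi_sum => k; apply: sqiZ; exact: sqi_shift. Qed.

Lemma nrm_dly p d w : sqi w -> nrm (dly p d w) <= pl1 p * nrm w.
Proof.
move=> sw; have sk (k : 'I_(size p)) : sqi (fun t => p`_k * w (t - k%:R * d)).
  by apply: sqiZ; exact: sqi_shift.
apply: le_trans (nrm_sum _ sk) _; rewrite /pl1 mulr_suml; apply: ler_sum => k _.
by rewrite (nrmZ _ (sqi_shift _ sw)) nrm_shift.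
Qed.

Lemma dlyB p d w c t : dly p d (fun x => w x - c x) t = dly p d w t - dly p d c t.
Proof. by rewrite /dly -sumrB; apply: eq_bigr => k _; rewrite mulrBr. Qed.

Lemma dly_norm_le p d w B t : (forall x, `|w x| <= B) -> `|dly p d w t| <= pl1 p * B.
Proof.
move=> wB; apply: le_trans (ler_norm_sum _ _ _) _; rewrite /pl1 mulr_suml.
by apply: ler_sum => k _; rewrite normrM ler_wpM2l.
Qed.

Lemma sqi_irop h0 h w : intg h -> sqi w -> sqi (irop h0 h w).
Proof. by move=> ih sw; have [sc _ _] := young2 ih sw; apply: sqiD => //; exact: sqiZ. Qed.

Lemma nrm_irop h0 h w : intg h -> sqi w ->
  nrm (irop h0 h w) <= (`|h0| + itg (fun t => `|h t|)) * nrm w.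
Proof.
move=> ih sw; have [sc nc _] := young2 ih sw.
apply: le_trans (nrmD (sqiZ h0 sw) sc) _; rewrite (nrmZ _ sw) mulrDl.
by rewrite lerD2l.
Qed.

Lemma iropB h0 h w c : intg h -> sqi w -> sqi c ->
  {ae mu, forall t, irop h0 h (fun x => w x - c x) t = irop h0 h w t - irop h0 h c t}.
Proof.
move=> ih sw sc; have [_ _ aw] := young2 ih sw; have [_ _ ac] := young2 ih sc.
apply: aeS2 aw ac => t iw ic; rewrite /irop /cnv.
have -> : itg (fun x => h x * (w (t - x) - c (t - x))) =
   itg (fun x => h x * w (t - x)) - itg (fun x => h x * c (t - x)).
  by rewrite -itgB //; apply: itg_eq => x; rewrite mulrBr.
ring.
Qed.

Lemma irop_norm_le (h0 B t : R) (h w : R -> R) : intg h -> measurable_fun setT w -> (forall x, `|w x| <= B) ->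
  `|irop h0 h w t| <= (`|h0| + itg (fun t => `|h t|)) * B.
Proof.
move=> ih mw wB; rewrite /irop mulrDl; apply: le_trans (ler_normD _ _) _.
apply: lerD; first by rewrite normrM ler_wpM2l.
rewrite mulrC -(itgZ _ (intg_norm ih)).
apply: itg_norm_le; [|by apply: intgZ; exact: intg_norm|].
  apply: (@intgM_bdd _ _ _ B ih) => [|x]; last exact: wB.
  by apply: (measurableT_comp mw); exact: measurable_funB.
by move=> x; rewrite normrM mulrC ler_wpM2r.
Qed.

(** Half-open, so that truncated signals vanish on [t <= 0], as do the continuous approximants
    supplied by [sqi_dense]. *)
Definition obox (T t : R) : R := (0 < t <= T)%R%:R.

Lemma measurable_obox T : measurable_fun setT (obox T).
Proof.
have -> : obox T = \1_(`]0, T]%classic : set R).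
  by apply/funext => t; rewrite indicE mem_setE.
exact: measurable_indic.
Qed.

Lemma obox_norm_le T t x : `|obox T t * x| <= `|x|.
Proof. by rewrite /obox; case: (_ < _ <= _); rewrite ?mul1r // mul0r normr0. Qed.

Lemma sqi_obox T f : sqi f -> sqi (fun t => obox T t * f t).
Proof.
move=> sf; have mf : measurable_fun setT f by have [] := sf.
apply: sqi_le sf; last by move=> t; exact: obox_norm_le.
by apply: measurable_funM; [exact: measurable_obox|exact: mf].
Qed.

Lemma nrm_obox T f : sqi f -> nrm (fun t => obox T t * f t) <= nrm f.
Proof.
by move=> sf; apply: nrm_le; [exact: sqi_obox|exact: sf|move=> t; exact: obox_norm_le].
Qed.

(** At fixed [t], [dly (E j) (d j) c t] is the functional [E j] applied to u -> c (t - u),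
    continuous and zero for u >= t: weak convergence gives pointwise convergence, and the uniform
    bound [C] makes it L2 convergence on the bounded interval. *)
Lemma dly_cvg_bounded (h : R -> R) (h0 M B T : R) (E : nat -> {poly R}) (d : nat -> R) (c : R -> R) :
  intg h -> (forall j, pl1 (E j) <= M) ->
  (forall (v : R -> R) (S : R), continuous v -> (forall t, S <= t -> v t = 0) ->
    \sum_(k < size (E j)) (E j)`_k * v (k%:R * d j) @[j --> \oo] --> h0 * v 0 + itg (fun t => h t * v t)) ->
  continuous c -> (forall t, t <= 0 -> c t = 0) -> (forall t, `|c t| <= B) -> sqi c ->
  itg (fun t => (obox T t * (dly (E j) (d j) c t - irop h0 h c t)) ^+ 2) @[j --> \oo] --> 0.
Proof.
move=> ih EM Hw cc c0 cB sc.
have mc : measurable_fun setT c by have [] := sc.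
have B0 : 0 <= B by apply: le_trans (cB 0); exact: normr_ge0.
pose C := M * B + (`|h0| + itg (fun t => `|h t|)) * B.
have sj j : sqi (fun t => obox T t * (dly (E j) (d j) c t - irop h0 h c t)).
  by apply: sqi_obox; apply: sqiB; [exact: sqi_dly|exact: sqi_irop].
have bb t : box 0 T t ^+ 2 = box 0 T t.
  by rewrite /box; case: (_ <= _ <= _); rewrite ?expr1n ?expr0n.
have ob t : 0 <= obox T t <= box 0 T t.
  rewrite /obox /box; case: (boolP (0 < t <= T)) => [/andP[t0 tT]|_]; last by rewrite lexx ler0n.
  by rewrite (ltW t0) tT ler01 lexx.
have CB j t : `|dly (E j) (d j) c t - irop h0 h c t| <= C.
  apply: le_trans (ler_normB _ _) _; apply: lerD; last exact: irop_norm_le.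
  by apply: le_trans (dly_norm_le _ _ _ cB) _; rewrite ler_wpM2r.
have C0 : 0 <= C by apply: le_trans (CB 0%N 0); exact: normr_ge0.
have [||||_ H] := @itg_dct R (fun j t => (obox T t * (dly (E j) (d j) c t - irop h0 h c t)) ^+ 2)
  (fun=> 0) (fun t => C ^+ 2 * box 0 T t) _ _ _ (intgZ _ (intg_box 0 T)).
- by move=> j; apply: intg_meas; have [] := sj j.
- exact: measurable_cst.
- move=> t; have cv : continuous (fun u : R => c (t - u)).
    move=> u; apply: (@cvg_comp _ _ _ (fun u : R => t - u) c _ (nbhs (t - u))); last exact: cc.
    by apply: cvgB; [exact: cvg_cst|exact: cvg_id].
  have v0 u : t <= u -> c (t - u) = 0 by move=> tu; rewrite c0 // subr_le0.
  have := Hw _ _ cv v0; rewrite subr0 -/(cnv h c t) -/(irop h0 h c t) => hj.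
  have h1 : dly (E j) (d j) c t - irop h0 h c t @[j --> \oo] --> 0.
    by rewrite -(subrr (irop h0 h c t)); apply: cvgB; [exact: hj|exact: cvg_cst].
  have h2 : obox T t * (dly (E j) (d j) c t - irop h0 h c t) @[j --> \oo] --> 0.
    by rewrite -[X in _ --> X](mulr0 (obox T t)); apply: cvgM; [exact: cvg_cst|exact: h1].
  by rewrite -[X in _ --> X](mulr0 (0 : R)); under eq_fun do rewrite expr2; apply: cvgM; exact: h2.
- move=> j t; rewrite normrX -bb -exprMn ler_pXn2r ?nnegrE ?mulr_ge0 ?box_ge0 //.
  have /andP[q0 q1] := ob t; rewrite normrM (ger0_norm q0) mulrC.
  by apply: ler_pM => //; exact: CB.
by rewrite itg0 in H.
Qed.

(** Convergence on the dense class of [sqi_dense], together with bounds on the norms of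
    [dly (E j) (d j)] and [irop h0 h] that do not depend on [j]. *)
Lemma dly_cvg (h : R -> R) (h0 M T : R) (E : nat -> {poly R}) (d : nat -> R) (w : R -> R) :
  0 < T -> intg h -> (forall j, pl1 (E j) <= M) ->
  (forall (v : R -> R) (S : R), continuous v -> (forall t, S <= t -> v t = 0) ->
    \sum_(k < size (E j)) (E j)`_k * v (k%:R * d j) @[j --> \oo] --> h0 * v 0 + itg (fun t => h t * v t)) ->
  sqi w -> (forall t, ~~ (0 < t <= T) -> w t = 0) ->
  nrm (fun t => obox T t * (dly (E j) (d j) w t - irop h0 h w t)) @[j --> \oo] --> 0.
Proof.
move=> T0 ih EM Hw sw w0; apply/cvgrPdist_le => e e0.
have M0 : 0 <= M by apply: le_trans (EM 0%N); exact: pl1_ge0.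
pose C := M + (`|h0| + itg (fun t => `|h t|)) + 1.
have h00 : 0 <= `|h0| + itg (fun t => `|h t|) by rewrite addr_ge0 // itg_ge0.
have C0 : 0 < C by rewrite /C; lra.
have e1 : 0 < e / 2 / C by rewrite !divr_gt0.
have [c [B [cc c0 cB sc nc]]] := sqi_dense T0 e1 sw w0.
have e2 : 0 < (e / 2) ^+ 2 by rewrite exprn_gt0 // divr_gt0.
have /cvgrPdist_le/(_ _ e2)[N _ HN] := dly_cvg_bounded T ih EM Hw cc c0 cB sc.
exists N => // j Nj; rewrite sub0r normrN ger0_norm ?nrm_ge0 //.
have {HN}Hc : nrm (fun t => obox T t * (dly (E j) (d j) c t - irop h0 h c t)) <= e / 2.
  rewrite -ler_sqr ?nnegrE ?nrm_ge0 ?divr_ge0 ?(ltW e0) // sqr_nrm.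
  by have := HN j Nj; rewrite sub0r normrN => /(le_trans (ler_norm _)).
have swc := sqiB sw sc.
pose A (f : R -> R) t := dly (E j) (d j) f t - irop h0 h f t.
have sA f : sqi f -> sqi (A f) by move=> sf; apply: sqiB; [exact: sqi_dly|exact: sqi_irop].
have nA : nrm (A (fun t => w t - c t)) <= e / 2.
  apply: (@le_trans _ _ (C * nrm (fun t => w t - c t))).
    apply: (@le_trans _ _ ((M + (`|h0| + itg (fun t => `|h t|))) * nrm (fun t => w t - c t))); last first.
      by rewrite ler_wpM2r ?nrm_ge0 // lerDl.
    rewrite mulrDl; apply: le_trans (nrmD (sqi_dly _ _ swc) (sqiN (sqi_irop h0 ih swc))) _.
    apply: lerD.
      by apply: le_trans (nrm_dly _ _ swc) _; rewrite ler_wpM2r ?nrm_ge0.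
    have -> : nrm (fun t => - irop h0 h (fun t => w t - c t) t) = nrm (irop h0 h (fun t => w t - c t)).
      by congr Num.sqrt; apply: itg_eq => t; rewrite sqrrN.
    exact: nrm_irop.
  by rewrite mulrC -ler_pdivlMr.
have E1 : nrm (fun t => obox T t * A w t) =
    nrm (fun t => obox T t * A c t + obox T t * A (fun t => w t - c t) t).
  apply: nrm_ae; first by apply: sqi_obox; exact: sA.
    by apply: sqiD; apply: sqi_obox; exact: sA.
  apply: aeS (iropB h0 ih sw sc) => t Ht; rewrite /A dlyB Ht; ring.
rewrite E1; apply: le_trans (nrmD (sqi_obox T (sA _ sc)) (sqi_obox T (sA _ swc))) _.
rewrite [leRHS](splitr e); apply: lerD; first exact: Hc.
by apply: le_trans nA; apply: nrm_obox; exact: sA.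
Qed.

End delay_operators.

(** * The transform of the fractional response on the real axis *)

Section fractional_impulse_response.
Context {R : realType}.
Notation mu := (@lebesgue_measure R).

Lemma cpow_real (s al : R) : 0 < s -> cpow s%:C al = (s `^ al)%:C.
Proof.
move=> s0; have ns : ComplexField.Normc.normc s%:C = s.
  by rewrite /= expr0n addr0 sqrtr_sqr gtr0_norm.
have E : carg s%:C = 0 by rewrite /carg ns /= lexx divff ?gt_eqF // acos1.
by rewrite /cpow ns E mulr0 cos0 sin0 mulr1.
Qed.

(** On the positive axis the principal power is the real power. The point s^al may lie to the left
    of the half-plane on which [g] is given as an inverse transform of G, and [ratfun_transform]
    covers that case. *)
Lemma fractional_transform (G : ratfun R) (g h : impulse R) (al : R) :
  impulse_response (rf_eval G) g -> ir_L1 g ->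
  impulse_response (fun s : R[i] => rf_eval G (cpow s al)) h ->
  exists s0 : R, [/\ 0 < s0, intg (fun t => ir_fun h t * expR (- (s0 * t))) &
    forall s, s0 <= s -> ir_dirac g + lapc (ir_fun g) (s `^ al) 0 =
      ir_dirac h + itg (fun t => ir_fun h t * expR (- (s * t)))].
Proof.
move=> Gg gL [mh ch [sg Hs]].
pose s0 := Num.max sg 0 + 1.
have s00 : 0 < s0 by rewrite /s0 ltr_wpDl // le_max lexx orbT.
have sgs0 s : s0 <= s -> sg < s.
  by apply: lt_le_trans; rewrite /s0 (@le_lt_trans _ _ (Num.max sg 0)) ?le_max ?lexx // ltrDl.
have E (s : R) : s0 <= s -> ir_dirac g + lapc (ir_fun g) (s `^ al) 0 =
    ir_dirac h + itg (fun t => ir_fun h t * expR (- (s * t))).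
  move=> ss; have [_] := Hs s%:C (sgs0 _ ss).
  rewrite cpow_real ?(lt_le_trans s00 ss) // (ratfun_transform Gg gL) /= ?powR_ge0 //.
  rewrite (laplace_lap _ ch) /lap /= => -[H _]; rewrite H; congr (_ + _).
  by apply: itg_eq => t; rewrite mul0r cos0 mulr1.
exists s0; split => //.
have [H _] := Hs s0%:C (sgs0 _ (lexx _)).
have mI : measurable (`[0, +oo[%classic : set (measurableTypeR R)) by exact: measurable_itv.
have := (integrable_mkcond _ mI).1 H; apply: eq_integrable => // t _ /=.
rewrite patchE mem_setE in_itv /= andbT; have [t0|t0] := leP 0 t; first by rewrite mulrC mulNr.
by rewrite ch // mul0r.
Qed.

End fractional_impulse_response.

(** * The Zames-Falb estimate *)

Section fractional_operator.
Context {R : realType}.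
Notation mu := (@lebesgue_measure R).

Lemma ir_norm1_lt1 (z : impulse R) : ir_L1 z -> causal (ir_fun z) -> ir_nonneg z -> (ir_norm1 z < 1)%E ->
  ir_dirac z + itg (ir_fun z) < 1.
Proof.
move=> zL cz [z0 zz0]; rewrite /ir_norm1 (ger0_norm z0) => H.
have iz := intg_ir_fun zL.
rewrite -lte_fin EFinD -(intg_EFin iz); apply: le_lt_trans H; rewrite leeD2l //.
rewrite [leRHS]integral_mkcond /=.
rewrite le_eqVlt; apply/orP; left; apply/eqP; apply: eq_integral => t _.
rewrite patchE mem_setE in_itv /= andbT; have [t0|t0] := leP 0 t; first by rewrite ger0_norm.
by rewrite cz.
Qed.

Lemma fractional_operator (G Z : ratfun R) (g z h : impulse R) (eps al : R) :
  impulse_response (rf_eval G) g -> ir_L1 g ->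
  impulse_response (rf_eval Z) z -> ir_L1 z -> ir_nonneg z -> (ir_norm1 z < 1)%E ->
  0 < eps ->
  (forall w : R, eps <= complex.Re ((1 - rf_eval Z (0 +i* w)) * rf_eval G (0 +i* w))) ->
  0 < al < 1 ->
  impulse_response (fun s : R[i] => rf_eval G (cpow s al)) h ->
  intg (ir_fun h) /\
  exists (M : R) (E zeta : nat -> {poly R}),
  [/\ forall j, pl1 (E j) <= M,
    forall j, pnneg (zeta j) /\ pl1 (zeta j) <= 1,
    forall j (x : R[i]), `|x| = 1 ->
      eps / 2 <= complex.Re (map_poly (real_complex R) ((1 - zeta j) * E j)).[x] &
    forall (v : R -> R) (S : R), continuous v -> (forall t, S <= t -> v t = 0) ->
      \sum_(k < size (E j)) (E j)`_k * v (k%:R * j.+1%:R^-1) @[j --> \oo] -->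
        ir_dirac h * v 0 + itg (fun t => ir_fun h t * v t)].
Proof.
move=> Gg gL Zz zL znn z1 eps0 He al01 Hh.
have [mg cg _] := Gg; have [mz cz _] := Zz; have [mh ch _] := Hh.
have [z0 zz0] := znn; have ig := intg_ir_fun gL; have iz := intg_ir_fun zL.
have hp := multiplier_half_plane Gg gL Zz zL He.
have [s0 [s00 ih0 Hs]] := fractional_transform Gg gL Hh.
have [E [zeta [HE cE]]] := fractional_approximants ig cg iz cz z0 zz0 al01 eps0 hp s00.
pose M := `|ir_dirac g| + itg (fun t => `|ir_fun g t|).
have EM j : pl1 (E j) <= M by have [] := HE j.
have Hw (v : R -> R) (S : R) : continuous v -> (forall t, S <= t -> v t = 0) ->
      \sum_(k < size (E j)) (E j)`_k * v (k%:R * j.+1%:R^-1) @[j --> \oo] -->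
        ir_dirac h * v 0 + itg (fun t => ir_fun h t * v t).
  move=> cv vS; apply: (@laplace_weak _ _ _ M s0 E (fun j => j.+1%:R^-1) v S) => //.
  - exact: ltW.
  - by move=> n; rewrite -Hs ?lerDl //; apply: cE; rewrite lerDl.
(* The limit functional, bounded by [M] on test functions of sup norm at most 1, includes the Dirac
   term; removing it costs [|ir_dirac h|]. *)
have [ih _] : intg (ir_fun h) /\ itg (fun t => `|ir_fun h t|) <= M + `|ir_dirac h|.
  apply: (@intg_of_test _ _ s0) => // [|v S cv vS v1]; first exact: ltW.
  have H : ir_dirac h * v 0 + itg (fun t => ir_fun h t * v t) <= M.
    apply: (cvgr_to_le (Hw v S cv vS)); apply: nearW => j.
    apply: le_trans (ler_norm _) _; apply: le_trans (ler_norm_sum _ _ _) _.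
    apply: le_trans (EM j); apply: ler_sum => k _.
    by rewrite normrM ler_piMr.
  have H0 : `|ir_dirac h * v 0| <= `|ir_dirac h| by rewrite normrM ler_piMr.
  have := ler_norm (- (ir_dirac h * v 0)); rewrite normrN; lra.
split=> //; exists M, E, zeta; split => //.
- move=> j; have [_ h1 h2 _] := HE j; split => //; apply: le_trans h2 _.
  by apply: ltW; exact: ir_norm1_lt1.
- by move=> j; have [] := HE j.
Qed.

End fractional_operator.

(** * The convex primitive of a monotone nonlinearity *)

Section monotone_nonlinearity.
Context {R : realType}.
Notation mu := (@lebesgue_measure R).
Variables (Phi : R -> R) (C : R).
Hypotheses (Phi0 : Phi 0 = 0) (PhiC : forall r, `|Phi r| <= C * `|r|).
Hypothesis Phi_mono : forall r s, 0 <= (r - s) * (Phi r - Phi s).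

Lemma Phi_homo r s : r <= s -> Phi r <= Phi s.
Proof.
rewrite le_eqVlt => /predU1P[->//|rs]; have := Phi_mono r s.
by rewrite nmulr_rge0 ?subr_lt0 // subr_le0.
Qed.

Lemma measurable_Phi : measurable_fun setT Phi.
Proof. by apply: nondecreasing_measurable => //; exact: Phi_homo. Qed.

Lemma Phi_bound_ge0 : 0 <= C.
Proof. by have := PhiC 1; rewrite normr1 mulr1; apply: le_trans. Qed.

Lemma sqi_Phi x : sqi x -> sqi (fun t => Phi (x t)).
Proof.
move=> sx; have [mx _] := sx; apply: (@sqi_le _ _ (fun t => C * x t)); last exact: sqiZ.
  exact: (measurableT_comp measurable_Phi mx).
by move=> t; rewrite [leRHS]normrM (ger0_norm Phi_bound_ge0).
Qed.

Let step (a s : R) : R := (s <= a)%R%:R.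

Let step_lt (a b : R) : b <= a -> (fun s => step a s - step b s) = \1_(`]b, a]%classic : set R).
Proof.
move=> ba; apply/funext => s; rewrite indicE mem_setE in_itv /= /step.
have [sb|sb] := leP s b; first by rewrite (le_trans sb ba) subrr.
by rewrite subr0.
Qed.

Let step_diff_le (a b : R) : b <= a ->
  intg (fun s => step a s - step b s) /\ itg (fun s => step a s - step b s) = a - b.
Proof.
move=> ba; rewrite step_lt //; split; first exact: integrable_indic_itv.
have E : mu `]b, a]%classic = (a - b)%:E.
  by rewrite lebesgue_measure_itv /= lte_fin; case: ltgtP ba => // -> _; rewrite subrr.
by rewrite /itg /Rintegral integral_indic // setIT [X in fine X]E.
Qed.

Let step_diff (a b : R) :
  intg (fun s => step a s - step b s) /\ itg (fun s => step a s - step b s) = a - b.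
Proof.
have [ba|/ltW ab] := leP b a; first exact: step_diff_le.
have [h1 h2] := step_diff_le ab; split.
  by apply: intg_eq (intgN h1) => s; rewrite opprB.
rewrite -[RHS]opprB -h2 -mulN1r -itgZ //; apply: itg_eq => s; ring.
Qed.

Let intg_step_Phi (a b : R) : intg (fun s => Phi s * (step a s - step b s)).
Proof.
have [h1 _] := step_diff a b.
apply: (@intg_le _ _ (fun s => C * (`|a| + `|b|) * `|step a s - step b s|)).
- by apply: measurable_funM; [exact: measurable_Phi|exact: intg_meas h1].
- move=> s; rewrite normrM.
  have key : b < s <= a \/ a < s <= b -> `|Phi s| <= C * (`|a| + `|b|).
    move=> H; apply: le_trans (PhiC s) _; rewrite ler_wpM2l ?Phi_bound_ge0 //.
    have n1 := ler_norm a; have n2 := ler_norm b.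
    have n3 := ler_norm (- a); have n4 := ler_norm (- b); rewrite !normrN in n3 n4.
    have p1 := normr_ge0 a; have p2 := normr_ge0 b.
    by rewrite ler_norml; case: H => /andP[? ?]; apply/andP; split; lra.
  rewrite /step; have [sa|sa] := leP s a; have [sb|sb] := leP s b.
  + by rewrite subrr normr0 !mulr0.
  + by rewrite subr0 ler_wpM2r // key // sb sa; left.
  + by rewrite ler_wpM2r // key // sb sa; right.
  + by rewrite subrr normr0 !mulr0.
- by apply: intgZ; exact: intg_norm.
Qed.

(** The oriented integral of Phi from 0 to [a]: the difference of steps is 1 on ]0, a] or -1 on ]a,
    0], so both signs of [a] share one formula. *)
Definition Phi_primitive (a : R) : R := itg (fun s => Phi s * (step a s - step 0 s)).

(** Between [a] and [b] the signed indicator times Phi(s) - Phi(a) is never positive, by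
    monotonicity. No derivative of the primitive is taken, and Phi may jump. *)
Lemma Phi_subgradient a b : Phi_primitive a - Phi_primitive b <= Phi a * (a - b).
Proof.
have [h1 h2] := step_diff a b.
rewrite -h2 -(itgZ _ h1) /Phi_primitive -(itgB (intg_step_Phi a 0) (intg_step_Phi b 0)).
apply: itg_le; [by apply: intgB; exact: intg_step_Phi|exact: intgZ|] => s.
rewrite -mulrBr opprB addrA subrK /step.
have [sa|sa] := leP s a; have [sb|sb] := leP s b.
- by rewrite subrr !mulr0.
- by rewrite subr0 !mulr1 Phi_homo.
- by rewrite sub0r !mulrN1 lerN2 Phi_homo // ltW.
- by rewrite subrr !mulr0.
Qed.

Lemma Phi_primitive0 : Phi_primitive 0 = 0.
Proof. by rewrite /Phi_primitive -[RHS](@itg0 R); apply: itg_eq => s; rewrite subrr mulr0. Qed.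

Lemma Phi_primitive_bounds a : 0 <= Phi_primitive a <= C * a ^+ 2.
Proof.
have := Phi_subgradient a 0; have := Phi_subgradient 0 a.
rewrite Phi_primitive0 Phi0 mul0r !subr0 sub0r oppr_le0 => -> /= h.
apply: le_trans h _; apply: le_trans (ler_norm _) _.
by rewrite normrM -(real_normK (num_real a)) expr2 mulrA ler_wpM2r.
Qed.

(** The subgradient inequality, used in both directions, squeezes the increments. Continuity makes
    the primitive of a measurable signal measurable. *)
Lemma continuous_Phi_primitive : continuous Phi_primitive.
Proof.
move=> b; apply/subr_cvg0.
pose k (a : R) := C * (`|a| + `|b|) * `|a - b|.
have ck : k a @[a --> b] --> 0.
  have h0 : a - b @[a --> b] --> b - b by apply: cvgB; [exact: cvg_id|exact: cvg_cst].
  have h1 : `|a - b| @[a --> b] --> `|b - b| by apply: cvg_norm; exact: h0.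
  rewrite subrr normr0 in h1.
  have h2 : C * (`|a| + `|b|) @[a --> b] --> C * (`|b| + `|b|).
    apply: cvgM; first exact: cvg_cst.
    by apply: cvgD; [apply: cvg_norm; exact: cvg_id|exact: cvg_cst].
  have h3 := cvgM h2 h1; rewrite mulr0 in h3; exact: h3.
have ckN : - k a @[a --> b] --> 0 by rewrite -oppr0; exact: cvgN.
apply: (@squeeze_cvgr _ _ _ _ (fun a => - k a) k); [|exact: ckN|exact: ck].
have bound a c : Phi a * (a - c) <= C * (`|a| + `|c|) * `|a - c|.
  apply: le_trans (ler_norm _) _; rewrite normrM ler_wpM2r //.
  by apply: le_trans (PhiC a) _; rewrite ler_wpM2l ?Phi_bound_ge0 // lerDl.
apply: nearW => a; have h1 := Phi_subgradient a b; have h2 := Phi_subgradient b a.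
have h3 := bound a b; have h4 := bound b a.
rewrite distrC (addrC `|b|) -/(k a) in h4.
apply/andP; split; rewrite -?/(k a) in h3 *; lra.
Qed.

Lemma intg_Phi_primitive x : sqi x -> intg (fun t => Phi_primitive (x t)).
Proof.
move=> sx; have [mx ix] := sx; apply: (@intg_le _ _ (fun t => C * x t ^+ 2)); last exact: intgZ.
  by apply: (measurableT_comp _ mx); apply: continuous_measurable_fun; exact: continuous_Phi_primitive.
by move=> t; have /andP[p0 p1] := Phi_primitive_bounds (x t); rewrite ger0_norm.
Qed.

(* The convex primitive of Phi has the same integral along x and its translate. *)
Lemma monotone_shift_ge0 (x : R -> R) (c : R) : sqi x ->
  0 <= itg (fun t => Phi (x t) * (x t - x (t - c))).
Proof.
move=> sx; have ip := intg_Phi_primitive sx.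
have ips := intg_shift c ip.
have -> : 0 = itg (fun t => Phi_primitive (x t) - Phi_primitive (x (t - c))).
  by rewrite (itgB ip ips) (itg_shift c ip) subrr.
apply: itg_le; [exact: intgB|by apply: sqiM; [exact: sqi_Phi|apply: sqiB => //; exact: sqi_shift]|].
by move=> t; exact: Phi_subgradient.
Qed.

(** Each delayed pairing [b k] is at most the undelayed one [a]; nonnegative weights of sum at most
    1 preserve this because [a >= 0]. *)
Lemma monotone_delay_ge0 (x : R -> R) (p : {poly R}) (d : R) : sqi x -> pnneg p -> pl1 p <= 1 ->
  0 <= itg (fun t => Phi (x t) * (x t - dly p d x t)).
Proof.
move=> sx p0 p1; have sP := sqi_Phi sx.
pose a := itg (fun t => Phi (x t) * x t); have ia := sqiM sP sx.
pose b (k : nat) := itg (fun t => Phi (x t) * x (t - k%:R * d)).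
have ib (k : nat) := sqiM sP (sqi_shift (k%:R * d) sx).
have a0 : 0 <= a.
  apply: itg_ge0 => t; have := Phi_mono (x t) 0; by rewrite Phi0 !subr0 mulrC.
have ab k : b k <= a.
  rewrite -subr_ge0 /a /b -(itgB ia (ib k)); apply: le_trans (monotone_shift_ge0 (k%:R * d) sx) _.
  by rewrite le_eqVlt; apply/orP; left; apply/eqP/itg_eq => t; rewrite mulrBr.
have -> : itg (fun t => Phi (x t) * (x t - dly p d x t)) = a - \sum_(k < size p) p`_k * b k.
  have -> : \sum_(k < size p) p`_k * b k =
      itg (fun t => \sum_(k < size p) p`_k * (Phi (x t) * x (t - k%:R * d))).
    rewrite (itg_sum _ (fun k : 'I_(size p) => intgZ (p`_k) (ib k))).
    by apply: eq_bigr => k _; rewrite (itgZ _ (ib k)).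
  rewrite -(itgB ia (intg_sum _ (fun k : 'I_(size p) => intgZ (p`_k) (ib k)))).
  apply: itg_eq => t; rewrite mulrBr /dly mulr_sumr; congr (_ - _).
  by apply: eq_bigr => k _; rewrite mulrCA.
rewrite subr_ge0; apply: (@le_trans _ _ (pl1 p * a)); last by rewrite ler_piMl.
rewrite /pl1 mulr_suml; apply: ler_sum => k _.
by rewrite (ger0_norm (p0 k)) ler_wpM2l.
Qed.

End monotone_nonlinearity.

(** * Pairing polynomials with sequences *)

Section polynomial_pairing.
Context {R : realType}.
Implicit Types (p q : {poly R}) (a : nat -> R).

(** The linear functional that sends X^k to [a k]. With autocorrelations for [a] it computes
    quadratic forms of delay operators, and [pevM] treats composed delays. *)
Definition pev a p : R := \sum_(k < size p) p`_k * a k.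

Lemma pev_widen a p n : (size p <= n)%N -> pev a p = \sum_(k < n) p`_k * a k.
Proof.
move=> pn; rewrite /pev (big_ord_widen n (fun k => p`_k * a k) pn) big_mkcond /=.
apply: eq_bigr => i _; case: ltnP => // h.
by rewrite nth_default // mul0r.
Qed.

Lemma pevD a p q : pev a (p + q) = pev a p + pev a q.
Proof.
pose n := maxn (size p) (size q).
rewrite (@pev_widen a (p + q) n) ?size_polyD // (@pev_widen a p n) ?leq_maxl //.
rewrite (@pev_widen a q n) ?leq_maxr // -big_split /=; apply: eq_bigr => i _.
by rewrite coefD mulrDl.
Qed.

Lemma pevZ a c p : pev a (c *: p) = c * pev a p.
Proof.
rewrite (@pev_widen a (c *: p) (size p)) ?size_scale_leq // /pev mulr_sumr.
by apply: eq_bigr => i _; rewrite coefZ mulrA.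
Qed.

Lemma pevB a p q : pev a (p - q) = pev a p - pev a q.
Proof. by rewrite pevD -scaleN1r pevZ mulN1r. Qed.

Lemma pev_sum a n (F : nat -> {poly R}) : pev a (\sum_(i < n) F i) = \sum_(i < n) pev a (F i).
Proof.
elim: n => [|n IH]; first by rewrite !big_ord0 /pev size_poly0 big_ord0.
by rewrite !big_ord_recr /= pevD IH.
Qed.

Lemma pev_XnM a n p : pev a ('X^n * p) = pev (fun k => a (n + k)%N) p.
Proof.
rewrite (@pev_widen a ('X^n * p) (n + size p)); last first.
  by apply: leq_trans (size_polyMleq _ _) _; rewrite size_polyXn.
rewrite big_split_ord /= big1 ?add0r => [|i _]; last by rewrite coefXnM ltn_ord mul0r.
by apply: eq_bigr => i _; rewrite coefXnM ltnNge leq_addr /= addKn.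
Qed.

Lemma pevM a p q : pev a (p * q) = pev (fun i => pev (fun j => a (i + j)%N) q) p.
Proof.
rewrite -{1}[p]coefK poly_def mulr_suml (pev_sum a _ (fun i => p`_i *: 'X^i * q)).
by apply: eq_bigr => i _; rewrite -scalerAl pevZ pev_XnM.
Qed.

End polynomial_pairing.

(** * Coercivity of the multiplier and the loop estimate *)

Section multiplier_estimate.
Context {R : realType}.
Notation mu := (@lebesgue_measure R).

(** The L2 adjoint of [dly], which advances instead of delaying. *)
Definition adv (p : {poly R}) (d : R) (w : R -> R) (t : R) : R :=
  \sum_(k < size p) p`_k * w (t + k%:R * d).

Lemma adv_dly p d w : adv p d w =1 dly p (- d) w.
Proof. by move=> t; apply: eq_bigr => k _; rewrite mulrN opprK. Qed.

Lemma sqi_adv p d w : sqi w -> sqi (adv p d w).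
Proof. by move=> sw; have -> : adv p d w = dly p (- d) w; [apply/funext; exact: adv_dly|exact: sqi_dly]. Qed.

Lemma nrm_adv p d w : sqi w -> nrm (adv p d w) <= pl1 p * nrm w.
Proof. by move=> sw; have -> : adv p d w = dly p (- d) w; [apply/funext; exact: adv_dly|exact: nrm_dly]. Qed.

Lemma dly_adjoint p d w x : sqi w -> sqi x ->
  itg (fun t => w t * dly p d x t) = itg (fun t => x t * adv p d w t).
Proof.
move=> sw sx; have i1 (k : nat) := sqiM sw (sqi_shift (k%:R * d) sx).
have i2 (k : nat) : intg (fun t => x t * w (t + k%:R * d)).
  by apply: intg_eq (sqiM sx (sqi_shift (- (k%:R * d)) sw)) => t; rewrite opprK.
transitivity (itg (fun t => \sum_(k < size p) p`_k * (w t * x (t - k%:R * d)))).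
  by apply: itg_eq => t; rewrite mulr_sumr; apply: eq_bigr => k _; rewrite mulrCA.
transitivity (itg (fun t => \sum_(k < size p) p`_k * (x t * w (t + k%:R * d)))); last first.
  by apply: itg_eq => t; rewrite mulr_sumr; apply: eq_bigr => k _; rewrite mulrCA.
rewrite (itg_sum _ (fun k : 'I_(size p) => intgZ (p`_k) (i1 k))).
rewrite (itg_sum _ (fun k : 'I_(size p) => intgZ (p`_k) (i2 k))).
apply: eq_bigr => k _; rewrite (itgZ _ (i1 k)) (itgZ _ (i2 k)); congr (_ * _).
rewrite -(itg_shift (k%:R * d) (i2 k)); apply: itg_eq => t.
by rewrite subrK mulrC.
Qed.

Lemma itg_dly (p : {poly R}) (d : R) (w f : R -> R) : sqi w -> sqi f ->
  itg (fun t => f t * dly p d w t) = pev (fun n => itg (fun t => f t * w (t - n%:R * d))) p.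
Proof.
move=> sw sf; have i1 (k : nat) := sqiM sf (sqi_shift (k%:R * d) sw).
rewrite /pev; transitivity (itg (fun t => \sum_(k < size p) p`_k * (f t * w (t - k%:R * d)))).
  by apply: itg_eq => t; rewrite mulr_sumr; apply: eq_bigr => k _; rewrite mulrCA.
rewrite (itg_sum _ (fun k : 'I_(size p) => intgZ (p`_k) (i1 k))).
by apply: eq_bigr => k _; rewrite (itgZ _ (i1 k)).
Qed.

(** Moving [zeta] across the pairing by adjunction turns the right-hand side into the
    autocorrelation sum of (1 - zeta) E, to which [autocorrelation_ge] applies. *)
Lemma multiplier_pairing (E zeta : {poly R}) (d e : R) (w : R -> R) : sqi w ->
  (forall x : R[i], `|x| = 1 ->
     e <= complex.Re (map_poly (real_complex R) ((1 - zeta) * E)).[x]) ->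
  e * nrm w ^+ 2 <= itg (fun t => dly E d w t * (w t - adv zeta d w t)).
Proof.
move=> sw He; rewrite sqr_nrm; apply: le_trans (autocorrelation_ge d He sw) _.
pose c (n : nat) := itg (fun t => w t * w (t - n%:R * d)).
rewrite -/(pev c ((1 - zeta) * E)) mulrBl mul1r pevB pevM.
have sE := sqi_dly E d sw; have sa := sqi_adv zeta d sw.
have -> : itg (fun t => dly E d w t * (w t - adv zeta d w t)) =
   itg (fun t => w t * dly E d w t) - itg (fun t => dly E d w t * adv zeta d w t).
  rewrite -(itgB (sqiM sw sE) (sqiM sE sa)); apply: itg_eq => t; ring.
rewrite (itg_dly _ _ sw sw) -(dly_adjoint _ _ sw sE) (itg_dly _ _ sE sw).
rewrite le_eqVlt; apply/orP; left; apply/eqP; congr (_ - _).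
apply: eq_bigr => i _; congr (_ * _).
have swi := sqi_shift (i%:R * d) sw.
rewrite -[RHS]/(itg (fun t => w t * dly E d w (t - i%:R * d))).
transitivity (itg (fun t => w t * dly E d (fun s => w (s - i%:R * d)) t)).
  rewrite (itg_dly _ _ swi sw); apply: eq_bigr => k _; congr (_ * _).
  by apply: itg_eq => t; congr (_ * w _); rewrite natrD; ring.
by apply: itg_eq => t; congr (_ * _); apply: eq_bigr => k _; congr (_ * w _); ring.
Qed.

(* Over ]0, T] the loop signals satisfy w = Phi(x), x = r - A w; testing x against
   w - zeta * w bounds ||w|| by ||r||, uniformly in T. *)
Lemma loop_estimate (Phi : R -> R) (C e T h0 M : R) (h x r : R -> R) (E zeta : nat -> {poly R})
    (d : nat -> R) :
  Phi 0 = 0 -> (forall s, `|Phi s| <= C * `|s|) ->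
  (forall s t, 0 <= (s - t) * (Phi s - Phi t)) ->
  0 < T -> 0 < e -> (forall j, 0 <= d j) -> intg h ->
  (forall j, pl1 (E j) <= M) -> (forall j, pnneg (zeta j) /\ pl1 (zeta j) <= 1) ->
  (forall j (s : R[i]), `|s| = 1 ->
     e <= complex.Re (map_poly (real_complex R) ((1 - zeta j) * E j)).[s]) ->
  (forall (v : R -> R) (S : R), continuous v -> (forall t, S <= t -> v t = 0) ->
    \sum_(k < size (E j)) (E j)`_k * v (k%:R * d j) @[j --> \oo] --> h0 * v 0 + itg (fun t => h t * v t)) ->
  sqi x -> sqi r -> (forall t, ~~ (0 < t <= T) -> x t = 0) ->
  {ae mu, forall t, x t = obox T t * (r t - irop h0 h (fun s => Phi (x s)) t)} ->
  e * nrm (fun t => Phi (x t)) <= 2 * nrm r.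
Proof.
move=> P0 PC Pm T0 e0 d0 ih EM Hz He Hw sx sr x0 Hx.
pose w t := Phi (x t); have sw : sqi w by exact: (sqi_Phi PC Pm sx).
have w0 t : ~~ (0 < t <= T) -> w t = 0 by move=> h'; rewrite /w x0.
pose D j t := obox T t * (dly (E j) (d j) w t - irop h0 h w t).
have Dc : nrm (D j) @[j --> \oo] --> 0 by exact: (dly_cvg T0 ih EM Hw sw w0).
have sD j : sqi (D j) by apply: sqi_obox; apply: sqiB; [exact: sqi_dly|exact: sqi_irop].
have key j : e * nrm w ^+ 2 <= 2 * nrm w * (nrm r + nrm (D j)).
  pose V t := w t - adv (zeta j) (d j) w t.
  have [z0 z1] := Hz j.
  have sa := sqi_adv (zeta j) (d j) sw.
  have sV : sqi V by exact: sqiB.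
  have nV : nrm V <= 2 * nrm w.
    apply: le_trans (nrmD sw (sqiN sa)) _; rewrite mulrDl mul1r lerD2l.
    have -> : nrm (fun t => - adv (zeta j) (d j) w t) = nrm (adv (zeta j) (d j) w).
      by congr Num.sqrt; apply: itg_eq => t; rewrite sqrrN.
    by apply: le_trans (nrm_adv _ _ sw) _; rewrite ler_piMl ?nrm_ge0.
  (* Advances keep [V] zero after [T], and delays keep the image of [w] under [E j] zero up to time
     0 ([A0]); the truncation to ]0, T] is therefore invisible in their pairing. *)
  have VT t : T < t -> V t = 0.
    move=> tT; rewrite /V w0; last by rewrite negb_and -!ltNge tT orbT.
    rewrite sub0r /adv big1 ?oppr0 // => k _.
    rewrite w0 ?mulr0 // negb_and -!ltNge; apply/orP; right.
    by apply: lt_le_trans tT _; rewrite lerDl mulr_ge0.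
  have A0 t : t <= 0 -> dly (E j) (d j) w t = 0.
    move=> t0; rewrite /dly big1 // => k _; rewrite w0 ?mulr0 // negb_and -leNgt.
    by apply/orP; left; rewrite subr_le0 (le_trans t0) // mulr_ge0.
  have h1 : 0 <= itg (fun t => x t * V t).
    have := monotone_delay_ge0 P0 PC Pm (d j) sx z0 z1.
    have sdx := sqi_dly (zeta j) (d j) sx.
    have -> : itg (fun t => Phi (x t) * (x t - dly (zeta j) (d j) x t)) =
      itg (fun t => x t * V t) => //.
    transitivity (itg (fun t => w t * x t) - itg (fun t => w t * dly (zeta j) (d j) x t)).
      by rewrite -(itgB (sqiM sw sx) (sqiM sw sdx)); apply: itg_eq => t; rewrite mulrBr.
    rewrite (dly_adjoint _ _ sw sx) -(itgB (sqiM sw sx) (sqiM sx sa)); apply: itg_eq => t.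
    rewrite /V; ring.
  have sE := sqi_dly (E j) (d j) sw.
  have so := sqi_obox T sr.
  have h2 : itg (fun t => x t * V t) =
      itg (fun t => obox T t * r t * V t) + itg (fun t => D j t * V t) -
      itg (fun t => dly (E j) (d j) w t * V t).
    have i1 := sqiM so sV; have i2 := sqiM (sD j) sV; have i3 := sqiM sE sV.
    rewrite -(itgD i1 i2) -(itgB (intgD i1 i2) i3).
    apply: itg_ae; [exact: intg_meas (sqiM sx sV)|exact: intg_meas (intgB (intgD i1 i2) i3)|].
    apply: aeS Hx => t ->; rewrite -[fun s => Phi (x s)]/w /D /obox.
    have [t0|t0] := leP t 0.
      by rewrite A0 //= mulr0n; ring.
    have [tT|tT] := leP t T; last by rewrite VT // !mulr0 addr0 subrr.
    by rewrite /= mulr1n; ring.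
  have h3 : itg (fun t => obox T t * r t * V t) <= nrm r * nrm V.
    apply: le_trans (ler_norm _) _; apply: le_trans (cauchy_schwarz so sV) _.
    by rewrite ler_wpM2r ?nrm_ge0 ?nrm_obox.
  have h4 : itg (fun t => D j t * V t) <= nrm (D j) * nrm V.
    by apply: le_trans (ler_norm _) _; exact: cauchy_schwarz.
  have h5 := multiplier_pairing (d j) sw (He j).
  have h6 : (nrm r + nrm (D j)) * nrm V <= (nrm r + nrm (D j)) * (2 * nrm w).
    by rewrite ler_wpM2l ?addr_ge0 ?nrm_ge0.
  rewrite -/V in h5; rewrite mulrC; lra.
(* Only here does [j] tend to infinity: [zeta j] has left the bound, and [D j] tends to 0. *)
have lim : e * nrm w ^+ 2 <= 2 * nrm w * nrm r.
  have Hc : 2 * nrm w * (nrm r + nrm (D j)) @[j --> \oo] --> 2 * nrm w * (nrm r + 0).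
    by apply: cvgM; [exact: cvg_cst|apply: cvgD; [exact: cvg_cst|exact: Dc]].
  by rewrite addr0 in Hc; apply: (cvgr_to_ge Hc); apply: nearW => j; exact: key.
rewrite -/w; have := nrm_ge0 w; rewrite le_eqVlt => /predU1P[<-|w1].
  by rewrite mulr0 mulr_ge0 ?nrm_ge0.
rewrite -(ler_pM2r w1) -mulrA -expr2.
by rewrite (_ : 2 * nrm r * nrm w = 2 * nrm w * nrm r) //; ring.
Qed.

End multiplier_estimate.

(** * Loop equations, truncation and the unbounded horizon *)

Section lure_loop.
Context {R : realType}.
Notation mu := (@lebesgue_measure R).

Lemma ae_neq0 : {ae mu, forall x : R, x != 0}.
Proof.
exists [set 0]; split; [exact: measurable_set1|exact: lebesgue_measure_set1|].
by move=> x /= /negP; rewrite negbK => /eqP.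
Qed.

(** By causality only the values of [e] on ]0, t] matter, so a signal that is merely locally square
    integrable can be exchanged for one to which Young's inequality applies. *)
Lemma ir_conv_cnv (h : impulse R) (e f : R -> R) (t : R) :
  measurable_fun setT (ir_fun h) -> causal (ir_fun h) ->
  measurable_fun setT e -> measurable_fun setT f -> causal f ->
  {ae mu, forall x, 0 < x <= t -> e x = f x} ->
  intg (fun x => ir_fun h x * f (t - x)) ->
  ir_conv h e t = ir_dirac h * e t + cnv (ir_fun h) f t.
Proof.
move=> mh ch me mf cf ef i; rewrite /ir_conv /cnv; congr (_ + _).
rewrite -(itg_refl t i).2 Rintegral_mkcond.
have mht : measurable_fun setT (fun x : R => ir_fun h (t - x)).
  by apply: (measurableT_comp mh); exact: measurable_funB.
apply: itg_ae.
- have -> : (fun x : R => ir_fun h (t - x) * e x) \_ `[0, t] = (fun x : R => box 0 t x * (ir_fun h (t - x) * e x)).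
    by apply/funext => x; rewrite patchE mem_setE in_itv /box; case: ifP => _; rewrite ?mul1r ?mul0r.
  apply: measurable_funM; first exact: intg_meas (intg_box 0 t).
  exact: measurable_funM.
- apply: measurable_funM => //; have -> : (fun x => f (t - (t - x))) = f by apply/funext => x; rewrite subKr.
  exact: mf.
apply: aeS2 ef ae_neq0 => x ex x0; rewrite patchE mem_setE in_itv /= subKr.
have [xn|xp] := ltP x 0; first by rewrite cf // mulr0.
have [xt|xt] := leP x t; last by rewrite (ch (t - x)) ?subr_lt0 ?mul0r.
by rewrite /= ex // lt_neqAle eq_sym x0 xp.
Qed.

Lemma sqi_ae f g : measurable_fun setT g -> {ae mu, forall x, f x = g x} -> sqi f -> sqi g.
Proof.
move=> mg fg [mf fi]; split => //; apply: intg_ae fi; first exact: measurable_funX.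
by apply: aeS fg => x ->.
Qed.

Lemma L2e_obox (f : R -> R) (T : R) : L2e f -> sqi (fun t => obox T t * f t).
Proof.
move=> [mf Hf]; have /L2_sqi sK := Hf `[0, T]%classic (@segment_compact R 0 T).
apply: sqi_le sK; first by apply: measurable_funM => //; exact: measurable_obox.
move=> t; rewrite patchE mem_setE in_itv /obox /=.
case: (boolP (0 < t <= T)) => [/andP[t0 tT]|_]; last by rewrite mul0r normr0.
by rewrite (ltW t0) tT mul1r.
Qed.

(** Since Phi vanishes at 0, truncating its argument truncates its value. The squares then increase
    with the horizon, and the uniform bound passes to the limit by monotone convergence. *)
Lemma nonlinear_output_sqi (Phi e : R -> R) (B : R) :
  measurable_fun setT Phi -> Phi 0 = 0 -> measurable_fun setT e ->
  (forall T, 0 < T -> sqi (fun t => Phi (obox T t * e t)) /\ nrm (fun t => Phi (obox T t * e t)) <= B) ->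
  sqi (fun t => (0 < t)%R%:R * Phi (e t)).
Proof.
move=> mP P0 me H.
have mw : measurable_fun setT (fun t : R => (0 < t)%R%:R * Phi (e t)).
  apply: measurable_funM; last exact: measurableT_comp.
  have -> : (fun t : R => (0 < t)%R%:R) = (\1_(`]0, +oo[%classic : set R) : R -> R).
    by apply/funext => t; rewrite indicE mem_setE in_itv /= andbT.
  exact: measurable_indic.
have E T t : Phi (obox T t * e t) = obox T t * Phi (e t).
  by rewrite /obox; case: (_ < _ <= _); rewrite ?mul1r ?mul0r.
split => //.
suff [] : intg (fun t => ((0 < t)%R%:R * Phi (e t)) ^+ 2) /\
  itg (fun t => ((0 < t)%R%:R * Phi (e t)) ^+ 2) <= B ^+ 2 by [].
apply: (@mono_intg _ (fun n t => Phi (obox n.+1%:R t * e t) ^+ 2)).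
- exact: measurable_funX.
- by move=> n; have [[_ i] _] := H n.+1%:R (ltr0Sn _ n).
- by move=> n t; exact: sqr_ge0.
- move=> t n m nm; rewrite !E !exprMn ler_wpM2r ?sqr_ge0 // /obox.
  case: (boolP (0 < t <= n.+1%:R)) => [/andP[t0 tn]|_]; last by rewrite expr0n sqr_ge0.
  by rewrite t0 (le_trans tn) // ler_nat ltnS.
- move=> t; apply: cvg_near_cst; exists (Num.truncn t).+1 => // n /= hn.
  rewrite E /obox (_ : t <= n.+1%:R) ?andbT //.
  by apply: ltW; apply: (lt_le_trans (truncnS_gt _)); rewrite ler_nat leqW.
- move=> n; have [_ b] := H n.+1%:R (ltr0Sn _ n); rewrite -sqr_nrm.
  by rewrite ler_pXn2r ?nnegrE ?nrm_ge0 // (le_trans _ b) ?nrm_ge0.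
Qed.

End lure_loop.

Theorem mainTheorem6 (R : realType) (G : ratfun R) (g : impulse R)
    (Phi : R -> R) :
  impulse_response (rf_eval G) g ->
  ir_L1 g ->
  Phi 0 = 0 ->
  (exists C : R, 0 < C /\ forall r : R, `|Phi r| <= C * `|r|) ->
  (forall r s : R, 0 <= (r - s) * (Phi r - Phi s)) ->
  (exists (Z : ratfun R) (z : impulse R) (eps : R),
    [/\ impulse_response (rf_eval Z) z,
        ir_L1 z,
        ir_nonneg z /\ (ir_norm1 z < 1)%E,
        0 < eps &
        forall w : R,
          eps <= complex.Re ((1 - rf_eval Z (0 +i* w)) *
                             rf_eval G (0 +i* w))]) ->
  forall alpha : R, 0 < alpha < 1 ->
  lure_stable (fun s : R[i] => rf_eval G (cpow s alpha)) Phi.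
Proof.
move=> Gg gL P0 [C [_ PC]] Pm [Z [z [eps [Zz zL [znn z1] eps0 He]]]] al al01 h Hh.
move=> u1 u2 e1 e2 y1 y2 [[cu1 cu2] [ce1 ce2] _ sys] /L2_sqi su1 /L2_sqi su2 Le1 Le2.
have [mh ch _] := Hh; have [me1 _] := Le1; have [me2 _] := Le2.
have [ih [M [E [zeta [EM Hz HeE Hw]]]]] := fractional_operator Gg gL Zz zL znn z1 eps0 He al01 Hh.
have mP := measurable_Phi Pm.
set h0 := ir_dirac h in Hw *; set hf := ir_fun h in mh ch ih Hw *.
(* Eliminating [e1] from the loop equations leaves e2 = r - h * Phi(e2): [r] is the input that
   drives this reduced loop. *)
pose r t := u2 t + irop h0 hf u1 t.
have sr : sqi r by apply: sqiD => //; exact: sqi_irop.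
have bound T : 0 < T -> sqi (fun t => Phi (obox T t * e2 t)) /\
    nrm (fun t => Phi (obox T t * e2 t)) <= 2 * nrm r / (eps / 2).
  move=> T0; pose x t := obox T t * e2 t.
  have sx : sqi x by exact: L2e_obox.
  pose w t := Phi (x t); have sw : sqi w by exact: (sqi_Phi PC Pm sx).
  split; first exact: sw.
  have e20 : 0 < eps / 2 by rewrite divr_gt0.
  rewrite ler_pdivlMr // mulrC.
  apply: (@loop_estimate R Phi C (eps / 2) T h0 M hf x r E zeta (fun j => j.+1%:R^-1)) => //.
    by move=> t t0; rewrite /x /obox (negbTE t0) mul0r.
  (* [u1 - w] is square integrable on the whole line and agrees with [e1] almost everywhere on ]0,
     T], which is all that the convolution sees up to time [T]. *)
  have sf := sqiB su1 sw.
  have cf : causal (fun t => u1 t - w t).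
    by move=> t t0; rewrite cu1 // /w /x ce2 // mulr0 P0 subrr.
  have [_ _ af] := young2 ih sf.
  have ab := iropB h0 ih su1 sw.
  have ae1 : {ae (@lebesgue_measure R), forall t, e1 t = u1 t - Phi (e2 t)}.
    by apply: aeS sys => t [-> _ _ ->].
  apply: aeS2 (aeS2 (fun t a b => conj a b) af ab) sys => t [ift abt] [E1 E2 E3 E4].
  rewrite /x /obox; case: (boolP (0 < t <= T)) => [/andP[t0 tT]|_]; last by rewrite !mul0r.
  have wE s : 0 < s <= T -> w s = Phi (e2 s) by move=> sT; rewrite /w /x /obox sT mul1r.
  rewrite !mul1r E2 E3 (ir_conv_cnv mh ch me1 _ cf _ ift); [|by have [] := sf|]; last first.
    apply: aeS ae1 => s -> /andP[s0 st]; rewrite wE // s0 //=.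
    exact: le_trans st tT.
  move: abt; rewrite {1}/irop -/hf -/h0 => abt.
  have -> : e1 t = u1 t - w t by rewrite wE ?t0 // E1 E4.
  by rewrite /r -addrA -/w abt.
(* With Phi(e2) square integrable for t > 0, the loop equations give e1 = u1 - Phi(e2) and then, by
   Young's inequality, e2 = u2 + h * e1 in L2. *)
have sw := nonlinear_output_sqi mP P0 me2 bound.
have se1 : sqi e1.
  apply: sqi_ae (sqiB su1 sw) => //.
  apply: aeS2 sys ae_neq0 => t [E1 _ _ E4] t0; rewrite E1 E4.
  have [tp|tn] := ltP 0 t; first by rewrite mul1r.
  by rewrite mul0r ce2 ?P0 // lt_neqAle t0.
have [_ _ af] := young2 ih se1.
split; first exact/L2_sqi.
apply/L2_sqi; apply: sqi_ae (sqiD su2 (sqi_irop h0 ih se1)) => //.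
apply: aeS2 af sys => t ift [_ E2 E3 _].
by rewrite E2 E3 (ir_conv_cnv mh ch me1 me1 ce1 _ ift) //; apply: aeW.
Qed.
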